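(* Let $I$ be an interval on the real line, let $\psi : I \to \mathbb{R}$ be a continuous function and let $\mathcal{C}>0$ be a parameter such that the following two conditions hold: for all real numbers $\delta_1,\delta_2$ with $\delta_1 \neq 0$, $$|\{(x,y)\in I^2 : x-y=\delta_1,\ \psi(x)-\psi(y)=\delta_2\}| \ll_{\mathcal{C}} 1,$$ and for all real numbers $n_1,n_2$, $$|\{(x,y)\in I^2 : x+y=n_1,\ \psi(x)+\psi(y)=n_2\}| \ll_{\mathcal{C}} 1.$$ Let $A \subseteq I$ be a finite, non-empty set, let $p$ be a natural number and let $c = 1/7246$. When $p \geq 2$, we have $$r_{2p+1}(A) \ll_{\mathcal{C}} |A|^{2p-2+\sigma_p},$$ where $\sigma_2 = 2/3$, $\sigma_3 = 1/3$, and $\sigma_p = (1/4-c)\cdot 2^{-p+5}\cdot 3^{-1}$ when $p \geq 4$. Similarly, when $p \geq 3$, we have $$r_{2p}(A) \ll_{\mathcal{C}} |A|^{2p-3+\sigma'_p},$$ where $\sigma'_3 = 1/2$, $\sigma'_4 = 1/4-c/3$, and $\sigma'_p = (1/4-c)\cdot 2^{-p+4}$ when $p \geq 5$.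
   Context: For $\mathbf{n}=(n_1,n_2)\in\mathbb{R}^2$ and $s\in\mathbb{N}$, $r_s(\mathbf{n})$ is the number of $(x_1,\dots,x_s)\in A^s$ with $\sum_{i=1}^s x_i = n_1$ and $\sum_{i=1}^s \psi(x_i) = n_2$, and $r_s(A) = \sup_{\mathbf{n}} r_s(\mathbf{n})$. The notation $X \ll_{\mathcal{C}} Y$ means $|X| \leq K|Y|$ for some constant $K>0$ depending only on $\mathcal{C}$ (after renaming the parameter, the two conditions on $I,\psi$ say that the stated cardinalities are at most $\mathcal{C}$). *)

(* Defs.v *)
From HB Require Import structures.
From mathcomp Require Import all_boot all_order all_algebra finmap.
From mathcomp Require Import all_classical all_reals all_analysis.

Set Implicit Arguments.
Unset Strict Implicit.
Unset Printing Implicit Defensive.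

Import Order.TTheory GRing.Theory Num.Theory.
Import numFieldNormedType.Exports.

Local Open Scope classical_set_scope.
Local Open Scope ring_scope.

(* [fset_set] is empty on infinite sets, hence the explicit finiteness. *)
Definition card_at_most (R : realType) (T : choiceType) (S : set T) (C : R) : Prop :=
  finite_set S /\ (#|` fset_set S|%fset)%:R <= C.

Section Counting.
Variable R : realType.
Implicit Types (I : interval R) (psi : R -> R) (A : {fset R}).

(* A function on [I] is represented by a total [psi]; only its values at
   points of [I] are used here and in the counts below (for [A] inside [I]). *)
Definition diff_condition I psi (C : R) : Prop :=
  forall d1 d2 : R, d1 != 0 ->
    card_at_most [set z : R * R | [/\ z.1 \in I, z.2 \in I,
      z.1 - z.2 = d1 & psi z.1 - psi z.2 = d2]] C.

Definition sum_condition I psi (C : R) : Prop :=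
  forall n1 n2 : R,
    card_at_most [set z : R * R | [/\ z.1 \in I, z.2 \in I,
      z.1 + z.2 = n1 & psi z.1 + psi z.2 = n2]] C.

Definition rep_count psi A (s : nat) (n : R * R) : nat :=
  #|[set x : {ffun 'I_s -> A} |
      (\sum_(i < s) val (x i) == n.1) && (\sum_(i < s) psi (val (x i)) == n.2)]%SET|.

Definition rep_sup psi A (s : nat) : R :=
  sup (range (fun n : R * R => (rep_count psi A s n)%:R)).

Definition c0 : R := 1 / 7246%:R.

(* Only the values at [p >= 2] are meaningful. *)
Definition sigma (p : nat) : R :=
  if p == 2%N then 2 / 3
  else if p == 3%N then 1 / 3
  else (1 / 4 - c0) * 2 `^ (- p%:R + 5) * 3^-1.

(* Only the values at [p >= 3] are meaningful. *)
Definition sigma' (p : nat) : R :=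
  if p == 3%N then 1 / 2
  else if p == 4%N then 1 / 4 - c0 / 3
  else (1 / 4 - c0) * 2 `^ (- p%:R + 4).

End Counting.

Arguments c0 {R}.
Arguments sigma {R} p.
Arguments sigma' {R} p.

(* Main.v *)
(* Let [P] be the set of points [(a, psi a)], [a] in [A], let [N = |P|], and let
   [E_s] be the number of solutions of [p_1 + ... + p_s = q_1 + ... + q_s] in [P].
   Two distinct translates of the graph of [psi] meet in boundedly many points,
   so the crossing lemma gives the Szemeredi-Trotter bound
   [I^3 << m^2 n^2 + m^3 + n^3] for the incidences of [m] translates with [n] points.
   Summing it over the level sets of the representation functions yields
     [sum_p <f(. + p), g> << (|f|_1 |f|_2^2 |g|_1 |g|_2^2)^(1/3) + lower order terms],
   hence [E_(s+1)^2 << N^(2s+1) E_s] and, from [E_2 << N^2],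
   [E_s << N^(2s-3+2^(2-s))]; moreover [r_(2s) <= E_s], and [r_(2s+1)] is bounded
   by one more application of the bilinear estimate.

   For [s = 4] one saves a further power.  Put [Y = P + P], [D = Y - Y], and let
   [rho] count the representations in [D].  If [E_4] is close to [N^(21/4)], then
   [rho (y - z)] is about [N^(5/4)] for about [N^4] pairs in [Y]; since [rho] is
   positive definite, these pairs span about [N^6] triangles.  By Cauchy-Schwarz
   over the edge vectors their number squared is at most
   [N^(-15/4) E_6 sum rho^3], and the incidence bound gives
   [sum rho^3 << N^(13/2) log N] and [E_6 << N^(9+1/16)], a contradiction that
   saves [N^c] in [E_4]; the saving propagates through the recursion. *)

Require Import Defs.
From HB Require Import structures.
From mathcomp Require Import all_boot all_order all_algebra finmap.
From mathcomp Require Import all_classical all_reals all_analysis.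
From mathcomp Require Import perm zify ring lra.

Set Implicit Arguments.
Unset Strict Implicit.
Unset Printing Implicit Defensive.

Import Order.TTheory GRing.Theory Num.Theory.
Import numFieldNormedType.Exports.

Local Open Scope ring_scope.

(** * Crossing lemma for x-monotone arcs *)

(** The crossing lemma is proved without topology: vertices are sorted by abscissa, so a drawing is
    the list of orders of the arcs over the vertices, and a crossing is an inversion between
    consecutive orders. A charging argument stands in for Euler's formula. Ties between curves over
    a vertex, and points with a common abscissa, are handled by a small vertical shift of each
    curve.

    The obstacle in summing over level sets is the exponent 2/3 of the incidence bound; it is
    linearised with free parameters, which amounts to Hoelder's inequality with explicit weights.

    The gain is measured by [d], where [E_4 >= N^(21/4) / d]. In units of [x = N^(1/16)] the
    triangles give [x^252 / d^70 << x^145 x^105], the logarithm being paid by one factor [x]. Hence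
    [x^2 << d^70], and for [d = N^c] with [70 c <= 1/16] this bounds [N]; for bounded [N] the
    trivial estimate of [E_4] is enough. The constant 1/7246 satisfies the condition with room to
    spare. *)

Section Drawing.
Variables (R : realDomainType) (E : finType) (M : nat).
Implicit Types (l r : E -> 'I_M) (H : E -> nat -> R) (F : {set E}).

Definition inner l r (e : E) (i : nat) := (l e < i < r e)%N.

(* The vertices are the points [(i, 0)] with [i < M]; the edge [e] is an x-monotone
   arc from [l e] to [r e], recorded by its heights [H e i] over the vertices.  Only
   the order of the arcs over each vertex matters. *)
Record drawing l r H : Prop := Drawing {
  drawing_lt : forall e, (l e < r e)%N;
  drawing_l : forall e, H e (l e) = 0;
  drawing_r : forall e, H e (r e) = 0;
  drawing_neq0 : forall e i, inner l r e i -> H e i != 0;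
  drawing_inj : forall e f i, e != f -> inner l r e i -> inner l r f i ->
    H e i != H f i }.

(** A strict sign change between consecutive vertices: two arcs that meet at a common end have
    difference 0 there and do not cross. *)
Definition crossing l r H (e f : E) (i : nat) :=
  [&& (l e <= i)%N, (i < r e)%N, (l f <= i)%N, (i < r f)%N
    & (H e i - H f i) * (H e i.+1 - H f i.+1) < 0].

Definition planar l r H F :=
  forall e f i, e \in F -> f \in F -> ~~ crossing l r H e f i.

Definition simple l r F := {in F &, injective (fun e => (l e, r e))}.

(** Without a crossing the order of two arcs can only degenerate to a tie. Inner heights are nonzero
    and distinct, so a tie forces both arcs to end there. *)
Lemma persist_right l r H F e f i j : drawing l r H -> planar l r H F ->
  e \in F -> f \in F -> e != f ->
  (l e <= i)%N -> (l f <= i)%N -> (i <= j)%N -> (j <= r e)%N -> (j <= r f)%N ->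
  H e i < H f i -> H e j < H f j \/ (r e = j :> nat /\ r f = j :> nat).
Proof.
move=> dH pF eF fF ef lei lfi; elim: j => [|j IH].
  by rewrite leqn0 => /eqP->; left.
rewrite leq_eqVlt => /orP[/eqP<-|ij]; first by left.
move=> jre jrf Hlt; case: (IH) => //; try lia.
move=> Hj; have := pF e f j eF fF; rewrite /crossing jre jrf.
have -> /= : (l e <= j)%N by lia.
have -> /= : (l f <= j)%N by lia.
rewrite -leNgt => Hge.
have dj : H e j - H f j < 0 by rewrite subr_lt0.
have : H e j.+1 - H f j.+1 <= 0 by rewrite -(nmulr_rge0 _ dj).
rewrite subr_le0 le_eqVlt => /orP[/eqP Heq|]; last by left.
right.
have [ne|ne] := eqVneq (r e : nat) j.+1; have [nf|nf] := eqVneq (r f : nat) j.+1 => //.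
- exfalso; have := drawing_neq0 dH (e := f) (i := j.+1); rewrite -Heq -ne (drawing_r dH) eqxx.
  by move=> /(_ _)/negP; case=> //; rewrite /inner; lia.
- exfalso; have := drawing_neq0 dH (e := e) (i := j.+1); rewrite Heq -nf (drawing_r dH) eqxx.
  by move=> /(_ _)/negP; case=> //; rewrite /inner; lia.
- exfalso; have := drawing_inj dH (i := j.+1) ef; rewrite Heq eqxx.
  by move=> /(_ _ _)/negP; case=> //; rewrite /inner; lia.
Qed.

(** The mirror image [i -> M - 1 - i], which turns statements on left ends into statements on right
    ends. *)
Definition refl_l r (e : E) : 'I_M := rev_ord (r e).
Definition refl_H H (e : E) (i : nat) := H e (M - i.+1)%N.

Lemma refl_drawing l r H : drawing l r H ->
  drawing (refl_l r) (refl_l l) (refl_H H).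
Proof.
move=> dH; split => [e|e|e|e i|e f i ef]; rewrite /refl_l /refl_H /inner /=.
- by have := drawing_lt dH e; have := ltn_ord (r e); have := ltn_ord (l e); lia.
- rewrite (_ : M - _ = r e)%N ?(drawing_r dH) //; have := ltn_ord (r e); lia.
- rewrite (_ : M - _ = l e)%N ?(drawing_l dH) //; have := ltn_ord (l e); lia.
- move=> h; apply: (drawing_neq0 dH); move: h; rewrite /inner.
  by have := ltn_ord (r e); have := ltn_ord (l e); lia.
- move=> h1 h2; apply: (drawing_inj dH) => //; move: h1 h2; rewrite /inner.
  + by have := ltn_ord (r e); have := ltn_ord (l e); lia.
  + by have := ltn_ord (r f); have := ltn_ord (l f); lia.
Qed.

Lemma refl_crossing l r H e f i : (i.+1 < M)%N ->
  crossing (refl_l r) (refl_l l) (refl_H H) e f i =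
  crossing l r H e f (M - i.+2)%N.
Proof.
move=> iM; rewrite /crossing /refl_l /refl_H /=.
rewrite (_ : (M - i.+2).+1 = M - i.+1)%N; last lia.
have := ltn_ord (r e); have := ltn_ord (l e).
have := ltn_ord (r f); have := ltn_ord (l f) => a b c d.
rewrite [X in _ = [&& _, _, _, _ & X < 0]]mulrC; set X := (_ * _ < 0).
by apply/and5P/and5P => -[? ? ? ? ?]; split => //; lia.
Qed.

Lemma refl_planar l r H F : planar l r H F ->
  planar (refl_l r) (refl_l l) (refl_H H) F.
Proof.
move=> pF e f i eF fF; case: (ltnP i.+1 M) => iM.
  by rewrite refl_crossing //; apply: pF.
rewrite /crossing /refl_l /=; apply/negP => /and5P[_ h _ _ _].
by have := ltn_ord (l e); lia.
Qed.

Lemma refl_simple l r F : simple l r F -> simple (refl_l r) (refl_l l) F.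
Proof.
move=> sF e f eF fF [h1 h2]; apply: sF => //.
by congr (_, _); apply: val_inj => /=; have := ltn_ord (r e); have := ltn_ord (l e);
 have := ltn_ord (r f); have := ltn_ord (l f); lia.
Qed.

Lemma persist_left l r H F e f i j : drawing l r H -> planar l r H F ->
  e \in F -> f \in F -> e != f ->
  (i <= r e)%N -> (i <= r f)%N -> (j <= i)%N -> (l e <= j)%N -> (l f <= j)%N ->
  H e i < H f i -> H e j < H f j \/ (l e = j :> nat /\ l f = j :> nat).
Proof.
move=> dH pF eF fF ef ire irf ji lej lfj Hlt.
have := ltn_ord (r e); have := ltn_ord (l e).
have := ltn_ord (r f); have := ltn_ord (l f) => a b c d.
have := @persist_right _ _ _ F e f (M - i.+1)%N (M - j.+1)%N (refl_drawing dH)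
  (refl_planar pF) eF fF ef.
have Ei : (M - (M - i.+1).+1 = i)%N by lia.
have Ej : (M - (M - j.+1).+1 = j)%N by lia.
rewrite /refl_l /refl_H Ei Ej.
have vl g : (rev_ord (l g) = M - (l g).+1 :> nat)%N by [].
have vr g : (rev_ord (r g) = M - (r g).+1 :> nat)%N by [].
rewrite !vl !vr => h.
case: h => //; try lia; by [left | right; lia].
Qed.

(* [e] is the edge hit first by the downward vertical ray from the vertex [v]. *)
Definition just_below l r H F (e : E) (v : nat) :=
  [&& inner l r e v, H e v < 0 &
   [forall u in F, inner l r u v && (H u v < 0) ==> (H u v <= H e v)]].

(** Edges leaving one vertex are compared over the next vertex; in a simple drawing their heights
    are distinct there ([germ_neq]). *)
Definition top_left l H F (e : E) :=
  [forall f in F, (l f == l e) ==> (H f (l e).+1 <= H e (l e).+1)].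

Lemma germ_neq l r H F e f : drawing l r H -> simple l r F ->
  e \in F -> f \in F -> e != f -> l f = l e -> H f (l e).+1 != H e (l e).+1.
Proof.
move=> dH sF eF fF ef lfe.
have rfe : r f != r e by apply: contra ef => /eqP rfe; apply/eqP/sF; rewrite ?lfe ?rfe.
have := drawing_lt dH e; have := drawing_lt dH f; rewrite lfe => lrf lre.
have [he|he] := eqVneq (r e : nat) (l e).+1.
  rewrite -[in X in _ != X]he (drawing_r dH); apply: (drawing_neq0 dH).
  by rewrite /inner lfe; move: rfe; rewrite -val_eqE /=; lia.
have [hf|hf] := eqVneq (r f : nat) (l e).+1.
  rewrite -[in X in X != _]hf (drawing_r dH) eq_sym; apply: (drawing_neq0 dH).
  by rewrite /inner; lia.
by apply: (drawing_inj dH); rewrite 1?eq_sym // /inner ?lfe; lia.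
Qed.

(** Let [h] be the next edge above [e] among those leaving [l e]. If [h] ends before [e], the wedge
    between them contains a vertex, and the leftmost one sees [e] directly below it; otherwise [h]
    outlasts [e]. *)
Lemma charge_left l r H F (V : {set 'I_M}) e :
  drawing l r H -> planar l r H F -> simple l r F ->
  (forall f, f \in F -> (l f \in V) && (r f \in V)) ->
  e \in F -> ~~ top_left l H F e ->
  (exists2 v, v \in V & just_below l r H F e v) \/
  (exists h, [/\ h \in F, l h = l e, (r e < r h)%N &
    H e (l e).+1 < H h (l e).+1]).
Proof.
move=> dH pF sF FV eF /forall_inPn[h0 h0F]; rewrite negb_imply -ltNge => /andP[/eqP lh0 Hh0].
pose P := [pred f | [&& f \in F, l f == l e & H e (l e).+1 < H f (l e).+1]].
have Ph0 : P h0 by rewrite /= h0F lh0 eqxx Hh0.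
case: (arg_minP (fun f => H f (l e).+1) Ph0) => h /and3P[hF /eqP lh Hh] hmin.
have eh : e != h by apply: contraTneq Hh => ->; rewrite ltxx.
have rhe : r h != r e.
  by apply: contra eh => /eqP rhe; apply/eqP/sF; rewrite ?lh ?rhe.
case: (ltngtP (r h) (r e)) => [rlt|rgt|/val_inj/eqP]; last by rewrite (negPf rhe).
  left.
  have le_e := drawing_lt dH e; have lt_h := drawing_lt dH h.
  rewrite lh in lt_h.
  have eleh j : (l e < j)%N -> (j <= r h)%N -> H e j < H h j.
    move=> h1 h2.
    have lhe : (l h <= (l e).+1)%N by rewrite lh.
    have jre : (j <= r e)%N by apply: leq_trans h2 (ltnW rlt).
    have [//|[A B]] := persist_right dH pF eF hF eh (leqnSn _) lhe h1 jre h2 Hh.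
    by move: rlt; rewrite A B ltnn.
  (* The vertices in the wedge above [e] and on or below [h]; the right end of [h] is one of
     them. *)
  pose Q := [pred v : 'I_M | [&& v \in V, (l e < v)%N, (v <= r h)%N, H e v < 0 & 0 <= H h v]].
  have Qr : Q (r h).
    have /andP[_ rV] := FV _ hF; rewrite /= rV leqnn lt_h (drawing_r dH) lexx andbT /=.
    by rewrite -(drawing_r dH h); apply: eleh.
  case: (arg_minnP (fun v : 'I_M => v : nat) Qr) => v /and5P[vV lv vr Hev Hhv] vmin.
  exists v => //; apply/and3P; split=> //; first by rewrite /inner lv (leq_ltn_trans vr).
  apply/forall_inP => u uF; apply/implyP => /andP[/andP[luv vru] Huv].
  rewrite leNgt; apply/negP => Heu.
  have ue : u != e by apply: contraTneq Heu => ->; rewrite ltxx.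
  have Huh : H u v < H h v by apply: lt_le_trans Hhv.
  have uh : u != h by apply: contraTneq Huh => ->; rewrite ltxx.
  have eu : e != u by rewrite eq_sym.
  have vre : (v <= r e)%N by apply: leq_trans vr (ltnW rlt).
  have vru' := ltnW vru.
  (* An arc [u] between [e] and [v] has no way into the wedge: not through [l e], where [e] and [h]
     both have height 0, not from an earlier vertex of the wedge, and not as an edge leaving [l e]
     between [e] and [h]. *)
  case: (ltngtP (l u) (l e)) => [lt|gt|/val_inj eq].
  - have lhe : (l h <= l e)%N by rewrite lh.
    have [A|[_ A]] := persist_left dH pF eF uF eu vre vru' (ltnW lv) (leqnn _) (ltnW lt) Heu;
      last by rewrite A ltnn in lt.
    have [B|[B _]] := persist_left dH pF uF hF uh vru' vr (ltnW lv) (ltnW lt) lhe Huh;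
      last by rewrite B ltnn in lt.
    by move: (lt_trans A B); rewrite (drawing_l dH) -lh (drawing_l dH) ltxx.
  - suff : Q (l u) by move=> /vmin; rewrite leqNgt luv.
    have lhu : (l h <= l u)%N by rewrite lh ltnW.
    have [A|[A _]] := persist_left dH pF eF uF eu vre vru' (ltnW luv) (ltnW gt) (leqnn _) Heu;
      last by rewrite A ltnn in gt.
    have [B|[_ B]] := persist_left dH pF uF hF uh vru' vr (ltnW luv) (leqnn _) lhu Huh;
      last by rewrite -B lh ltnn in gt.
    rewrite (drawing_l dH) in A B.
    have /andP[lV _] := FV _ uF.
    by rewrite /= lV gt A (ltW B) !andbT (leq_trans (ltnW luv) vr).
  - have lue : (l u <= (l e).+1)%N by rewrite eq.
    have lhe : (l h <= (l e).+1)%N by rewrite lh.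
    have [A|[A _]] := persist_left dH pF eF uF eu vre vru' lv (leqnSn _) lue Heu;
      last by move/eqP: A; rewrite ltn_eqF.
    have [B|[_ B]] := persist_left dH pF uF hF uh vru' vr lv lue lhe Huh;
      last by move/eqP: B; rewrite lh ltn_eqF.
    by have := hmin u; rewrite /P /= uF eq eqxx A => /(_ isT); rewrite leNgt B.
by right; exists h.
Qed.

Lemma top_left_inj l r H F : drawing l r H -> simple l r F ->
  {in [set e in F | top_left l H F e] &, injective l}.
Proof.
move=> dH sF e f; rewrite !inE => /andP[eF te] /andP[fF tf] lef.
apply/eqP; apply: contraT => ef.
have lfe := esym lef.
have := germ_neq dH sF eF fF ef lfe.
move/forall_inP: te => /(_ f fF); rewrite lfe eqxx /= => A.
move/forall_inP: tf => /(_ e eF); rewrite lef eqxx /= lfe => B.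
by rewrite (le_anti (introT andP (conj A B))) eqxx.
Qed.

Lemma refl_just_below l r H F e (v : 'I_M) :
  just_below (refl_l r) (refl_l l) (refl_H H) F e (rev_ord v) =
  just_below l r H F e v.
Proof.
have inn u : inner (refl_l r) (refl_l l) u (rev_ord v) = inner l r u v.
  rewrite /inner /=; have := ltn_ord (r u); have := ltn_ord (l u).
  have := ltn_ord v; clear; lia.
have Hv u : refl_H H u (rev_ord v) = H u v.
  by rewrite /refl_H /=; congr (H u); have := ltn_ord v; clear; lia.
by rewrite /just_below inn Hv; do 2!congr andb; apply: eq_forallb => u; rewrite inn Hv.
Qed.

Lemma just_below_inj l r H F e f v : drawing l r H ->
  e \in F -> f \in F -> just_below l r H F e v -> just_below l r H F f v -> e = f.
Proof.
move=> dH eF fF /and3P[ie He /forall_inP/(_ f fF)] + /and3P[jf Hf /forall_inP/(_ e eF)].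
rewrite ie jf He Hf /= => A B; apply/eqP; apply: contraT => ef.
have := drawing_inj dH ef ie jf.
by rewrite (le_anti (introT andP (conj A B))) eqxx.
Qed.

(** Otherwise some [h] leaves [l e] above [e] and outlasts it, and some [g] reaches [r e] above [e]
    and starts before it. Then [h] is below [g] at [l e] and above it at [r e], so they cross. *)
Lemma left_or_right_charge l r H F (V : {set 'I_M}) e :
  drawing l r H -> planar l r H F -> simple l r F ->
  (forall f, f \in F -> (l f \in V) && (r f \in V)) -> e \in F ->
  ~~ top_left l H F e -> ~~ top_left (refl_l r) (refl_H H) F e ->
  exists2 v, v \in V & just_below l r H F e v.
Proof.
move=> dH pF sF FV eF tl tr.
have [//|[h [hF lh rh Hh]]] := charge_left dH pF sF FV eF tl.
have FV' f : f \in F -> (refl_l r f \in [set rev_ord v | v in V]) &&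
    (refl_l l f \in [set rev_ord v | v in V]).
  by move=> fF; rewrite !(mem_imset _ _ rev_ord_inj) andbC FV.
have [[_ /imsetP[v vV ->]]|] :=
  charge_left (refl_drawing dH) (refl_planar pF) (refl_simple sF) FV' eF tr.
  by rewrite refl_just_below => jv; exists v.
move=> [g [gF lg rg Hg]]; exfalso.
have rge : r g = r e by apply: rev_ord_inj.
have lge : (l g < l e)%N.
  by move: rg; rewrite /refl_l /=; have := ltn_ord (l g); have := ltn_ord (l e); clear; lia.
have re1 : (r e).-1.+1 = r e by rewrite prednK // (leq_trans _ (drawing_lt dH e)).
have Hr u : refl_H H u (refl_l r e).+1 = H u (r e).-1.
  by rewrite /refl_H /refl_l /=; congr (H u); have := ltn_ord (r e); move: re1; clear; lia.
rewrite !Hr {Hr} in Hg.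
have ne u v i : H e i < H u i -> H v i <= H e i -> u != v.
  by move=> A B; apply: contraTneq A => ->; rewrite -leNgt.
have lre := drawing_lt dH e.
have le_r1 : (l e <= (r e).-1)%N by rewrite -ltnS re1.
have lhe : (l h <= l e)%N by rewrite lh.
have reg : (r e <= r g)%N by rewrite rge.
have reh := ltnW rh.
have hg : h != g by apply: contraTneq lge => <-; rewrite lh ltnn.
have eh : e != h by rewrite eq_sym (ne _ _ _ Hh).
have eg : e != g by rewrite eq_sym (ne _ _ _ Hg).
have [A|[_ A]] := persist_right dH pF eF hF eh (leqnSn _) (leqW lhe) lre (leqnn _) reh Hh;
  last by rewrite A ltnn in rh.
have [B|[_ B]] := persist_left dH pF eF gF eg (leq_pred _) (leq_trans (leq_pred _) reg)
  le_r1 (leqnn _) (ltnW lge) Hg; last by rewrite B ltnn in lge.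
have Hhl : H h (l e) = 0 by rewrite -lh (drawing_l dH).
have Hgr : H g (r e) = 0 by rewrite -rge (drawing_r dH).
have Hhg : H h (l e) < H g (l e) by rewrite Hhl -[0](drawing_l dH e).
have [D|[D _]] := persist_right dH pF hF gF hg lhe (ltnW lge) (ltnW lre) reh reg Hhg;
  last by rewrite D ltnn in rh.
by move: (lt_trans A D); rewrite Hgr (drawing_r dH) ltxx.
Qed.

(** Each edge is the top one at its left end, the top one at its right end, or directly below a
    vertex; each of the three charges is injective. *)
Lemma card_simple_planar l r H F (V : {set 'I_M}) :
  drawing l r H -> planar l r H F -> simple l r F ->
  (forall f, f \in F -> (l f \in V) && (r f \in V)) ->
  (#|F| <= 3 * #|V|)%N.
Proof.
move=> dH pF sF FV.
pose TL := [set e in F | top_left l H F e].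
pose TR := [set e in F | top_left (refl_l r) (refl_H H) F e].
pose VB := [set e in F | [exists v in V, just_below l r H F e v]].
have cov : F \subset TL :|: TR :|: VB.
  apply/fintype.subsetP => e eF; rewrite !inE eF /=.
  case tl: (top_left l H F e) => //=.
  case tr: (top_left (refl_l r) (refl_H H) F e) => //=.
  have [v vV jv] := left_or_right_charge dH pF sF FV eF (negbT tl) (negbT tr).
  by apply/exists_inP; exists v.
have cTL : (#|TL| <= #|V|)%N.
  rewrite -(card_in_imset (top_left_inj dH sF)); apply/subset_leq_card/fintype.subsetP => _ /imsetP[e + ->].
  by rewrite inE => /andP[/FV/andP[]].
have cTR : (#|TR| <= #|V|)%N.
  rewrite -(card_in_imset (top_left_inj (refl_drawing dH) (refl_simple sF))).
  rewrite -(card_imset V rev_ord_inj); apply/subset_leq_card/fintype.subsetP => _ /imsetP[e + ->].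
  by rewrite inE /refl_l (mem_imset _ _ rev_ord_inj) => /andP[/FV/andP[]].
have cVB : (#|VB| <= #|V|)%N.
  pose p e := [pick v in V | just_below l r H F e v].
  have pP e : e \in VB -> exists v, [/\ p e = Some v, v \in V & just_below l r H F e v].
    rewrite inE => /andP[_ /exists_inP[v vV jv]]; rewrite /p.
    by case: pickP => [u /andP[uV ju]|/(_ v)]; [exists u|rewrite vV jv].
  have pi : {in VB &, injective p}.
    move=> e f eV fV; have [v [-> _ jv]] := pP e eV; have [u [-> _ ju]] := pP f fV => -[vu].
    rewrite -vu in ju; move: eV fV; rewrite !inE => /andP[eF _] /andP[fF _].
    exact: just_below_inj jv ju.
  rewrite -(card_in_imset pi) -(card_imset V (@Some_inj _)).
  apply/subset_leq_card/fintype.subsetP => _ /imsetP[e /pP[v [-> vV _]] ->].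
  exact: imset_f.
apply: leq_trans (subset_leq_card cov) _.
apply: leq_trans (leq_card_setU _ _) _; rewrite (mulSn 2) addnC leq_add //.
by apply: leq_trans (leq_card_setU _ _) _; rewrite mul2n -addnn leq_add.
Qed.

End Drawing.

(** * Drawings with crossings, and the uncrossing of adjacent edges *)

Section Crossings.
Variables (R : realDomainType) (E : finType) (M : nat) (l r : E -> 'I_M).
Implicit Types (H : E -> nat -> R) (F : {set E}).

Definition cross_pairs H F : {set E * E} :=
  [set p | [&& p.1 \in F, p.2 \in F & [exists i : 'I_M, crossing l r H p.1 p.2 i]]].

(** Deleting every edge that takes part in a crossing leaves a planar drawing; keeping one edge for
    each pair of ends then costs a factor [k]. *)
Lemma card_drawing H F (V : {set 'I_M}) (k : nat) : drawing l r H ->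
  (forall a c, (#|[set e in F | (l e, r e) == (a, c)]| <= k)%N) ->
  (forall f, f \in F -> (l f \in V) && (r f \in V)) ->
  (#|F| <= 3 * k * #|V| + #|cross_pairs H F|)%N.
Proof.
move=> dH Fk FV.
pose F0 := F :\: [set p.1 | p in cross_pairs H F].
have F0F e : e \in F0 -> e \in F by rewrite inE => /andP[].
have pF0 : planar l r H F0.
  move=> e f i eF fF; apply/negP => cr; have iM : (i < M)%N.
    by case/and5P: cr => _ ire _ _ _; apply: ltn_trans ire (ltn_ord _).
  move: (eF); rewrite inE => /andP[/negP + _]; apply; apply/imsetP; exists (e, f) => //.
  rewrite inE /= (F0F _ eF) (F0F _ fF) /=; apply/existsP; by exists (Ordinal iM).
pose rep e := odflt e [pick f in F0 | (l f, r f) == (l e, r e)].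
have repP e : e \in F0 -> rep e \in F0 /\ (l (rep e), r (rep e)) = (l e, r e).
  by move=> eF; rewrite /rep; case: pickP => [f /andP[fF /eqP]|/(_ e)] //=; rewrite eF eqxx.
have repE e f : (l e, r e) = (l f, r f) -> e \in F0 -> rep e = rep f.
  move=> ef eF; rewrite /rep -ef; case: pickP => [//|/(_ e)].
  by rewrite eF eqxx.
pose F1 := [set rep e | e in F0].
have sF1 : simple l r F1.
  move=> _ _ /imsetP[e eF ->] /imsetP[f fF ->] h.
  by apply: repE => //; rewrite -(repP e eF).2 -(repP f fF).2.
have F1F0 e : e \in F1 -> e \in F0 by case/imsetP => f /repP[+ _] -> .
have c1 : (#|F1| <= 3 * #|V|)%N.
  apply: (card_simple_planar dH) sF1 _ => [e f i /F1F0 eF /F1F0 fF|f /F1F0/F0F]; [exact: pF0|exact: FV].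
have c0 : (#|F0| <= #|F1| * k)%N.
  rewrite -sum1_card (partition_big rep (mem F1)) /=; last by move=> e eF; apply: imset_f.
  rewrite -sum_nat_const; apply: leq_sum => f _; rewrite sum1_card.
  apply: leq_trans (Fk (l f) (r f)); apply/subset_leq_card/fintype.subsetP => e.
  rewrite unfold_in => /andP[eF /eqP <-]; rewrite inE (F0F _ eF) /=.
  by rewrite (repP e eF).2.
have : (#|F| <= #|F0| + #|cross_pairs H F|)%N.
  rewrite -(cardsID [set p.1 | p in cross_pairs H F] F) addnC leq_add //.
  apply: leq_trans (leq_imset_card (@fst E E) _).
  exact/subset_leq_card/subsetIr.
move=> h; apply: leq_trans h _; rewrite leq_add2r.
by apply: leq_trans c0 _; rewrite mulnAC leq_mul2r c1 orbT.
Qed.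

Definition inverted (u v : E -> R) (e f : E) : bool := (u e - u f) * (v e - v f) < 0.

Definition inversions (act : pred E) (u v : E -> R) : nat :=
  (\sum_(e | act e) \sum_(f | act f) inverted u v e f)%N.

Definition alive (i : nat) : pred E := fun e => (l e <= i < r e)%N.

(** Crossings counted with multiplicity over ordered pairs: the potential that decreases under
    uncrossing, and an upper bound for [cross_pairs]. *)
Definition total_inversions H : nat :=
  (\sum_(i < M) inversions (alive i) (H^~ i) (H^~ i.+1))%N.

Lemma crossingE H e f i :
  crossing l r H e f i = [&& alive i e, alive i f & inverted (H^~ i) (H^~ i.+1) e f].
Proof. by rewrite /crossing /alive /inverted -!andbA. Qed.

Lemma inversions_perm (s : {perm E}) (act : pred E) u v : (forall e, act (s e) = act e) ->
  inversions act (u \o s) (v \o s) = inversions act u v.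
Proof.
move=> acts; rewrite /inversions [RHS](reindex_inj (@perm_inj _ s)).
apply: eq_big => [e|e _]; first by rewrite acts.
by rewrite [RHS](reindex_inj (@perm_inj _ s)); apply: eq_big => [f|f _] //; rewrite acts.
Qed.

Lemma sum_split2 (act : pred E) (t : E -> E -> nat) e f : act e -> act f -> e != f ->
  (\sum_(x | act x) \sum_(y | act y) t x y =
   (t e e + t f f + (t e f + t f e)) +
   \sum_(y | [&& act y, y != e & y != f]) (t e y + t f y + (t y e + t y f)) +
   \sum_(x | [&& act x, x != e & x != f]) \sum_(y | [&& act y, y != e & y != f]) t x y)%N.
Proof.
move=> ae af ef.
have S (g : E -> nat) : (\sum_(x | act x) g x = g e + g f +
    \sum_(x | [&& act x, x != e & x != f]) g x)%N.
  rewrite (bigD1 e) //= (bigD1 f) /= ?af 1?eq_sym // addnA; congr addn.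
  by apply: eq_bigl => x; rewrite -andbA.
rewrite S !S (eq_bigr _ (fun x _ => S (t x))) !big_split /=.
lia.
Qed.

(** The pair [e], [f] stops being inverted, and the inversions with any third element do not
    increase, by comparing its position with those of [e] and [f] in both orders. *)
Lemma inversions_swap (act : pred E) u v e f : act e -> act f ->
  u e < u f -> v f < v e ->
  (inversions act (u \o tperm e f) v < inversions act u v)%N.
Proof.
move=> ae af ue vf.
have ef : e != f by apply: contraTneq ue => ->; rewrite ltxx.
rewrite /inversions !(@sum_split2 act _ e f) // -addnA -[X in (_ < X)%N]addnA.
rewrite -addSn leq_add //.
  rewrite /inverted /= tpermL tpermR !subrr !mul0r !ltxx /=.
  have -> : (u f - u e) * (v e - v f) < 0 = false.
    by apply/negbTE; rewrite -leNgt mulr_ge0 // subr_ge0 ltW.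
  have -> : (u e - u f) * (v f - v e) < 0 = false.
    by apply/negbTE; rewrite -leNgt mulr_le0 // subr_le0 ltW.
  have -> : (u e - u f) * (v e - v f) < 0 by rewrite pmulr_llt0 ?subr_gt0 ?subr_lt0.
  by rewrite addn_gt0.
apply: leq_add.
  apply: leq_sum => y /and3P[_ ye yf].
  rewrite /inverted /= tpermL tpermR tpermD 1?eq_sym //.
  have sym (a b c d : R) : ((a - b) * (c - d) < 0) = ((b - a) * (d - c) < 0).
    by rewrite -mulrNN !opprB.
  rewrite !(sym (u y)).
  suff : (((u f - u y) * (v e - v y) < 0)%R + ((u e - u y) * (v f - v y) < 0)%R <=
          ((u e - u y) * (v e - v y) < 0)%R + ((u f - u y) * (v f - v y) < 0)%R)%N by lia.
  rewrite !mulr_lt0 !subr_eq0 !subr_lt0.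
  case: (ltgtP (u e) (u y)) => h1; case: (ltgtP (u f) (u y)) => h2;
  case: (ltgtP (v e) (v y)) => h3; case: (ltgtP (v f) (v y)) => h4 //=;
  by exfalso; move: ue vf h1 h2 h3 h4; clear; lra.
apply: leq_sum => x /and3P[_ xe xf]; apply: leq_sum => y /and3P[_ ye yf].
by rewrite /inverted /= !tpermD 1?eq_sym.
Qed.

Lemma inversions_swap_at (act : pred E) u v e f : act e -> act f -> inverted u v e f ->
  (inversions act (u \o tperm e f) v < inversions act u v)%N.
Proof.
move=> ae af; rewrite /inverted mulr_lt0 => /and3P[].
rewrite !subr_eq0 !subr_lt0 => ne1 ne2.
case: ltgtP ne1 => // h1 _; case: ltgtP ne2 => // h2 _ _.
  exact: inversions_swap.
by rewrite tpermC; apply: inversions_swap.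
Qed.

(* Uncrosses two edges that share their endpoint on one side of the crossing. *)
Definition swap_side H (e f : E) (j : nat) (left : bool) : E -> nat -> R :=
  fun x i => if (i <= j)%N == left then H (tperm e f x) i else H x i.

(** The parts exchanged are those that contain the common end, so every arc keeps its own two
    ends. *)
Lemma swap_side_drawing H e f j left : drawing l r H -> crossing l r H e f j ->
  (if left then l e == l f else r e == r f) -> drawing l r (swap_side H e f j left).
Proof.
move=> dH /and5P[lej jre lfj jrf _] lr.
have inn x i : (i <= j)%N == left -> inner l r (tperm e f x) i = inner l r x i.
  move=> ij; rewrite /inner; case: tpermP => // ->; move: lr ij lej jre lfj jrf;
  by case: left => /eqP ->; clear; lia.
split => [x|x|x|x i|x y i xy].
- exact: drawing_lt dH x.
- rewrite /swap_side; case: ifP => [ij|_]; last exact: (drawing_l dH).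
  case: tpermP => [xe|xf|_ _]; last exact: (drawing_l dH).
    move: lr ij; clear inn; rewrite xe; case: left => [/eqP -> _|_]; first exact: (drawing_l dH).
    by rewrite lej.
  move: lr ij; clear inn; rewrite xf; case: left => [/eqP <- _|_]; first exact: (drawing_l dH).
  by rewrite lfj.
- rewrite /swap_side; case: ifP => [ij|_]; last exact: (drawing_r dH).
  case: tpermP => [xe|xf|_ _]; last exact: (drawing_r dH).
    move: lr ij; clear inn; rewrite xe; case: left => [_|/eqP -> _]; last exact: (drawing_r dH).
    by rewrite leqNgt jre.
  move: lr ij; clear inn; rewrite xf; case: left => [_|/eqP <- _]; last exact: (drawing_r dH).
  by rewrite leqNgt jrf.
- rewrite /swap_side; case: ifP => [ij|_]; last exact: (drawing_neq0 dH).
  by move=> xi; apply: (drawing_neq0 dH); rewrite inn.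
- rewrite /swap_side; case: ifP => [ij|_]; last exact: (drawing_inj dH).
  move=> xi yi; apply: (drawing_inj dH); rewrite ?inn //.
  by rewrite (inj_eq perm_inj).
Qed.

(** Only the step from [j] to [j.+1] changes: at any other step either both orders are permuted or
    neither is. *)
Lemma swap_side_inversions H e f j left : crossing l r H e f j ->
  (if left then l e == l f else r e == r f) ->
  (total_inversions (swap_side H e f j left) < total_inversions H)%N.
Proof.
move=> cr lr; have := cr; rewrite crossingE => /and3P[ae af inv].
have jM : (j < M)%N by case/andP: ae => _ h; apply: ltn_trans h (ltn_ord _).
rewrite /total_inversions (bigD1 (Ordinal jM)) //= [X in (_ < X)%N](bigD1 (Ordinal jM)) //=.
have K : involutive (tperm e f) := tpermK e f.
rewrite -addSn; apply: leq_add.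
  have swapj i : swap_side H e f j left ^~ i =
    if (i <= j)%N == left then (H^~ i) \o tperm e f else H^~ i.
    by apply/funext => x; rewrite /swap_side; case: ifP.
  rewrite !swapj leqnn ltnn; case: left {lr swapj} => /=.
    exact: inversions_swap_at.
  have aK x : alive j (tperm e f x) = alive j x.
    by case: tpermP => // ->; rewrite ?ae ?af.
  rewrite -(inversions_perm _ _ aK).
  rewrite (_ : (_ \o tperm e f) \o tperm e f = H^~ j.+1); last first.
    by apply/funext => x /=; rewrite K.
  exact: inversions_swap_at.
apply: leq_sum => i; rewrite -val_eqE /= => ij.
have sij : ((i.+1 <= j) = (i <= j))%N by move: ij; clear; lia.
have [h|h] := boolP ((i <= j)%N == left); last first.
  by apply: eq_leq; congr inversions; apply/funext => x; rewrite /swap_side ?sij (negPf h).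
have ai x : alive i (tperm e f x) = alive i x.
  move: ae af h ij lr; rewrite /alive; case: tpermP => // ->;
  by case: left => /andP[? ?] /andP[? ?] ? ? /eqP ->; lia.
rewrite -(inversions_perm (H^~ i) (H^~ i.+1) ai).
by apply: eq_leq; congr inversions; apply/funext => x; rewrite /swap_side ?sij h.
Qed.

(** Descent on [total_inversions]. Adjacent edges must not cross because a sampled crossing has
    probability [t^-4] only if its four ends are distinct. *)
Lemma uncross H : drawing l r H -> exists H',
  [/\ drawing l r H', (total_inversions H' <= total_inversions H)%N &
    forall e f i, crossing l r H' e f i -> l e != l f /\ r e != r f].
Proof.
have [n] := ubnP (total_inversions H); elim: n H => // n IH H Hn dH.
have [/existsP[e /existsP[f /existsP[j /andP[cr adj]]]]|no] := boolP
    [exists e, exists f, exists j : 'I_M,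
      crossing l r H e f j && ((l e == l f) || (r e == r f))].
  have {adj} [left lr] : exists left : bool, if left then l e == l f else r e == r f.
    by case/orP: adj => h; [exists true|exists false].
  have [] := IH (swap_side H e f j left).
  - exact: leq_trans (swap_side_inversions cr lr) Hn.
  - exact: swap_side_drawing.
  - move=> H' [dH' iH' nH']; exists H'; split => //.
    exact: leq_trans iH' (ltnW (swap_side_inversions cr lr)).
exists H; split => // e f i cr; have iM : (i < M)%N.
  by case/and5P: cr => _ ire _ _ _; apply: ltn_trans ire (ltn_ord _).
move: no; rewrite negb_exists => /forallP/(_ e); rewrite negb_exists => /forallP/(_ f).
rewrite negb_exists => /forallP/(_ (Ordinal iM)) /=.
by rewrite cr /= negb_or => /andP.
Qed.

Lemma card_cross_pairs H : (#|cross_pairs H [set: E]| <= total_inversions H)%N.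
Proof.
rewrite /total_inversions /inversions.
apply: (@leq_trans (\sum_(i < M) \sum_e \sum_f crossing l r H e f i)); last first.
  apply: leq_sum => i _; rewrite [X in (_ <= X)%N]big_mkcond; apply: leq_sum => e _.
  rewrite [X in (_ <= if _ then X else _)%N]big_mkcond.
  case: ifP => ae; last by rewrite big1 // => f _; rewrite crossingE ae.
  by apply: leq_sum => f _; rewrite crossingE ae /=; case: (alive i f).
under eq_bigr do rewrite pair_bigA /=.
rewrite exchange_big /= -sum1_card [X in (X <= _)%N]big_mkcond; apply: leq_sum => p _.
rewrite !inE /=; case: ifP => // /existsP[i cr].
by rewrite (bigD1 i) //= cr.
Qed.
End Crossings.

(** * Random vertex samples, with expectations written as counts *)

Section Sampling.
Variables (M t : nat).
Implicit Types (A : {set 'I_M}) (phi : {ffun 'I_M -> 'I_t.+1}).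

(** For a uniform [phi], each vertex is kept independently with probability [1 / t.+1]. *)
Definition sample phi : {set 'I_M} := [set v | phi v == ord0].

Lemma card_sample A : (#|[pred phi | A \subset sample phi]| * t.+1 ^ #|A| = t.+1 ^ M)%N.
Proof.
have -> : #|[pred phi | A \subset sample phi]| = #|pffun_on (ord0 : 'I_t.+1) (~: A) predT|.
  apply: eq_card => phi; rewrite !inE; apply/fintype.subsetP/pffun_onP.
    move=> h; split => [|x _] //; apply/fintype.subsetP => v; rewrite !inE /=.
    by apply: contra => /h; rewrite inE.
  move=> [/fintype.subsetP h _] v vA; rewrite inE; apply: contraT => nv.
  by have := h v; rewrite !inE /= vA => /(_ nv).
by rewrite card_pffun_on card_ord -expnD addnC cardsC card_ord.
Qed.

(** Linearity of expectation; the spare factor [t.+1 ^ b] brings supports of different sizes to a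
    common denominator. *)
Lemma sum_sample (T : finType) (P : pred T) (A : T -> {set 'I_M}) (a b : nat) :
  (forall x, P x -> #|A x| = a) ->
  ((\sum_(phi : {ffun 'I_M -> 'I_t.+1}) #|[set x | P x & A x \subset sample phi]|)
     * t.+1 ^ (a + b) = #|P| * t.+1 ^ M * t.+1 ^ b)%N.
Proof.
move=> cA.
have -> : (\sum_(phi : {ffun 'I_M -> 'I_t.+1}) #|[set x | P x & A x \subset sample phi]| =
   \sum_(x | P x) #|[pred phi | A x \subset sample phi]|)%N.
  transitivity (\sum_(phi : {ffun 'I_M -> 'I_t.+1}) \sum_(x | P x) (A x \subset sample phi))%N.
    apply: eq_bigr => phi _; rewrite -sum1dep_card big_mkcondr /=.
    by apply: eq_bigr => x _; case: (_ \subset _).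
  rewrite exchange_big /=; apply: eq_bigr => x _.
  rewrite -[RHS]sum1_card [RHS]big_mkcond; apply: eq_bigr => phi _.
  by rewrite !inE; case: (_ \subset _).
rewrite expnD mulnA; congr muln; rewrite big_distrl /= -sum_nat_const.
by apply: eq_bigr => x Px; rewrite -(cA x Px) card_sample.
Qed.

End Sampling.

Lemma card_set_seq (T : finType) (s : seq T) : uniq s -> #|[set x in s]| = size s.
Proof. by move=> us; rewrite cardsE; apply/card_uniqP. Qed.

Lemma set_seq_subset (T : finType) (s : seq T) (B : {set T}) :
  ([set x in s] \subset B) = all (mem B) s.
Proof.
by apply/fintype.subsetP/allP => h x; [have := h x; rewrite inE|rewrite inE; apply: h].
Qed.

(** * The crossing lemma with bounded edge multiplicity *)

Section CrossingLemma.
Variables (R : realDomainType) (E : finType) (M k : nat) (l r : E -> 'I_M).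
Hypothesis lrk : forall a c, (#|[set e | (l e, r e) == (a, c)]| <= k)%N.

(** Average of [card_drawing] over vertex samples, multiplied by [t^4]: vertices, edges and
    crossings survive with probabilities [t^-1], [t^-2] and [t^-4]. *)
Lemma crossing_sampled (H : E -> nat -> R) (t : nat) : drawing l r H -> (0 < t)%N ->
  (forall e f i, crossing l r H e f i -> l e != l f /\ r e != r f) ->
  (#|E| * t ^ 2 <= 3 * k * M * t ^ 3 + #|cross_pairs l r H [set: E]|)%N.
Proof.
case: t => // t dH _ unc.
pose Fs phi := [set e | true & [set x in [:: l e; r e]] \subset sample (t := t) phi].
have ends phi e : ([set x in [:: l e; r e]] \subset sample (t := t) phi) =
    (l e \in sample phi) && (r e \in sample phi).
  by rewrite set_seq_subset /= andbT.
have main phi : (#|Fs phi| <= 3 * k * #|sample phi| + #|cross_pairs l r H (Fs phi)|)%N.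
  apply: (card_drawing dH) => [a c|f]; last by rewrite inE /= ends.
  apply: leq_trans (lrk a c); apply/subset_leq_card/fintype.subsetP => e.
  by rewrite !inE => /andP[_].
have {main} : ((\sum_phi #|Fs phi|) * t.+1 ^ 4 <=
    3 * k * ((\sum_(phi : {ffun 'I_M -> 'I_t.+1}) #|sample phi|) * t.+1 ^ 4)
    + (\sum_phi #|cross_pairs l r H (Fs phi)|) * t.+1 ^ 4)%N.
  rewrite [X in (_ <= X + _)%N]mulnA -mulnDl leq_mul2r big_distrr -big_split /=.
  exact: leq_sum.
rewrite (@sum_sample _ _ _ xpredT (fun e => [set x in [:: l e; r e]]) 2 2); last first.
  by move=> e _; rewrite card_set_seq //= inE andbT -val_eqE /= ltn_eqF // (drawing_lt dH).
have -> : ((\sum_(phi : {ffun 'I_M -> 'I_t.+1}) #|sample phi|) * t.+1 ^ 4 = M * t.+1 ^ M * t.+1 ^ 3)%N.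
  rewrite -[X in (_ = X * _ * _)%N](card_ord M) -(@sum_sample _ t _ xpredT (@finset.set1 _) 1 3); last first.
    by move=> v _; rewrite cards1.
  congr muln; apply: eq_bigr => phi _; apply: eq_card => v.
  by rewrite !inE finset.sub1set inE.
pose C := cross_pairs l r H [set: E].
have -> : ((\sum_phi #|cross_pairs l r H (Fs phi)|) * t.+1 ^ 4 = #|C| * t.+1 ^ M)%N.
  rewrite -[RHS]muln1 -[X in (_ = _ * X)%N](expn0 t.+1) -(@sum_sample _ t _ (mem C)
    (fun p => [set x in [:: l p.1; r p.1; l p.2; r p.2]]) 4 0).
    congr muln; apply: eq_bigr => phi _; apply: eq_card => -[e f].
    rewrite !inE /= !set_seq_subset /= !inE !andbT.
    by case: [exists i, _]; rewrite ?andbT ?andbF //= -!andbA.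
  move=> [e f]; rewrite !inE /= => /existsP[i cr]; have [lne rne] := unc _ _ _ cr.
  case/and5P: cr => lei ire lfi irf _; apply: card_set_seq => /=.
  by move: lne rne lei ire lfi irf; rewrite !inE -!val_eqE /=; clear; lia.
rewrite cardT -cardE -mulnA mulnCA [X in (_ <= X + _)%N](_ : _ = t.+1 ^ M * (3 * k * M * t.+1 ^ 3))%N; last first.
  by rewrite !mulnA [RHS]mulnC !mulnA; lia.
rewrite [X in (_ <= _ + X)%N]mulnC -mulnDr leq_mul2l => /orP[|//].
by rewrite expn_eq0.
Qed.

Lemma crossing_lemma (H : E -> nat -> R) : drawing l r H ->
  (#|E| <= 6 * k * M)%N \/
  (#|E| ^ 3 <= 288 * k ^ 2 * M ^ 2 * total_inversions l r H)%N.
Proof.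
move=> dH; have [H' [dH' iH' unc]] := uncross dH.
have key t : (0 < t)%N -> (#|E| * t ^ 2 <= 3 * k * M * t ^ 3 + total_inversions l r H)%N.
  move=> t0; have [_ h] : True /\ (#|cross_pairs l r H' [set: E]| <= total_inversions l r H)%N.
    by split=> //; apply: leq_trans iH'; apply: card_cross_pairs.
  by apply: leq_trans (crossing_sampled dH' t0 unc) _; rewrite leq_add2l.
move: key; move: (total_inversions _ _ _) => X; move: #|E| => e.
clear; move=> key; case: (leqP e (6 * k * M)%N) => [|he]; [by left|right].
(* Otherwise [key] at [t = X + 1] would give [e (X + 1)^2 <= X] with [e > 0]. *)
have kM0 : (0 < 6 * k * M)%N.
  rewrite lt0n; apply/negP => /eqP q0; have := key X.+1 isT.
  have -> : (3 * k * M = 0)%N by lia.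
  by rewrite mul0n add0n; nia.
(* With this [t] the vertex term is at most half of the left side of [key], and rounding down loses
   at most a factor 2. *)
pose t := (e %/ (6 * k * M))%N.
have t0 : (0 < t)%N by rewrite divn_gt0 // ltnW.
have te : (t * (6 * k * M) <= e)%N by apply: leq_divM.
have et : (e <= 2 * t * (6 * k * M))%N.
  have := ltn_ceil e kM0; rewrite -/t; move: (6 * k * M)%N t0 => q; clear; nia.
have h := key t t0.
have h2 : (e * t ^ 2 <= 2 * X)%N.
  have : (3 * k * M * t ^ 3 * 2 <= e * t ^ 2)%N.
    rewrite (_ : (3 * k * M * t ^ 3 * 2) = t * (6 * k * M) * t ^ 2)%N; last by lia.
    by rewrite leq_mul2r te orbT.
  by move: h; clear; lia.
have : (e ^ 2 <= (2 * t * (6 * k * M)) ^ 2)%N by rewrite leq_exp2r.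
move=> h3; rewrite expnS.
apply: (@leq_trans (e * (2 * t * (6 * k * M)) ^ 2)); first by rewrite leq_mul2l h3 orbT.
rewrite (_ : (e * _ = 144 * k ^ 2 * M ^ 2 * (e * t ^ 2))%N); last by lia.
rewrite (_ : 288 * k ^ 2 * M ^ 2 * X = 144 * k ^ 2 * M ^ 2 * (2 * X))%N; last by lia.
by rewrite leq_mul2l h2 orbT.
Qed.

End CrossingLemma.

Local Open Scope classical_set_scope.
Local Open Scope ring_scope.

(** * Incidences with translates of a graph *)

(** Provides room for a perturbation that reverses no strict inequality. *)
Lemma finite_family_separated (R : realFieldType) (T : finType) (g : T -> R) :
  exists2 eps, 0 < eps & forall t, g t != 0 -> eps < `|g t|.
Proof.
suff [eps e0 h] : exists2 eps, 0 < eps & forall t, t \in enum T -> g t != 0 -> eps < `|g t|.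
  by exists eps => // t; apply: h; rewrite mem_enum.
elim: (enum T) => [|a s [eps e0 IH]]; first by exists 1.
exists (if g a == 0 then eps else Num.min eps (`|g a| / 2)) => [|t].
  by case: ifPn => // ga; rewrite lt_min e0 divr_gt0 ?normr_gt0.
rewrite inE => /predU1P[->|ts] nz.
  rewrite (negPf nz) gt_min; apply/ssrbool.orP; right.
  by rewrite ltr_pdivrMr // ltr_pMr ?normr_gt0 ?ltr1n.
by case: ifPn => // _; rewrite ?gt_min IH.
Qed.

Lemma within_continuous_translate (R : realType) (I : interval R) (psi : R -> R) (b u v : R) :
  {within [set` I], continuous psi} ->
  (forall x, x \in `[u, v] -> x - b \in I) ->
  {within `[u, v], continuous (fun x => psi (x - b))}.
Proof.
move=> /subspace_continuousP cpsi sub; apply/subspace_continuousP => x /= xuv.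
apply: (cvg_comp _ _ _ (cpsi (x - b) (sub x xuv))) => W /= [e /= e0 We].
exists e => //= t te tuv; apply: We; last exact: sub.
rewrite /ball /=; have -> // : x - b - (t - b) = x - t by rewrite opprB addrA subrK.
Qed.

Definition incidences (G : zmodType) (P X Z : seq G) : nat :=
  (\sum_(x <- X) count (fun p => (x + p)%R \in Z) P)%N.

Lemma cube_add_le (a b : nat) : ((a + b) ^ 3 <= 4 * (a ^ 3 + b ^ 3))%N.
Proof.
wlog ab : a b / (a <= b)%N.
  by move=> h; have [/h//|/ltnW/h] := leqP a b; rewrite addnC [(b ^ 3 + _)%N]addnC.
rewrite -(subnKC ab); move: (b - a)%N => d.
rewrite !expnS !expn0 !muln1; nia.
Qed.

Lemma sum_in_injective_le (T J : finType) (P : pred T) (c : T -> J) (F : J -> nat) :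
  {in P &, injective c} -> (\sum_(e | P e) F (c e) <= \sum_j F j)%N.
Proof.
move=> ci; rewrite -(big_imset F ci) /= [X in (X <= _)%N]big_mkcond /=.
by apply: leq_sum => j _; case: ifP.
Qed.

Lemma sum_pred_le1 (T : finType) (P : pred T) :
  (forall i j, P i -> P j -> i = j) -> (\sum_i P i <= 1)%N.
Proof.
move=> P1; rewrite (eq_bigr (fun i => if P i then 1%N else 0%N)); last by move=> i _; case: (P i).
rewrite -big_mkcond sum1_card.
by apply/card_le1_eqP => i j Pi Pj; apply: P1.
Qed.

(** * The arrangement of translates of the graph as a drawing *)

Section Curves.
Variables (R : realType) (I : interval R) (psi : R -> R) (C : R) (k : nat).
Hypothesis cpsi : {within [set` I], continuous psi}.
Hypothesis dpsi : diff_condition I psi C.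
Hypothesis Ck : C <= k%:R.

Definition on_curve (b z : R * R) : bool :=
  (z.1 - b.1 \in I) && (psi (z.1 - b.1) + b.2 == z.2).

Lemma card_at_most_size (T : choiceType) (S : set T) (s : seq T) :
  card_at_most S C -> uniq s -> (forall x, x \in s -> S x) -> (size s <= k)%N.
Proof.
move=> [fS cS] us sS; rewrite -(ler_nat R); apply: le_trans Ck; apply: le_trans cS.
rewrite ler_nat cardfE cardE; apply: (@leq_trans (size (fset_set S))); last by rewrite cardfE cardE.
apply: uniq_leq_size => // x /sS Sx.
by rewrite in_fset_set // inE.
Qed.

Definition value (b : R * R) (x : R) := psi (x - b.1) + b.2.

(** A common point over [x] yields the pair [(x - b.1, x - b'.1)] counted by [diff_condition]; if
    [b.1 = b'.1], the curves are vertical shifts of each other and never meet. *)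
Lemma curve_meets b b' : b != b' -> exists2 s : seq R, (size s <= k)%N &
  forall x, x - b.1 \in I -> x - b'.1 \in I -> value b x = value b' x -> x \in s.
Proof.
move=> bb'; have [e|ne] := eqVneq b.1 b'.1.
  exists [::] => // x _ _; rewrite /value e => /addrI e2.
  by move: bb'; rewrite [b]surjective_pairing [b']surjective_pairing e e2 eqxx.
have d0 : b'.1 - b.1 != 0 by rewrite subr_eq0 eq_sym.
have h := dpsi (b'.2 - b.2) d0; set S := (X in card_at_most X _) in h.
exists [seq z.1 + b.1 | z <- fset_set S].
  rewrite size_map; apply: (card_at_most_size h) => // x.
  by rewrite in_fset_set ?inE //; case: h.
move=> x xI xI' /eqP; rewrite /value => /eqP e.
apply/mapP; exists (x - b.1, x - b'.1); last by rewrite subrK.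
rewrite in_fset_set ?inE; last by case: h.
split => //=; first by lra.
by lra.
Qed.

(** Dual count, bounding edge multiplicities: the pair [(z.1 - b.1, z'.1 - b.1)] determines [b],
    while its two differences do not depend on [b]. *)
Lemma curves_through z z' (s : seq (R * R)) : z.1 != z'.1 -> uniq s ->
  (forall b, b \in s -> on_curve b z && on_curve b z') -> (size s <= k)%N.
Proof.
move=> zz' us sz; have d0 : z.1 - z'.1 != 0 by rewrite subr_eq0.
have h := dpsi (z.2 - z'.2) d0.
rewrite -(size_map (fun b => (z.1 - b.1, z'.1 - b.1))); apply: (card_at_most_size h).
  rewrite map_inj_in_uniq // => b b' /sz /andP[/andP[_ /eqP e1] _] /sz /andP[/andP[_ /eqP e2] _] [e _].
  have eb : b.1 = b'.1 by lra.
  by rewrite [b]surjective_pairing [b']surjective_pairing eb; congr pair; move: e1 e2; rewrite eb; lra.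
move=> _ /mapP[b /sz /andP[/andP[i1 /eqP e1] /andP[i2 /eqP e2]] ->] /=.
by split => //=; lra.
Qed.

Section Arrangement.
Variables (B Z : seq (R * R)).
Hypotheses (uB : uniq B) (uZ : uniq Z).
Hypothesis sZ : sorted (fun z z' => z.1 <= z'.1) Z.

Let M := size Z.
Let n := size B.
Let b (j : nat) : R * R := nth 0 B j.
Let z (i : nat) : R * R := nth 0 Z i.

Let z_le i j : (i <= j)%N -> (j < M)%N -> (z i).1 <= (z j).1.
Proof.
move=> ij jM; apply: (@sorted_leq_nth _ (fun z z' => z.1 <= z'.1)) => //.
- by move=> y x t; apply: le_trans.
- by rewrite inE (leq_ltn_trans ij).
Qed.

Let z_inj i j : (i < M)%N -> (j < M)%N -> z i = z j -> i = j.
Proof. by move=> iM jM /eqP; rewrite nth_uniq // => /eqP. Qed.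

Definition arc_pred (e : 'I_n * 'I_M * 'I_M) : bool :=
  [&& (e.1.2 < e.2)%N, on_curve (b e.1.1) (z e.1.2), on_curve (b e.1.1) (z e.2) &
   [forall i : 'I_M, (e.1.2 < i < e.2)%N ==> ~~ on_curve (b e.1.1) (z i)]].

Definition arc : finType := {e : 'I_n * 'I_M * 'I_M | arc_pred e}.

Definition arc_curve (e : arc) : 'I_n := (val e).1.1.
Definition arc_l (e : arc) : 'I_M := (val e).1.2.
Definition arc_r (e : arc) : 'I_M := (val e).2.

Let bc (e : arc) := b (arc_curve e).

Let arc_lt (e : arc) : (arc_l e < arc_r e)%N.
Proof. by case/and4P: (valP e). Qed.

Let arc_onl (e : arc) : on_curve (bc e) (z (arc_l e)).
Proof. by case/and4P: (valP e). Qed.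

Let arc_onr (e : arc) : on_curve (bc e) (z (arc_r e)).
Proof. by case/and4P: (valP e). Qed.

Let arc_off (e : arc) i : inner arc_l arc_r e i -> ~~ on_curve (bc e) (z i).
Proof.
move=> ie; have iM : (i < M)%N by case/andP: ie => _ h; apply: ltn_trans h (ltn_ord _).
by case/and4P: (valP e) => _ _ _ /forallP/(_ (Ordinal iM))/implyP; apply.
Qed.

Let arc_dom (e : arc) i : (arc_l e <= i <= arc_r e)%N -> (z i).1 - (bc e).1 \in I.
Proof.
move=> /andP[li ir]; have [/andP[lI _] /andP[rI _]] := (arc_onl e, arc_onr e).
apply: (interval_is_interval lI rI); rewrite !lerD2r.
by rewrite !z_le // (leq_ltn_trans ir).
Qed.

Let arc_eq (e f : arc) i : arc_curve e = arc_curve f ->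
  (arc_l e <= i < arc_r e)%N -> (arc_l f <= i < arc_r f)%N -> e = f.
Proof.
move=> ef /andP[le re] /andP[lf rf].
have bef : bc e = bc f by rewrite /bc ef.
have H (g h : arc) : bc g = bc h -> (arc_l g <= i)%N -> (i < arc_r g)%N -> (arc_l h <= i)%N -> (i < arc_r h)%N ->
    ((arc_l h <= arc_l g) && (arc_r g <= arc_r h))%N.
  move=> gh lg rg lh rh; rewrite (leqNgt (arc_l h)) (leqNgt (arc_r g)); apply/andP; split; apply/negP => lt.
    have := @arc_off g (arc_l h); rewrite gh arc_onl /inner lt (leq_ltn_trans lh rg).
    by move=> /(_ isT).
  have := @arc_off g (arc_r h); rewrite gh arc_onr /inner lt (leq_ltn_trans lg rh).
  by move=> /(_ isT).
have /andP[h1 h2] := H _ _ bef le re lf rf; have /andP[h3 h4] := H _ _ (esym bef) lf rf le re.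
apply: val_inj; rewrite [val e]surjective_pairing [val f]surjective_pairing.
rewrite [(val e).1]surjective_pairing [(val f).1]surjective_pairing.
by congr (_, _, _) => //; apply: val_inj; apply: anti_leq; rewrite ?h1 ?h2 ?h3 ?h4.
Qed.

(** Measured from the point [z i], so that every vertex lies at height 0, as [drawing] requires. *)
Let height (e : arc) (i : nat) : R := value (bc e) (z i).1 - (z i).2.

Let heightl e : height e (arc_l e) = 0.
Proof. by apply/eqP; rewrite subr_eq0; case/andP: (arc_onl e). Qed.

Let heightr e : height e (arc_r e) = 0.
Proof. by apply/eqP; rewrite subr_eq0; case/andP: (arc_onr e). Qed.

Let height_neq0 e i : inner arc_l arc_r e i -> height e i != 0.
Proof.
move=> ie; have := arc_off ie; rewrite /on_curve arc_dom ?subr_eq0 //.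
by case/andP: ie => h1 h2; rewrite (ltnW h1) (ltnW h2).
Qed.

(* Heights are perturbed so that arcs of distinct curves never tie strictly inside both. *)
Let tilted (eps : R) (e : arc) (i : nat) : R :=
  if inner arc_l arc_r e i then height e i + eps * (arc_curve e)%:R else 0.

Definition tilt_small (eps : R) := [/\ 0 < eps,
  forall (e : arc) (i : 'I_M), height e i != 0 -> eps * n%:R < `|height e i| &
  forall (e f : arc) (i : 'I_M), height e i != height f i ->
    eps * n%:R < `|height e i - height f i|].

Let tilt_exists : exists eps, tilt_small eps.
Proof.
have [e1 e10 h1] := finite_family_separated (fun p : arc * 'I_M => height p.1 p.2).
have [e2 e20 h2] := finite_family_separated
  (fun p : arc * arc * 'I_M => height p.1.1 p.2 - height p.1.2 p.2).
pose e := Num.min e1 e2; have e0 : 0 < e by rewrite lt_min e10 e20.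
have en : e / n.+1%:R * n%:R <= e.
  by rewrite -mulrA ger_pMr // mulrC ler_pdivrMr ?ltr0n // mul1r ler_nat.
exists (e / n.+1%:R); split.
- by rewrite divr_gt0 ?ltr0n.
- move=> a i /(h1 (a, i)) /=; apply: le_lt_trans; apply: le_trans en _.
  by rewrite ge_min lexx.
- move=> a c i; rewrite -subr_eq0 => /(h2 (a, c, i)) /=; apply: le_lt_trans.
  by apply: le_trans en _; rewrite ge_min lexx orbT.
Qed.

Section Tilt.
Variable eps : R.
Hypothesis small : tilt_small eps.

Let curve_le e : 0 <= eps * (arc_curve e)%:R <= eps * n%:R.
Proof.
have [e0 _ _] := small.
by rewrite mulr_ge0 ?ler0n ?(ltW e0) // ler_pM2l // ler_nat ltnW // ltn_ord.
Qed.

Let inner_ord e i : inner arc_l arc_r e i -> (i < M)%N.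
Proof. by case/andP => _ h; apply: ltn_trans h (ltn_ord _). Qed.

Lemma tilted_drawing : drawing arc_l arc_r (tilted eps).
Proof.
have [e0 s1 s2] := small.
split => [e|e|e|e i ie|e f i ef ie jf].
- exact: arc_lt.
- by rewrite /tilted /inner ltnn.
- by rewrite /tilted /inner ltnn andbF.
- rewrite /tilted ie; have := s1 e (Ordinal (inner_ord ie)) (height_neq0 ie).
  have /andP[h1 h2] := curve_le e; apply: contraTneq => /= h.
  by rewrite -leNgt ler_norml; lra.
- rewrite /tilted ie jf.
  have cef : arc_curve e != arc_curve f.
    apply: contra ef => /eqP cef; apply/eqP; apply: (arc_eq (i := i) cef).
      by case/andP: ie => h1 h2; rewrite (ltnW h1) h2.
    by case/andP: jf => h1 h2; rewrite (ltnW h1) h2.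
  have [heq|hne] := eqVneq (height e i) (height f i).
    by rewrite heq (inj_eq (addrI _)) (inj_eq (mulfI (lt0r_neq0 e0))) eqr_nat.
  have := s2 e f (Ordinal (inner_ord ie)) hne.
  have /andP[h1 h2] := curve_le e; have /andP[h3 h4] := curve_le f.
  apply: contraTneq => /= h.
  by rewrite -leNgt ler_norml; lra.
Qed.

(** The tilt is too small to reverse a strict inequality between true heights. *)
Let tilted_lt e f i : (arc_l e <= i <= arc_r e)%N -> (arc_l f <= i <= arc_r f)%N ->
  tilted eps e i < tilted eps f i -> height e i <= height f i.
Proof.
have [e0 s1 s2] := small.
move=> ie jf; have iM : (i < M)%N by case/andP: ie => _ h; apply: leq_ltn_trans h (ltn_ord _).
have ends g : (arc_l g <= i <= arc_r g)%N -> inner arc_l arc_r g i = false -> height g i = 0.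
  rewrite /inner => /andP[+ +] /negbT; rewrite negb_and -(leqNgt (arc_r g)) leq_eqVlt => /predU1P[<- _ _|].
    exact: heightl.
  by move=> -> /= h /= h'; rewrite (_ : i = arc_r g) ?heightr //; apply: anti_leq; rewrite h h'.
have /andP[h1 h2] := curve_le e; have /andP[h3 h4] := curve_le f.
rewrite leNgt => lt; apply/negP => gt; move: lt; rewrite /tilted.
have s2' := s2 e f (Ordinal iM) (negbT (gt_eqF gt)).
case ei: (inner _ _ e i); case fi: (inner _ _ f i); rewrite ?ltxx //.
- move: s2'; rewrite /= gtr0_norm ?subr_gt0 //; lra.
- have := ends f jf fi => f0; move: gt; rewrite f0; lra.
- have e0' := ends e ie ei; move: gt s2'; rewrite /= e0' sub0r normrN => gt.
  rewrite ltr0_norm //; lra.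
Qed.

Let tie_curve e f i : (arc_l e <= i <= arc_r e)%N -> (arc_l f <= i <= arc_r f)%N ->
  height e i = height f i -> tilted eps e i < tilted eps f i ->
  (arc_curve e < arc_curve f)%N.
Proof.
move=> ie jf hef; rewrite /tilted.
have ends g : (arc_l g <= i <= arc_r g)%N -> inner arc_l arc_r g i = (height g i != 0).
  move=> ig; apply/idP/idP; first exact: height_neq0.
  move: ig; rewrite /inner => /andP[].
  rewrite leq_eqVlt => /predU1P[<-|->]; first by rewrite heightl eqxx.
  by rewrite leq_eqVlt => /predU1P[->|->] //; rewrite heightr eqxx.
rewrite !ends // hef; case: ifP => _; rewrite ?ltxx // ltrD2l.
by have [e0 _ _] := small; rewrite ltr_pM2l // ltr_nat.
Qed.

(** Only slabs of positive width count; for them an abscissa lies in at most two closed slabs. *)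
Let meets (j j' i : nat) : bool :=
  [&& j != j', (i.+1 < M)%N, (z i).1 < (z i.+1).1 &
   `[< exists x, [/\ (z i).1 <= x, x <= (z i.+1).1, x - (b j).1 \in I,
        x - (b j').1 \in I & value (b j) x = value (b j') x] >] ].

Let meetsC j j' i : meets j j' i = meets j' j i.
Proof.
rewrite /meets eq_sym; do 3 congr andb; apply/asboolP/asboolP => -[x [h1 h2 h3 h4 h5]];
by exists x; split.
Qed.

(** A crossing of tilted arcs is a weak sign change of the difference of the two curves, which then
    vanishes in the slab by the intermediate value theorem. *)
Let crossing_meets e f i : crossing arc_l arc_r (tilted eps) e f i ->
  meets (arc_curve e) (arc_curve f) i.
Proof.
suff key a c : (arc_l a <= i)%N -> (i < arc_r a)%N -> (arc_l c <= i)%N -> (i < arc_r c)%N ->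
    tilted eps a i < tilted eps c i -> tilted eps c i.+1 < tilted eps a i.+1 ->
    meets (arc_curve a) (arc_curve c) i.
  move=> /and5P[le re lf rf]; rewrite mulr_lt0 !subr_eq0 !subr_lt0 => /and3P[].
  case: ltgtP => // h1 _; case: ltgtP => // h2 _ _; first exact: key.
  by rewrite meetsC; apply: key.
move=> la ra lc rc lt1 lt2.
have iM : (i.+1 < M)%N by apply: leq_ltn_trans ra (ltn_ord _).
have ai : (arc_l a <= i <= arc_r a)%N by rewrite la (ltnW ra).
have ci : (arc_l c <= i <= arc_r c)%N by rewrite lc (ltnW rc).
have ai1 : (arc_l a <= i.+1 <= arc_r a)%N by rewrite leqW.
have ci1 : (arc_l c <= i.+1 <= arc_r c)%N by rewrite leqW.
have h1 := tilted_lt ai ci lt1; have h2 := tilted_lt ci1 ai1 lt2.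
pose D x := value (bc a) x - value (bc c) x.
have hD j : height a j - height c j = D (z j).1 by rewrite /height /D; ring.
have D1 : D (z i).1 <= 0 by rewrite -hD subr_le0.
have D2 : 0 <= D (z i.+1).1 by rewrite -hD subr_ge0.
have xx : (z i).1 <= (z i.+1).1 by apply: z_le.
(* Over equal abscissae the curves would tie at both vertices, and ties are broken by the curve
   index in the same way each time. *)
have x_lt : (z i).1 < (z i.+1).1.
  rewrite lt_neqAle xx andbT; apply/eqP => xe.
  have e1 : height a i = height c i.
    by apply/eqP; rewrite -subr_eq0 hD; apply/eqP/le_anti; rewrite D1 /= xe.
  have e2 : height a i.+1 = height c i.+1.
    by apply/eqP; rewrite -subr_eq0 hD; apply/eqP/le_anti; rewrite D2 andbT -xe.
  have := tie_curve ai ci e1 lt1; have := tie_curve ci1 ai1 (esym e2) lt2.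
  by move=> h h'; have := ltn_trans h h'; rewrite ltnn.
have dom g x : (arc_l g <= i <= arc_r g)%N -> (arc_l g <= i.+1 <= arc_r g)%N ->
    x \in `[(z i).1, (z i.+1).1] -> x - (bc g).1 \in I.
  move=> g1 g2; rewrite in_itv /= => /andP[x1 x2].
  by apply: (interval_is_interval (arc_dom g1) (arc_dom g2)); rewrite !lerD2r x1 x2.
have cD : {within `[(z i).1, (z i.+1).1], continuous D}.
  have := within_continuous_translate cpsi (fun x => @dom a x ai ai1).
  have := within_continuous_translate cpsi (fun x => @dom c x ci ci1).
  move=> /subspace_continuousP cc /subspace_continuousP ca.
  apply/subspace_continuousP => x xin; rewrite /D /value.
  by apply: cvgB; (apply: cvgD; [|exact: cvg_cst]); [exact: ca|exact: cc].
have : Num.min (D (z i).1) (D (z i.+1).1) <= 0 <= Num.max (D (z i).1) (D (z i.+1).1).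
  by rewrite ge_min D1 le_max D2 orbT.
move=> /(IVT xx cD)[x xin Dx].
rewrite /meets iM x_lt /=; apply/andP; split.
  apply/negP => /eqP ac; have := arc_eq (val_inj ac) (i := i); rewrite la ra lc rc.
  by move=> /(_ isT isT) eac; rewrite eac ltxx in lt1.
apply/asboolP; exists x; split; try exact: dom.
- by move: xin; rewrite in_itv /= => /andP[].
- by move: xin; rewrite in_itv /= => /andP[].
- by apply/eqP; rewrite -subr_eq0 -/(D x) Dx.
Qed.

Let sum_meets (j j' : 'I_n) : (\sum_(i < M) meets j j' i <= 2 * k)%N.
Proof.
have [->|jj'] := eqVneq j j'; first by rewrite big1 // => i _; rewrite /meets eqxx.
have bb : b j != b j' by rewrite nth_uniq.
have [s sk sP] := curve_meets bb.
(* A closed slab containing [x] contains it in one of its two half-open versions, and half-open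
   slabs of one kind are disjoint. *)
pose p x i := [&& (i.+1 < M)%N, (z i).1 <= x & x < (z i.+1).1].
pose q x i := [&& (i.+1 < M)%N, (z i).1 < x & x <= (z i.+1).1].
apply: (@leq_trans (\sum_(i < M) \sum_(x <- s) (p x i + q x i))).
  apply: leq_sum => i _; case: (boolP (meets _ _ _)) => // /and4P[_ iM lt /asboolP[x [x1 x2 x3 x4 x5]]].
  rewrite (big_rem x) /=; last exact: sP.
  rewrite /p /q iM x1 x2 /=; have [_|le] := ltP x (z i.+1).1; first by [].
  by rewrite (lt_le_trans lt le).
rewrite exchange_big /=; apply: (@leq_trans (\sum_(x <- s) 2)); last first.
  by rewrite big_const_seq count_predT iter_addn_0 leq_mul2l sk orbT.
have mono i i' : (i < i')%N -> (i' < M)%N -> (z i.+1).1 <= (z i').1 by move=> h h'; apply: z_le.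
apply: leq_sum => x _; rewrite big_split /= (leq_add (n1 := 1) (n2 := 1)) //;
  apply: sum_pred_le1 => i i' /and3P[iM h1 h2] /and3P[i'M h1' h2']; apply: val_inj; apply/eqP;
  case: ltngtP => // lt; exfalso.
- by have := lt_le_trans h2 (le_trans (mono _ _ lt (ltn_ord _)) h1'); rewrite ltxx.
- by have := lt_le_trans h2' (le_trans (mono _ _ lt (ltn_ord _)) h1); rewrite ltxx.
- by have := le_lt_trans h2 (le_lt_trans (mono _ _ lt (ltn_ord _)) h1'); rewrite ltxx.
- by have := le_lt_trans h2' (le_lt_trans (mono _ _ lt (ltn_ord _)) h1); rewrite ltxx.
Qed.

(** A curve has at most one arc alive at [i], so the inversions at [i] inject into ordered pairs of
    curves that meet in that slab. *)
Lemma total_inversions_le :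
  (total_inversions arc_l arc_r (tilted eps) <= 2 * k * n ^ 2)%N.
Proof.
apply: (@leq_trans (\sum_(i < M) \sum_(j < n) \sum_(j' < n) meets j j' i)).
  apply: leq_sum => i _.
  have inj : {in alive arc_l arc_r i &, injective arc_curve}.
    by move=> e f ae af cef; apply: arc_eq cef ae af.
  apply: leq_trans _ (sum_in_injective_le (fun j : 'I_n => \sum_(j' < n) meets j j' i)%N inj).
  apply: leq_sum => e ae.
  apply: leq_trans _ (sum_in_injective_le (fun j' : 'I_n => nat_of_bool (meets (arc_curve e) j' i)) inj).
  apply: leq_sum => f af; have := @crossing_meets e f i; rewrite crossingE ae af /=.
  by case: inverted => // /(_ isT) ->.
rewrite exchange_big; apply: (@leq_trans (\sum_(j < n) \sum_(j' < n) (2 * k))).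
  by apply: leq_sum => j _; rewrite exchange_big; apply: leq_sum.
by rewrite !sum_nat_const !card_ord mulnCA !mulnA; lia.
Qed.

End Tilt.
Let card_arc :
  (#|arc| <= 6 * k * M)%N \/ (#|arc| ^ 3 <= 576 * k ^ 3 * M ^ 2 * n ^ 2)%N.
Proof.
have [eps small] := tilt_exists.
have mult a c : (#|[set e : arc | (arc_l e, arc_r e) == (a, c)]%SET| <= k)%N.
  set S := [set e : arc | _]%SET.
  have SP e : e \in enum S -> arc_l e = a /\ arc_r e = c.
    by rewrite mem_enum inE => /eqP[].
  rewrite cardE; have [->//|[e0 e0S]] : enum S = [::] \/ exists e, e \in enum S.
    by case: (enum S) => [|e s]; [left|right; exists e; rewrite inE eqxx].
  (* Two points of one curve with the same abscissa coincide. *)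
  have zac : (z a).1 != (z c).1.
    have [la rc] := SP _ e0S; have := arc_lt e0; have := arc_onl e0; have := arc_onr e0.
    rewrite /on_curve la rc => /andP[_ /eqP e1] /andP[_ /eqP e2] ac.
    apply/eqP => e3; have zz : z a = z c.
      by rewrite [LHS]surjective_pairing [RHS]surjective_pairing -e1 -e2 e3.
    by move: ac; rewrite (z_inj _ _ zz) // ltnn.
  rewrite -(size_map bc); apply: (curves_through (z := z a) (z' := z c) zac).
    rewrite map_inj_in_uniq ?enum_uniq // => e f /SP[el er] /SP[fl fr] /eqP.
    rewrite /bc nth_uniq // => /eqP cef; apply: (arc_eq (i := a) (val_inj cef)).
      by rewrite -el leqnn arc_lt.
    by rewrite -fl leqnn arc_lt.
  by move=> _ /mapP[e /SP[<- <-] ->]; rewrite arc_onl arc_onr.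
have [h|h] := crossing_lemma mult (tilted_drawing small); [by left|right].
apply: leq_trans h _; apply: (@leq_trans (288 * k ^ 2 * M ^ 2 * (2 * k * n ^ 2))).
  by rewrite leq_mul2l total_inversions_le ?orbT.
by apply: eq_leq; move: k M n; clear; lia.
Qed.

(** Every incidence except the first one on its curve is the right end of an arc. *)
Let card_incident :
  (#|[set p : 'I_n * 'I_M | on_curve (b p.1) (z p.2)]%SET| <= #|arc| + n)%N.
Proof.
set Inc := [set p | _]%SET.
pose A1 := [set (arc_curve e, arc_r e) | e : arc]%SET.
pose A2 := [set p in Inc | [forall i : 'I_M, (i < p.2)%N ==> ~~ on_curve (b p.1) (z i)]]%SET.
have cov : Inc \subset A1 :|: A2.
  apply/fintype.subsetP => -[j c] jc; rewrite !inE; have := jc; rewrite inE /= => onc.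
  rewrite onc /=.
  case: forallP => [_|/forallP/forallPn[i]]; first by rewrite orbT.
  rewrite negb_imply negbK => ic; rewrite orbF.
  case: (@arg_maxnP 'I_M i (fun i => (i < c)%N && on_curve (b j) (z i)) (fun i => i : nat) ic)
    => a /andP[ac ona] amax.
  have ae : arc_pred (j, a, c).
    rewrite /arc_pred /= ac ona onc /=; apply/forallP => i'; apply/implyP => /andP[h1 h2].
    apply/negP => oni; have : (i' <= a)%N by apply: amax; rewrite h2 oni.
    by rewrite leqNgt h1.
  by apply/imsetP; exists (exist (fun e => arc_pred e) (j, a, c) ae).
apply: leq_trans (subset_leq_card cov) _; apply: leq_trans (leq_card_setU _ _) _.
apply: leq_add; first exact: leq_imset_card.
have inj : {in A2 &, injective (fun p : 'I_n * 'I_M => p.1)}.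
  move=> [j c] [j' c']; rewrite !inE /= => /andP[on1 /forallP f1] /andP[on2 /forallP f2] jj.
  rewrite -jj in on2 f2 *; congr pair; apply: val_inj; apply/eqP; case: ltngtP => // lt.
    by have := f2 c; rewrite lt on1.
  by have := f1 c'; rewrite lt on2.
by rewrite -(card_in_imset inj) -[X in (_ <= X)%N](card_ord n) max_card.
Qed.

Lemma sorted_incidence_bound : ((\sum_(x <- B) count (on_curve x) Z) ^ 3 <=
  (3168 * k ^ 3 + 4) * (size B ^ 2 * size Z ^ 2 + size B ^ 3 + size Z ^ 3))%N.
Proof.
have -> : (\sum_(x <- B) count (on_curve x) Z =
    #|[set p : 'I_n * 'I_M | on_curve (b p.1) (z p.2)]%SET|)%N.
  rewrite (big_nth 0) big_mkord -/n.
  rewrite -sum1dep_card -(pair_big_dep xpredT (fun (j : 'I_n) (i : 'I_M) => on_curve (b j) (z i)) (fun _ _ => 1%N)) /=.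
  apply: eq_bigr => j _; rewrite -sum1_count (big_nth 0) big_mkord.
  by [].
have h := card_incident; rewrite -/n -/M.
(* [792 = 216 + 576] covers both alternatives of [card_arc]; the factor 4 of [cube_add_le] then
   gives 3168. *)
have : (#|arc| ^ 3 <= 792 * k ^ 3 * (n ^ 2 * M ^ 2 + M ^ 3))%N.
  case: card_arc => h1; last first.
    apply: leq_trans h1 _.
    by move: k M n; clear=> k M n; nia.
  apply: (@leq_trans ((6 * k * M) ^ 3)); first by rewrite leq_exp2r.
  by move: k M n; clear=> k M n; nia.
move: (#|arc|) (#|_|) h; move: k M n; clear => k M n a I0 h h1.
apply: (@leq_trans ((a + n) ^ 3)); first by rewrite leq_exp2r.
apply: (@leq_trans (4 * (a ^ 3 + n ^ 3))); first exact: cube_add_le.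
rewrite (_ : 3168 * k ^ 3 = 4 * (792 * k ^ 3))%N; last by lia.
move: (792 * k ^ 3)%N h1 => K; move: (a ^ 3)%N (n ^ 3)%N (M ^ 3)%N (n ^ 2 * M ^ 2)%N.
by clear=> a3 n3 M3 nM; nia.
Qed.

End Arrangement.

Lemma incidence_bound (P X Z : seq (R * R)) : uniq P -> uniq X -> uniq Z ->
  (forall p, p \in P -> p.1 \in I /\ psi p.1 = p.2) ->
  (incidences P X Z ^ 3 <=
  (3168 * k ^ 3 + 4) * (size X ^ 2 * size Z ^ 2 + size X ^ 3 + size Z ^ 3))%N.
Proof.
move=> uP uX uZ PI.
pose Z' := sort (fun z z' : R * R => z.1 <= z'.1) Z.
have sZ' : sorted (fun z z' : R * R => z.1 <= z'.1) Z'.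
  by apply: sort_sorted => z z'; apply: le_total.
have uZ' : uniq Z' by rewrite sort_uniq.
apply: (@leq_trans ((\sum_(x <- X) count (on_curve x) Z') ^ 3)); last first.
  by have := sorted_incidence_bound uX uZ' sZ'; rewrite size_sort.
rewrite leq_exp2r //; apply: leq_sum => x _.
rewrite -!size_filter -(size_map (+%R x)); apply: uniq_leq_size.
  by rewrite map_inj_uniq ?filter_uniq //; apply: addrI.
move=> _ /mapP[p + ->]; rewrite !mem_filter mem_sort => /andP[-> /PI[pI pe]].
rewrite andbT /on_curve /=.
rewrite (_ : x.1 + p.1 - x.1 = p.1) ?pI ?pe; first by rewrite addrC eqxx.
by rewrite addrC addKr.
Qed.
End Curves.

(** * Bilinear estimate and energies *)

(** Cauchy-Schwarz in linearised form: the optimal [t = s / u] gives the conclusion without square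
    roots. *)
Lemma sqr_le_of_amgm (R : realFieldType) (s u d : R) : 0 <= u -> 0 <= d ->
  (forall t, 2 * t * s <= d + t ^+ 2 * u) -> s ^+ 2 <= u * d.
Proof.
move=> u0 d0 h; have [uz|un] := eqVneq u 0.
  have [->|sn] := eqVneq s 0; first by rewrite expr0n mulr_ge0.
  (* For [u = 0] this [t] would turn the hypothesis into [d + 1 <= d]. *)
  have := h ((d + 1) / (2 * s)); rewrite uz mulr0 addr0.
  by rewrite (_ : 2 * _ * s = d + 1); [lra|field].
have up : 0 < u by rewrite lt_neqAle eq_sym un.
have := h (s / u); rewrite -(ler_pM2r up).
rewrite (_ : 2 * (s / u) * s * u = 2 * s ^+ 2); last by field.
rewrite (_ : (d + (s / u) ^+ 2 * u) * u = u * d + s ^+ 2); last by field.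
lra.
Qed.

(** * Sequences as finitely supported functions, and their level sets *)

Section Multisets.
Variables (R : realType) (T : eqType).
Implicit Types (L U : seq T) (F : T -> R).

(** A sequence [L] stands for the function [x -> count_mem x L]; [dot] is the inner product, so
    [size L] is the l1 norm and [dot L L] the squared l2 norm. *)
Definition dot L1 L2 : nat := (\sum_(x <- L1) count_mem x L2)%N.

Lemma dotE L1 L2 : dot L1 L2 = (\sum_(x <- L1) \sum_(y <- L2) (x == y))%N.
Proof.
apply: eq_bigr => x _; rewrite -sum1_count [LHS]big_mkcond.
by apply: eq_bigr => y _; rewrite /= eq_sym; case: eqP.
Qed.

Lemma countE (z : T) L : (count_mem z L)%:R = \sum_(x <- L) (z == x)%:R :> R.
Proof.
rewrite -sum1_count natr_sum big_mkcond; apply: eq_bigr => x _ /=.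
by rewrite eq_sym; case: eqP.
Qed.

Lemma sum_by_value L U F : uniq U -> {subset L <= U} ->
  \sum_(x <- L) F x = \sum_(z <- U) (count_mem z L)%:R * F z.
Proof.
move=> uU LU; under [RHS]eq_bigr do rewrite countE big_distrl.
rewrite /= exchange_big /= [LHS]big_seq [RHS]big_seq; apply: eq_bigr => x /LU xU.
rewrite (bigD1_seq x) //= eqxx mul1r big1 ?addr0 // => y /negPf.
by move=> ->; rewrite mul0r.
Qed.

Lemma dot_by_value L1 L2 U : uniq U -> {subset L1 <= U} ->
  (dot L1 L2)%:R = \sum_(z <- U) (count_mem z L1)%:R * (count_mem z L2)%:R :> R.
Proof. by move=> uU LU; rewrite natr_sum; apply: sum_by_value. Qed.

Lemma dot_amgm L1 L2 (t : R) :
  2 * t * (dot L1 L2)%:R <= (dot L1 L1)%:R + t ^+ 2 * (dot L2 L2)%:R.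
Proof.
pose U := undup (L1 ++ L2); have uU : uniq U by apply: undup_uniq.
have s1 : {subset L1 <= U} by move=> x; rewrite mem_undup mem_cat => ->.
have s2 : {subset L2 <= U} by move=> x; rewrite mem_undup mem_cat orbC => ->.
rewrite (dot_by_value L2 uU s1) (dot_by_value L1 uU s1) (dot_by_value L2 uU s2).
rewrite !mulr_sumr -big_split /=; apply: ler_sum => z _.
rewrite -subr_ge0 (_ : _ - _ = ((count_mem z L1)%:R - t * (count_mem z L2)%:R) ^+ 2) ?sqr_ge0 //.
ring.
Qed.

Lemma dot_le L1 L2 (B : R) : (dot L1 L1)%:R <= B -> (dot L2 L2)%:R <= B -> (dot L1 L2)%:R <= B.
Proof. by move=> h1 h2; have := dot_amgm L1 L2 1; lra. Qed.

(** Cauchy-Schwarz against the indicator function of the support. *)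
Lemma size_sqr_le_dot L : ((size L)%:R ^+ 2 <= (size (undup L))%:R * (dot L L)%:R :> R).
Proof.
apply: sqr_le_of_amgm => [||t]; rewrite ?ler0n //.
have := dot_amgm L (undup L) t.
have -> : dot L (undup L) = size L.
  rewrite /dot -sum1_size !big_seq; apply: eq_bigr => x xL.
  by rewrite count_uniq_mem ?undup_uniq // mem_undup xL.
have -> // : dot (undup L) (undup L) = size (undup L).
rewrite /dot -sum1_size !big_seq; apply: eq_bigr => x xL.
by rewrite count_uniq_mem ?undup_uniq // xL.
Qed.

Lemma dot_le_size L (k : nat) : (forall x, (count_mem x L <= k)%N) -> (dot L L <= k * size L)%N.
Proof.
by move=> Lk; rewrite -sum1_size big_distrr /=; apply: leq_sum => x _; rewrite muln1.
Qed.

Definition level L (k : nat) : seq T := [seq z <- undup L | (k < count_mem z L)%N].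

Lemma level_uniq L k : uniq (level L k).
Proof. by rewrite filter_uniq ?undup_uniq. Qed.

Lemma mem_level L k z : (z \in level L k) = (k < count_mem z L)%N.
Proof.
rewrite mem_filter mem_undup; case: ltnP => //= h.
by rewrite -has_pred1 has_count (leq_ltn_trans _ h).
Qed.

Lemma sum_bool_lt (m c : nat) (g : nat -> R) : (c <= m)%N ->
  \sum_(k < m) (k < c)%:R * g k = \sum_(k < c) g k.
Proof.
move=> cm; rewrite (big_ord_widen_cond m xpredT g cm) [RHS]big_mkcond /=.
by apply: eq_bigr => k _; case: ltnP; rewrite ?mul1r ?mul0r.
Qed.

(* Layer-cake formula, with a weight attached to each layer. *)
Lemma sum_level L F (m : nat) (g : nat -> R) : (forall x, (count_mem x L <= m)%N) ->
  \sum_(k < m) g k * \sum_(z <- level L k) F z =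
  \sum_(z <- undup L) (\sum_(k < count_mem z L) g k) * F z.
Proof.
move=> Lm; under [RHS]eq_bigr do rewrite -(sum_bool_lt _ (Lm _)) big_distrl.
rewrite /= exchange_big /=; apply: eq_bigr => k _.
rewrite big_filter mulr_sumr big_mkcond; apply: eq_bigr => z _.
by case: ltnP; rewrite ?mul1r ?mul0r ?mulr0.
Qed.

Lemma sum_level1 L F (m : nat) : (forall x, (count_mem x L <= m)%N) ->
  \sum_(k < m) \sum_(z <- level L k) F z = \sum_(x <- L) F x.
Proof.
move=> Lm; have := sum_level F (fun=> 1) Lm; under eq_bigr do rewrite mul1r.
move=> ->; rewrite (@sum_by_value _ (undup L)) ?undup_uniq //; last first.
  by move=> x; rewrite mem_undup.
by apply: eq_bigr => z _; rewrite sumr_const card_ord.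
Qed.

Lemma sum_size_level L (m : nat) : (forall x, (count_mem x L <= m)%N) ->
  \sum_(k < m) (size (level L k))%:R = (size L)%:R :> R.
Proof.
move=> Lm; rewrite -[in RHS]sum1_size natr_sum -(sum_level1 (fun=> 1) Lm).
by apply: eq_bigr => k _; rewrite -sum1_size natr_sum.
Qed.

Lemma sum_size_level_weight L (m : nat) : (forall x, (count_mem x L <= m)%N) ->
  \sum_(k < m) k.+1%:R * (size (level L k))%:R <= (dot L L)%:R :> R.
Proof.
move=> Lm; under eq_bigr do rewrite -sum1_size natr_sum.
rewrite (sum_level (fun=> 1) (fun k => k.+1%:R) Lm).
rewrite (@dot_by_value _ _ (undup L)) ?undup_uniq //; last by move=> x; rewrite mem_undup.
apply: ler_sum => z _; rewrite mulr1.
apply: (@le_trans _ _ (\sum_(k < count_mem z L) (count_mem z L)%:R)).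
  by apply: ler_sum => k _; rewrite ler_nat.
by rewrite sumr_const card_ord -[_ *+ _]mulr_natr.
Qed.

End Multisets.

Section Cbrt.
Variable R : realType.
Implicit Types x y a b : R.

Definition cbrt x : R := x `^ (3^-1).

Lemma cbrt_ge0 x : 0 <= cbrt x.
Proof. exact: powR_ge0. Qed.

Lemma cbrtK x : 0 <= x -> cbrt x ^+ 3 = x.
Proof.
by move=> x0; rewrite /cbrt -powR_mulrn ?powR_ge0 // -powRrM mulVf ?powRr1.
Qed.

Lemma cbrtM x y : 0 <= x -> 0 <= y -> cbrt (x * y) = cbrt x * cbrt y.
Proof. exact: powRM. Qed.

Lemma cbrt_gt0 x : 0 < x -> 0 < cbrt x.
Proof. exact: powR_gt0. Qed.

Lemma cube_le a b : 0 <= b -> a ^+ 3 <= b ^+ 3 -> a <= b.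
Proof.
move=> b0 h; rewrite leNgt; apply/negP => ba.
by move: h; rewrite leNgt => /negP; apply; rewrite ltrXn2r // ?nnegrE // (le_trans b0) // ltW.
Qed.

Lemma cbrt_le x b : 0 <= x -> 0 <= b -> x <= b ^+ 3 -> cbrt x <= b.
Proof. by move=> x0 b0 h; apply: cube_le => //; rewrite cbrtK. Qed.

(** The inequality of means for [m / b], [m / b] and [b ^+ 2]. *)
Lemma amgm_cube (m b : R) : 0 <= m -> 0 < b -> 27 * m ^+ 2 <= (2 * m / b + b ^+ 2) ^+ 3.
Proof.
move=> m0 b0; have bn : b != 0 by rewrite gt_eqF.
rewrite -(ler_pM2r (exprn_gt0 3 b0)).
have -> : (2 * m / b + b ^+ 2) ^+ 3 * b ^+ 3 = (2 * m + b ^+ 3) ^+ 3 by field.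
rewrite -subr_ge0 (_ : _ - _ = (b ^+ 3 - m) ^+ 2 * (b ^+ 3 + 8 * m)); last by ring.
have b3 : 0 <= b ^+ 3 by rewrite exprn_ge0 // ltW.
by apply: mulr_ge0; [exact: sqr_ge0|lra].
Qed.

End Cbrt.

(** * From incidences of sets to a bilinear estimate for functions *)

Section Bilinear.
Variables (R : realType) (G : zmodType) (P : seq G) (K : R).
Hypothesis K1 : 1 <= K.
Implicit Types L X Z : seq G.

Hypothesis incidence_cube : forall X Z, uniq X -> uniq Z ->
  (incidences P X Z)%:R ^+ 3 <=
  K * ((size X)%:R ^+ 2 * (size Z)%:R ^+ 2 + (size X)%:R ^+ 3 + (size Z)%:R ^+ 3) :> R.

(* The optimum over [a] of the summand is a multiple of [x ^ (2/3)]. *)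
Definition young (x a : R) := 2 * x / a + a ^+ 2.

(** Replaces the 2/3 powers by expressions linear in each size, which can be summed over level sets;
    the parameters may vary with the level. *)
Lemma incidence_young X Z a b : uniq X -> uniq Z -> 0 < a -> 0 < b ->
  (incidences P X Z)%:R <= K * (young (size X)%:R a * young (size Z)%:R b
    + (size X)%:R + (size Z)%:R).
Proof.
move=> uX uZ a0 b0; set x : R := (size X)%:R; set z : R := (size Z)%:R.
have x0 : 0 <= x by rewrite ler0n. have z0 : 0 <= z by rewrite ler0n.
have ya : 0 <= young x a by rewrite addr_ge0 ?sqr_ge0 ?divr_ge0 ?mulr_ge0 // ltW.
have yb : 0 <= young z b by rewrite addr_ge0 ?sqr_ge0 ?divr_ge0 ?mulr_ge0 // ltW.
have K0 : 0 <= K by apply: le_trans K1.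
have s0 : 0 <= young x a * young z b + x + z by rewrite !addr_ge0 ?mulr_ge0.
apply: cube_le; first by rewrite mulr_ge0.
apply: le_trans (incidence_cube uX uZ) _; rewrite -/x -/z exprMn.
apply: ler_pM => //; first by rewrite !addr_ge0 ?mulr_ge0 ?exprn_ge0.
  by rewrite exprS ler_peMr // exprn_ege1.
have := amgm_cube x0 a0; have := amgm_cube z0 b0.
rewrite -/(young x a) -/(young z b) => hz hx.
have : (27 * x ^+ 2) * (27 * z ^+ 2) <= young x a ^+ 3 * young z b ^+ 3.
  by apply: ler_pM => //; rewrite mulr_ge0 ?sqr_ge0.
rewrite -exprMn; set w := young x a * young z b => h.
have w0 : 0 <= w by rewrite mulr_ge0.
apply: (@le_trans _ _ (w ^+ 3 + x ^+ 3 + z ^+ 3)).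
  have : 0 <= x ^+ 2 * z ^+ 2 by rewrite mulr_ge0 ?sqr_ge0.
  by have := exprn_ge0 3 w0; move: h; rewrite mulrACA; lra.
rewrite -subr_ge0.
rewrite (_ : _ - _ = 3 * (w ^+ 2 * x + w ^+ 2 * z + w * x ^+ 2 + w * z ^+ 2 + x ^+ 2 * z + x * z ^+ 2)
   + 6 * (w * x * z)); last by ring.
by rewrite addr_ge0 ?mulr_ge0 // !addr_ge0 ?mulr_ge0 ?sqr_ge0.
Qed.

(** Telescoping, since [(c + 1) ^- 2 <= c^-1 - (c + 1)^-1]. *)
Lemma sum_inv_sqr (kappa : R) (m : nat) : 0 < kappa ->
  \sum_(k < m) (kappa + k.+1%:R) ^- 2 <= kappa^-1 - (kappa + m%:R)^-1.
Proof.
move=> k0; elim: m => [|m IH]; first by rewrite big_ord0 addr0 subrr.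
rewrite big_ord_recr /=; apply: le_trans (lerD IH (lexx _)) _.
have h1 : 0 < kappa + m%:R by rewrite ltr_wpDr ?ler0n.
rewrite -natr1 addrA; move: (kappa + m%:R) h1 => c c0.
rewrite -subr_ge0.
rewrite (_ : _ - _ = c^-1 * (c + 1) ^- 2); last first.
  by field; rewrite !gt_eqF // addr_gt0.
by rewrite mulr_ge0 ?invr_ge0 ?exprn_ge0 ?ltW // addr_gt0.
Qed.

(** Hoelder's inequality for the 2/3 powers of the level sizes, with weights [kappa + k + 1]. The
    linear parts of [young] contribute [4 mu], the squares [mu]. *)
Lemma sum_young_level L (m : nat) : (forall x, (count_mem x L <= m)%N) -> L != [::] ->
  exists2 a : nat -> R, (forall k, 0 < a k) &
  \sum_(k < m) young (size (level L k))%:R (a k) <=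
    5 * cbrt ((size L)%:R * (dot L L)%:R).
Proof.
move=> Lm L0; set s : R := (size L)%:R; set d : R := (dot L L)%:R.
have s0 : 0 < s by rewrite ltr0n lt0n size_eq0.
have sd : s <= d.
  rewrite ler_nat -sum1_size /dot !big_seq; apply: leq_sum => x xL.
  by rewrite -has_count has_pred1.
have d0 : 0 < d by apply: lt_le_trans sd.
pose kappa := d / s; have kappa0 : 0 < kappa by rewrite divr_gt0.
pose mu := cbrt (s * d); have mu0 : 0 < mu by rewrite cbrt_gt0 // mulr_gt0.
have mu3 : mu ^+ 3 = s * d by rewrite cbrtK // mulr_ge0 // ltW.
have ks : kappa * s = d by rewrite /kappa divfK // gt_eqF.
have kk k : kappa + k%:R != 0 by rewrite gt_eqF // ltr_wpDr ?ler0n.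
have kk0 k : 0 < kappa + k%:R by rewrite ltr_wpDr ?ler0n.
have dn : d != 0 by rewrite gt_eqF. have mun : mu != 0 by rewrite gt_eqF.
have sn : s != 0 by rewrite gt_eqF.
(* [kappa = d / s] balances the weighted sizes, of sum at most [kappa s + d = 2 d], and the sum of
   [(kappa + k + 1) ^- 2] is at most [1 / kappa]; the scale [d / mu] makes both parts of order
   [mu]. *)
exists (fun k => d / (mu * (kappa + k.+1%:R))) => [k|].
  by rewrite divr_gt0 ?mulr_gt0.
rewrite big_split /= (_ : 5 * mu = 4 * mu + mu); last by ring.
apply: lerD.
  apply: (@le_trans _ _ (2 * mu / d * (kappa * s + d))); last first.
    by rewrite ks -mulr2n -[d *+ 2]mulr_natl mulrCA mulfVK ?gt_eqF //; lra.
  rewrite (eq_bigr (fun k : 'I_m => 2 * mu / d * (kappa * (size (level L k))%:R +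
     k.+1%:R * (size (level L k))%:R))); last first.
    move=> k _; move: (k.+1%:R) (kk k.+1) => c c0; rewrite /young; field.
    by rewrite dn mun c0.
  rewrite -mulr_sumr ler_pM2l ?divr_gt0 ?mulr_gt0 // big_split /= -mulr_sumr.
  by rewrite sum_size_level // lerD2l sum_size_level_weight.
rewrite (eq_bigr (fun k : 'I_m => d ^+ 2 / mu ^+ 2 * (kappa + k.+1%:R) ^- 2)); last first.
  move=> k _; move: (k.+1%:R) (kk k.+1) => c c0; field.
  by rewrite mun c0.
rewrite -mulr_sumr; apply: (@le_trans _ _ (d ^+ 2 / mu ^+ 2 * kappa^-1)).
  rewrite ler_pM2l ?divr_gt0 ?exprn_gt0 //; apply: le_trans (sum_inv_sqr m kappa0) _.
  by rewrite gerBl invr_ge0 ltW.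
rewrite (_ : _ / _ * _ = mu ^+ 3 / mu ^+ 2); first by rewrite exprS mulfK // expf_neq0.
by rewrite mu3 /kappa; field; rewrite sn mun dn.
Qed.

Lemma natr_incidences X Z : (incidences P X Z)%:R =
  \sum_(x <- X) \sum_(p <- P) (x + p \in Z)%:R :> R.
Proof.
rewrite natr_sum; apply: eq_bigr => x _; rewrite -sum1_count natr_sum big_mkcond.
by apply: eq_bigr => p _; case: (_ \in _).
Qed.

(** Layer-cake in both functions; [25 = 5 * 5], and the linear terms of the incidence bound sum to a
    sup norm times an l1 norm. *)
Lemma bilinear_incidence Lw Lu (mw mu : nat) :
  (forall x, (count_mem x Lw <= mw)%N) -> (forall x, (count_mem x Lu <= mu)%N) ->
  \sum_(x <- Lw) \sum_(p <- P) (count_mem (x + p) Lu)%:R <=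
  K * (25 * (cbrt ((size Lw)%:R * (dot Lw Lw)%:R) * cbrt ((size Lu)%:R * (dot Lu Lu)%:R))
    + mu%:R * (size Lw)%:R + mw%:R * (size Lu)%:R) :> R.
Proof.
move=> hw hu; have K0 : 0 <= K by apply: le_trans K1.
have rhs0 : 0 <= K * (25 * (cbrt ((size Lw)%:R * (dot Lw Lw)%:R) * cbrt ((size Lu)%:R * (dot Lu Lu)%:R))
    + mu%:R * (size Lw)%:R + mw%:R * (size Lu)%:R).
  by apply: mulr_ge0 => //; rewrite !addr_ge0 ?mulr_ge0 ?cbrt_ge0.
have [w0|w0] := eqVneq Lw [::]; first by rewrite {1}w0 big_nil.
have [u0|u0] := eqVneq Lu [::].
  by rewrite big1 // => x _; rewrite big1 // => p _; rewrite u0.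
have [a a0 ha] := sum_young_level hw w0; have [b b0 hb] := sum_young_level hu u0.
rewrite -(sum_level1 _ hw).
have -> : \sum_(k < mw) \sum_(x <- level Lw k) \sum_(p <- P) (count_mem (x + p) Lu)%:R =
   \sum_(k < mw) \sum_(l < mu) (incidences P (level Lw k) (level Lu l))%:R :> R.
  apply: eq_bigr => k _; under [RHS]eq_bigr do rewrite natr_incidences.
  rewrite [RHS]exchange_big /=; apply: eq_bigr => x _; rewrite [RHS]exchange_big /=.
  apply: eq_bigr => p _.
  transitivity (\sum_(l < mu) (l < count_mem (x + p)%R Lu)%N%:R * 1 : R).
    by rewrite (sum_bool_lt (fun=> 1) (hu _)) sumr_const card_ord.
  by apply: eq_bigr => l _; rewrite mem_level mulr1.
apply: (@le_trans _ _ (\sum_(k < mw) \sum_(l < mu) K *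
    (young (size (level Lw k))%:R (a k) * young (size (level Lu l))%:R (b l)
    + (size (level Lw k))%:R + (size (level Lu l))%:R))).
  by do 2![apply: ler_sum => ? _]; apply: incidence_young; rewrite ?level_uniq.
under eq_bigr do rewrite -mulr_sumr.
rewrite -mulr_sumr ler_wpM2l //.
pose yw (k : 'I_mw) := young (size (level Lw k))%:R (a k).
pose yu (l : 'I_mu) := young (size (level Lu l))%:R (b l).
rewrite (eq_bigr (fun k : 'I_mw => yw k * \sum_(l < mu) yu l +
    mu%:R * (size (level Lw k))%:R + (size Lu)%:R)); last first.
  move=> k _; rewrite 2!big_split /= -mulr_sumr sum_size_level // sumr_const card_ord.
  by rewrite [mu%:R * _]mulr_natl.
rewrite 2!big_split /= -mulr_suml -mulr_sumr sum_size_level // sumr_const card_ord.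
rewrite [mw%:R * _]mulr_natl !lerD2r.
have -> : 25 * (cbrt ((size Lw)%:R * (dot Lw Lw)%:R) * cbrt ((size Lu)%:R * (dot Lu Lu)%:R)) =
  (5 * cbrt ((size Lw)%:R * (dot Lw Lw)%:R)) * (5 * cbrt ((size Lu)%:R * (dot Lu Lu)%:R)) :> R by ring.
have y0 (x c : R) : 0 <= x -> 0 < c -> 0 <= young x c.
  by move=> x0 c0; rewrite addr_ge0 ?sqr_ge0 // divr_ge0 ?mulr_ge0 // ltW.
by apply: ler_pM => //; apply: sumr_ge0 => i _; apply: y0.
Qed.

End Bilinear.

(** * Sumsets with multiplicity and additive energies *)

Section Sumsets.
Variable G : zmodType.
Implicit Types L : seq G.

Definition sumset L1 L2 : seq G := [seq x + y | x <- L1, y <- L2].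

Lemma sum_sumset (V : nmodType) L1 L2 (F : G -> V) :
  \sum_(z <- sumset L1 L2) F z = \sum_(x <- L1) \sum_(y <- L2) F (x + y).
Proof. exact: big_allpairs_dep. Qed.

Lemma size_sumset L1 L2 : size (sumset L1 L2) = (size L1 * size L2)%N.
Proof. exact: size_allpairs. Qed.

Lemma count_sum (T : eqType) (z : T) (L : seq T) : count_mem z L = (\sum_(x <- L) (x == z))%N.
Proof.
rewrite -sum1_count big_mkcond; apply: eq_bigr => x _ /=.
by case: eqP.
Qed.

Lemma count_sumset L1 L2 z :
  count_mem z (sumset L1 L2) = (\sum_(y <- L2) count_mem (z - y)%R L1)%N.
Proof.
rewrite count_sum (sum_sumset _ _ (fun x => nat_of_bool (x == z))) exchange_big /=.
by apply: eq_bigr => y _; rewrite count_sum; apply: eq_bigr => x _; rewrite -subr_eq opprK.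
Qed.

Lemma dot_sumset L1 L2 L : dot (sumset L1 L2) L =
  (\sum_(x <- L1) \sum_(y <- L2) count_mem (x + y)%R L)%N.
Proof. exact: (sum_sumset _ _ (fun x => count_mem x L)). Qed.

(** Turns a convolution at [n] into an inner product ([count_sumsD]) and preserves the l2 norm
    ([dot_reflected]). *)
Definition reflected (n : G) L : seq G := [seq n - x | x <- L].

Lemma count_reflected n L z : count_mem z (reflected n L) = count_mem (n - z) L.
Proof.
rewrite count_map; apply: eq_count => x /=.
by rewrite subr_eq addrC -subr_eq eq_sym.
Qed.

Lemma dot_reflected n L : dot (reflected n L) (reflected n L) = dot L L.
Proof.
rewrite /dot big_map; apply: eq_bigr => x _.
by rewrite count_reflected opprB addrC subrK.
Qed.

Variable P : seq G.
Fixpoint sums (s : nat) : seq G := if s is s'.+1 then sumset (sums s') P else [:: 0].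

Lemma size_sums s : size (sums s) = (size P ^ s)%N.
Proof. by elim: s => //= s IH; rewrite size_sumset IH expnSr. Qed.

Lemma sum_sumsD (V : nmodType) a b (F : G -> V) :
  \sum_(z <- sums (a + b)) F z = \sum_(x <- sums a) \sum_(y <- sums b) F (x + y).
Proof.
elim: b F => [|b IH] F; first by rewrite addn0; apply: eq_bigr => x _; rewrite big_seq1 addr0.
rewrite addnS /= sum_sumset IH; apply: eq_bigr => x _.
by rewrite sum_sumset; do 2!apply: eq_bigr => ? _; rewrite addrA.
Qed.

Lemma sum_sums1 (V : nmodType) (F : G -> V) : \sum_(z <- sums 1) F z = \sum_(p <- P) F p.
Proof. by rewrite sum_sumset big_seq1; apply: eq_bigr => p _; rewrite add0r. Qed.

Lemma sum_sums2 (V : nmodType) (F : G -> V) :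
  \sum_(z <- sums 2) F z = \sum_(p <- P) \sum_(q <- P) F (p + q).
Proof. by rewrite sum_sumset sum_sums1. Qed.

Lemma count_sumsD a b n : count_mem n (sums (a + b)) = dot (sums a) (reflected n (sums b)).
Proof.
rewrite count_sum (sum_sumsD _ _ (fun x => nat_of_bool (x == n))) /dot.
apply: eq_bigr => x _; rewrite count_reflected count_sum; apply: eq_bigr => y _.
by rewrite eq_sym addrC -subr_eq eq_sym.
Qed.

Definition energy s := dot (sums s) (sums s).

End Sumsets.

(** * The energy recursion and its consequences for representation counts *)

Section Energy.
Variables (R : realType) (G : zmodType) (P : seq G) (K : R) (k : nat).
Hypothesis K1 : 1 <= K.
Hypothesis incidence_cube : forall X Z : seq G, uniq X -> uniq Z ->
  (incidences P X Z)%:R ^+ 3 <=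
  K * ((size X)%:R ^+ 2 * (size Z)%:R ^+ 2 + (size X)%:R ^+ 3 + (size Z)%:R ^+ 3) :> R.
Hypothesis sums2 : forall z, (count_mem z (sums P 2) <= k)%N.
Hypothesis P0 : (0 < size P)%N.
Let N : R := (size P)%:R.

Let N1 : 1 <= N. Proof. by rewrite ler1n. Qed.
Let N0 : 0 < N. Proof. by rewrite ltr0n. Qed.
Let Nge n : 0 <= N ^+ n. Proof. by rewrite exprn_ge0 ?ler0n. Qed.
Let Ngt n : 0 < N ^+ n. Proof. by rewrite exprn_gt0. Qed.
Let K0 : 0 < K. Proof. by apply: lt_le_trans K1. Qed.

Lemma count_sums_le s z : (count_mem z (sums P s.+2) <= k * size P ^ s)%N.
Proof.
elim: s z => [|s IH] z; first by rewrite muln1.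
rewrite [sums P _]/= count_sumset.
apply: (@leq_trans (\sum_(y <- P) k * size P ^ s)); first by apply: leq_sum.
by rewrite big_const_seq count_predT iter_addn_0 expnSr mulnA.
Qed.

Lemma bilinear_sumset (Lw Lu : seq G) (mw mu : nat) :
  (forall x, (count_mem x Lw <= mw)%N) -> (forall x, (count_mem x Lu <= mu)%N) ->
  (dot (sumset Lw P) Lu)%:R <=
  K * (25 * (cbrt ((size Lw)%:R * (dot Lw Lw)%:R) * cbrt ((size Lu)%:R * (dot Lu Lu)%:R))
    + mu%:R * (size Lw)%:R + mw%:R * (size Lu)%:R) :> R.
Proof.
move=> hw hu; apply: le_trans (bilinear_incidence K1 incidence_cube hw hu).
rewrite dot_sumset natr_sum; apply: ler_sum => x _.
by rewrite natr_sum.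
Qed.

Lemma energy2_le : (energy P 2)%:R <= k%:R * N ^+ 2.
Proof.
rewrite -natrX -natrM ler_nat; apply: leq_trans (dot_le_size sums2) _.
by rewrite size_sums.
Qed.

(** The excess passes from [h ^+ 2] to [h], so its exponent is halved. Arguing by contradiction
    makes the lower order terms absorbable. *)
Lemma energy_step s (M h : R) : 1 <= h -> (50 * K) ^+ 3 <= M -> 4 * K * k%:R <= M ->
  (energy P s.+2)%:R <= M * (N ^+ (2 * s + 1) * h ^+ 2) ->
  (energy P s.+3)%:R <= M * (N ^+ (2 * s + 3) * h).
Proof.
move=> h1 M1 M2 IH; set e : R := (energy P s.+3)%:R.
have M0 : 0 < M by apply: lt_le_trans M1; rewrite exprn_gt0 // mulr_gt0.
rewrite leNgt; apply/negP => big.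
have h0 : 0 < h by apply: lt_le_trans h1.
set T := N ^+ (2 * s + 3) * h in big.
have T0 : 0 < T by rewrite mulr_gt0.
have e0 : 0 < e by apply: lt_trans big; rewrite mulr_gt0.
have c1 x : (count_mem x (sums P s.+2) <= k * size P ^ s)%N by apply: count_sums_le.
have c2 x : (count_mem x (sums P s.+3) <= k * size P ^ s.+1)%N by apply: count_sums_le.
have := bilinear_sumset c1 c2; rewrite -/(sums P s.+3) -/(energy P s.+3) -/e !size_sums.
rewrite !(natrM _ k) !natrX -/N -/(energy P s.+2) -/(energy P s.+3) -/e.
set a : R := cbrt _; set b : R := cbrt _.
have a3 : a ^+ 3 = N ^+ s.+2 * (energy P s.+2)%:R by rewrite cbrtK // mulr_ge0 ?Nge ?ler0n.
have b3 : b ^+ 3 = N ^+ s.+3 * e by rewrite cbrtK // mulr_ge0 ?Nge ?(ltW e0).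
have -> : k%:R * N ^+ s.+1 * N ^+ s.+2 = k%:R * N ^+ (2 * s + 3).
  by rewrite -mulrA -exprD; congr (_ * _ ^+ _); clear; lia.
have -> : k%:R * N ^+ s * N ^+ s.+3 = k%:R * N ^+ (2 * s + 3).
  by rewrite -mulrA -exprD; congr (_ * _ ^+ _); clear; lia.
move=> he.
(* Hence the two lower order terms together are at most half of [e]. *)
have kT : 4 * K * (k%:R * N ^+ (2 * s + 3)) <= M * T.
  rewrite [X in X <= _]mulrA; apply: ler_pM.
  - by rewrite !mulr_ge0 // ltW.
  - exact: Nge.
  - exact: M2.
  - by rewrite /T ler_peMr.
have {he} : e <= 50 * K * (a * b) by lra.
move=> he; have {he} : e ^+ 3 <= (50 * K * (a * b)) ^+ 3.
  have ab0 : 0 <= 50 * K * (a * b) by rewrite !mulr_ge0 ?cbrt_ge0 ?(ltW K0).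
  by rewrite lerXn2r ?nnegrE ?(ltW e0).
rewrite exprMn [(a * b) ^+ 3]exprMn a3 b3 => he.
(* The cubed right side contains [e] once, which cancels. *)
have {he} : e ^+ 2 <= (50 * K) ^+ 3 * (N ^+ s.+2 * (energy P s.+2)%:R * N ^+ s.+3).
  by rewrite -(ler_pM2r e0) -exprSr; apply: le_trans he _; rewrite !mulrA.
move=> he; have {he} : e ^+ 2 <= M * (M * T ^+ 2).
  apply: le_trans he _; apply: ler_pM => //.
  - by rewrite exprn_ge0 // mulr_ge0 // ltW.
  - by rewrite mulr_ge0 ?Nge // mulr_ge0 ?Nge ?ler0n.
  rewrite mulrAC -exprD; apply: (@le_trans _ _ (N ^+ (s.+2 + s.+3) * (M * (N ^+ (2 * s + 1) * h ^+ 2)))).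
    by rewrite ler_pM2l.
  rewrite /T exprMn -exprM mulrCA ler_pM2l // mulrA -exprD.
  by rewrite (_ : s.+2 + s.+3 + (2 * s + 1) = (2 * s + 3) * 2)%N //; clear; lia.
have : (M * T) ^+ 2 < e ^+ 2 by rewrite ltrXn2r ?(ltW (mulr_gt0 M0 T0)).
by rewrite exprMn [M ^+ 2]expr2 -mulrA => lt /(lt_le_trans lt); rewrite ltxx.
Qed.

Lemma count_even_le p n : (count_mem n (sums P (p + p)) <= energy P p)%N.
Proof.
rewrite -(ler_nat R) count_sumsD; apply: dot_le => //.
by rewrite dot_reflected.
Qed.

(** The excess is written [g ^+ 3] because the two cube roots of the bilinear estimate turn it into
    [g ^+ 2]. *)
Lemma count_odd_le p (M g : R) n : 1 <= g -> 0 <= M ->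
  (energy P p.+2)%:R <= M * (N ^+ (2 * p + 1) * g ^+ 3) ->
  (count_mem n (sums P (p.+3 + p.+2)))%:R <=
    K * (25 * cbrt M ^+ 2 + 2 * k%:R) * (N ^+ (2 * p + 2) * g ^+ 2).
Proof.
move=> g1 M0 hE; have g0 : 0 < g by apply: lt_le_trans g1.
rewrite count_sumsD.
have c1 x : (count_mem x (sums P p.+2) <= k * size P ^ p)%N by apply: count_sums_le.
have c2 x : (count_mem x (reflected n (sums P p.+2)) <= k * size P ^ p)%N.
  by rewrite count_reflected.
apply: le_trans (bilinear_sumset c1 c2) _; rewrite dot_reflected /reflected size_map.
rewrite !size_sums !(natrM _ k) !natrX -/N -/(energy P p.+2) -expr2.
set a : R := cbrt _.
have a_le : a <= cbrt M * (N ^+ p.+1 * g).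
  apply: cbrt_le; first by rewrite mulr_ge0 ?Nge ?(ltW g0) //.
    by rewrite !mulr_ge0 ?cbrt_ge0 ?Nge ?(ltW g0) //.
  rewrite 2!exprMn cbrtK //; apply: (@le_trans _ _ (N ^+ p.+2 * (M * (N ^+ (2 * p + 1) * g ^+ 3)))).
    by rewrite ler_pM2l.
  have e3 : (p.+1 * 3 = p.+2 + (2 * p + 1))%N by clear; lia.
  rewrite -exprM e3 (exprD N p.+2); move: (N ^+ p.+2) (N ^+ (2 * p + 1)) => u v.
  by rewrite [X in X <= _](_ : _ = M * (u * v * g ^+ 3)) //; ring.
have a2 : a ^+ 2 <= cbrt M ^+ 2 * (N ^+ (2 * p + 2) * g ^+ 2).
  apply: (@le_trans _ _ ((cbrt M * (N ^+ p.+1 * g)) ^+ 2)).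
    by rewrite lerXn2r ?nnegrE ?cbrt_ge0 // !mulr_ge0 ?cbrt_ge0 ?Nge ?(ltW g0).
  by rewrite 2!exprMn -exprM (_ : p.+1 * 2 = 2 * p + 2)%N //; clear; lia.
have -> : k%:R * N ^+ p * N ^+ p.+2 = k%:R * N ^+ (2 * p + 2).
  by rewrite -mulrA -exprD; congr (_ * _ ^+ _); clear; lia.
have kg : k%:R * N ^+ (2 * p + 2) <= k%:R * (N ^+ (2 * p + 2) * g ^+ 2).
  by rewrite ler_wpM2l // ler_peMr ?exprn_ege1.
by rewrite -mulrA ler_pM2l //; lra.
Qed.

End Energy.

(** * The gain in the energy of order four *)

Section Moments.
Variables (R : realType) (T : eqType) (L : seq T) (m : nat).
Hypothesis Lm : forall x, (count_mem x L <= m)%N.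
Let c (x : T) : R := (count_mem x L)%:R.

Lemma upper_half_count (n : nat) : (n%:R <= 2 * \sum_(j < n) (n <= 2 * j.+1)%N%:R :> R).
Proof.
rewrite mulr2n mulrDl !mul1r {2}(reindex_inj rev_ord_inj) -big_split /=.
rewrite -[X in X <= _](_ : \sum_(j < n) 1 = _); last by rewrite sumr_const card_ord.
apply: ler_sum => j _; rewrite -natrD ler1n addn_gt0 !lt0b.
by move: (ltn_ord j); clear; lia.
Qed.

Lemma power_le_upper_half (a n : nat) (lam : R) : lam <= n%:R ->
  n%:R ^+ a.+1 <= 2 ^+ a.+1 * \sum_(j < n) (lam <= 2 * j.+1%:R)%R%:R * j.+1%:R ^+ a :> R.
Proof.
move=> lamn; apply: (@le_trans _ _ (2 ^+ a.+1 * \sum_(j < n) (n <= 2 * j.+1)%N%:R * (n%:R / 2) ^+ a)).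
  rewrite -mulr_suml exprS [2 ^+ a.+1]exprS expr_div_n.
  rewrite [X in _ <= X](_ : _ = (2 * \sum_(j < n) (n <= 2 * j.+1)%N%:R) * n%:R ^+ a); last first.
    by field; rewrite expf_neq0 // pnatr_eq0.
  by rewrite ler_wpM2r ?exprn_ge0 ?upper_half_count.
rewrite ler_pM2l ?exprn_gt0 //; apply: ler_sum => j _.
case: (leqP n (2 * j.+1)) => [h|_]; last by rewrite mul0r mulr_ge0 ?exprn_ge0.
have h' : n%:R <= 2 * j.+1%:R :> R by rewrite -natrM ler_nat.
rewrite (le_trans lamn h') !mul1r lerXn2r ?nnegrE ?divr_ge0 //.
by rewrite ler_pdivrMr // mulrC.
Qed.

Lemma moment_le (a : nat) (lam : R) :
  \sum_(x <- L | lam <= c x) c x ^+ a <=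
  2 ^+ a.+1 * \sum_(j < m) (lam <= 2 * j.+1%:R)%R%:R * j.+1%:R ^+ a * (size (level L j))%:R.
Proof.
under [X in _ <= _ * X]eq_bigr do rewrite -sum1_size natr_sum.
rewrite (sum_level (fun=> 1) (fun j => (lam <= 2 * j.+1%:R)%R%:R * j.+1%:R ^+ a) Lm).
rewrite big_mkcond (@sum_by_value R _ _ (undup L)) ?undup_uniq //; last first.
  by move=> x; rewrite mem_undup.
rewrite mulr_sumr; apply: ler_sum => z _; rewrite -/(c z) mulr1.
case: ifPn => h; last first.
  by rewrite mulr0 mulr_ge0 ?exprn_ge0 // sumr_ge0 // => j _; rewrite mulr_ge0 ?exprn_ge0.
by rewrite -exprS power_le_upper_half.
Qed.

Variable B : R.
(** A weak l3 bound. Since sums over [L] carry one multiplicity, [moment2_le] is the critical third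
    moment, where a harmonic sum appears. *)
Hypothesis LB : forall j, (size (level L j))%:R * j.+1%:R ^+ 3 <= B.

Let B0 : 0 <= B. Proof. by apply: le_trans (LB 0); rewrite mulr_ge0 ?exprn_ge0. Qed.

Lemma sum_inv_sqr_tail (lam : R) : 0 < lam ->
  \sum_(j < m) (lam <= 2 * j.+1%:R)%R%:R * j.+1%:R ^- 2 <= 8 / lam :> R.
Proof.
move=> l0; have l2 : 0 < lam / 2 by rewrite divr_gt0.
apply: (@le_trans _ _ (\sum_(j < m) 4 * (lam / 2 + j.+1%:R) ^- 2)).
  apply: ler_sum => j _; have j0 : 0 < j.+1%:R :> R by rewrite ltr0n.
  have s0 : 0 < lam / 2 + j.+1%:R by rewrite addr_gt0.
  have [h|h] := boolP (lam <= 2 * j.+1%:R); rewrite ?mul1r ?mul0r; last by rewrite mulr_ge0 ?invr_ge0 ?exprn_ge0 // ltW.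
  have -> : 4 * (lam / 2 + j.+1%:R) ^- 2 = ((lam / 2 + j.+1%:R) / 2) ^- 2.
    by move: (lam / 2 + _) s0 => s s0; field; rewrite gt_eqF.
  rewrite lef_pV2 ?posrE ?exprn_gt0 ?divr_gt0 //; apply: lerXn2r; rewrite ?nnegrE ?ler0n //.
    by rewrite ltW ?divr_gt0.
  by rewrite ler_pdivrMr //; lra.
rewrite -mulr_sumr; apply: (@le_trans _ _ (4 * (lam / 2)^-1)).
  rewrite ler_pM2l //; apply: le_trans (sum_inv_sqr m l2) _.
  by rewrite gerBl invr_ge0 addr_ge0 // ltW.
by rewrite invf_div mulrA; lra.
Qed.

Let LB' j : (size (level L j))%:R <= B / j.+1%:R ^+ 3.
Proof. by rewrite ler_pdivlMr ?exprn_gt0 ?ltr0n. Qed.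

Lemma moment0_le (lam : R) : 0 < lam ->
  (size [seq x <- L | lam <= c x])%:R <= 32 * B / lam ^+ 2.
Proof.
move=> l0; rewrite -sum1_size natr_sum big_filter.
rewrite (eq_bigr (fun x => c x ^+ 0)); last by move=> x _; rewrite expr0.
apply: le_trans (moment_le 0 lam) _; rewrite expr1.
apply: (@le_trans _ _ (2 * \sum_(j < m) (2 * B / lam) * ((lam <= 2 * j.+1%:R)%R%:R * j.+1%:R ^- 2))).
  rewrite ler_pM2l //; apply: ler_sum => j _; rewrite expr0 mulr1.
  have j0 : 0 < j.+1%:R :> R by rewrite ltr0n.
  have [h|h] := boolP (lam <= 2 * j.+1%:R); rewrite ?mul0r ?mulr0 // !mul1r.
  apply: le_trans (LB' j) _; rewrite [j.+1%:R ^+ 3]exprS invfM mulrA ler_pM2r ?invr_gt0 ?exprn_gt0 //.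
  rewrite ler_pdivrMr // -[X in X <= _]mulr1 mulrAC -!mulrA mulrCA.
  by rewrite ler_wpM2l // mulrA ler_pdivlMr // mul1r.
rewrite -mulr_sumr; apply: (@le_trans _ _ (2 * (2 * B / lam * (8 / lam)))).
  by rewrite ler_pM2l // ler_wpM2l ?sum_inv_sqr_tail // divr_ge0 ?mulr_ge0 // ltW.
rewrite le_eqVlt; apply/ssrbool.orP; left; apply/eqP; field.
by rewrite gt_eqF.
Qed.

Lemma moment1_le (lam : R) : 0 < lam ->
  \sum_(x <- L | lam <= c x) c x <= 32 * B / lam.
Proof.
move=> l0; rewrite (eq_bigr (fun x => c x ^+ 1)); last by move=> x _; rewrite expr1.
apply: le_trans (moment_le 1 lam) _.
apply: (@le_trans _ _ (4 * \sum_(j < m) B * ((lam <= 2 * j.+1%:R)%R%:R * j.+1%:R ^- 2))).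
  rewrite (_ : 2 ^+ 2 = 4 :> R); last by ring.
  rewrite ler_pM2l //; apply: ler_sum => j _; rewrite expr1.
  have j0 : 0 < j.+1%:R :> R by rewrite ltr0n.
  have [h|h] := boolP (lam <= 2 * j.+1%:R); rewrite ?mul0r ?mulr0 // !mul1r.
  apply: le_trans (_ : j.+1%:R * (B / j.+1%:R ^+ 3) <= _); first by rewrite ler_pM2l.
  rewrite le_eqVlt; apply/ssrbool.orP; left; apply/eqP.
  by move: (j.+1%:R) j0 => t t0; field; rewrite gt_eqF.
rewrite -mulr_sumr; apply: (@le_trans _ _ (4 * (B * (8 / lam)))).
  by rewrite ler_pM2l // ler_wpM2l ?sum_inv_sqr_tail.
rewrite le_eqVlt; apply/ssrbool.orP; left; apply/eqP; field.
by rewrite gt_eqF.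
Qed.

Lemma moment2_le : \sum_(x <- L) c x ^+ 2 <= 8 * B * \sum_(j < m) j.+1%:R^-1.
Proof.
rewrite [X in X <= _](_ : _ = \sum_(x <- L | 0 <= c x) c x ^+ 2); last first.
  by apply: eq_bigl => x; rewrite ler0n.
apply: le_trans (moment_le 2 0) _; rewrite -mulrA.
rewrite (_ : 2 ^+ 3 = 8 :> R); last by ring.
rewrite ler_pM2l // mulr_sumr; apply: ler_sum => j _.
have j0 : 0 < j.+1%:R :> R by rewrite ltr0n.
rewrite mulr_ge0 ?ler0n // mul1r.
apply: le_trans (_ : j.+1%:R ^+ 2 * (B / j.+1%:R ^+ 3) <= _).
  by rewrite ler_pM2l // exprn_gt0.
rewrite le_eqVlt; apply/ssrbool.orP; left; apply/eqP.
by move: (j.+1%:R) j0 => t t0; field; rewrite gt_eqF.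
Qed.

Lemma size_level_mul (j : nat) : (size (level L j) * j.+1 <= size L)%N.
Proof.
rewrite -(ler_nat R) natrM -sum1_size -[size L]sum1_size !natr_sum mulr_suml.
rewrite (@sum_by_value R _ L (undup L)) ?undup_uniq //; last by move=> x; rewrite mem_undup.
rewrite big_filter big_mkcond; apply: ler_sum => z _; rewrite mulr1 mul1r.
by case: ltnP => // h; rewrite ler_nat.
Qed.

End Moments.

Lemma harmonic_le_ln (R : realType) (m : nat) : (0 < m)%N ->
  \sum_(j < m) j.+1%:R^-1 <= 1 + ln m%:R :> R.
Proof.
case: m => // m _; elim: m => [|m IH].
  by rewrite big_ord_recl big_ord0 ln1 invr1.
rewrite big_ord_recr /=; apply: le_trans (lerD IH (lexx _)) _.
rewrite -addrA lerD2l.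
have h1 : 0 < m.+1%:R :> R by rewrite ltr0n.
have h2 : 0 < m.+2%:R :> R by rewrite ltr0n.
have := @le_ln1Dx R (- m.+2%:R^-1); rewrite ltrN2 invf_lt1 // ltr1n => /(_ isT).
have -> : 1 - m.+2%:R^-1 = m.+1%:R / m.+2%:R :> R.
  have -> : m.+1%:R = m.+2%:R - 1 :> R by rewrite -[m.+2%:R]natr1 addrK.
  by move: (m.+2%:R) h2 => t t0; field; rewrite gt_eqF.
rewrite ln_div ?posrE // => h.
by move: (ln m.+1%:R) (ln m.+2%:R) (m.+2%:R^-1) h => a b c; lra.
Qed.

(** Either [b] is at least half of [lam * d], or [a * c] dominates and the inequality is cubed and
    divided by [d ^+ 2]. *)
Lemma cube_dichotomy (R : realType) (lam d c a b W : R) :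
  0 <= lam -> 0 <= d -> 0 <= a -> 0 <= c -> 0 <= b -> 0 <= W -> c ^+ 3 = d ^+ 2 * W ->
  lam * d <= a * c + b -> d * lam ^+ 3 <= (2 * a) ^+ 3 * W + 2 * b * lam ^+ 2.
Proof.
move=> l0 d0 a0 c0 b0 W0 c3 h.
have t1 : 0 <= (2 * a) ^+ 3 * W by rewrite mulr_ge0 // exprn_ge0 // mulr_ge0.
have t2 : 0 <= 2 * b * lam ^+ 2 by rewrite !mulr_ge0 ?exprn_ge0.
have [hb|hb] := leP (lam * d) (2 * b).
  apply: (@le_trans _ _ (2 * b * lam ^+ 2)); last by lra.
  by rewrite (_ : d * _ = (lam * d) * lam ^+ 2); [rewrite ler_wpM2r ?exprn_ge0|ring].
apply: (@le_trans _ _ ((2 * a) ^+ 3 * W)); last by lra.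
have [->|dn] := eqVneq d 0; first by rewrite mul0r.
have dp : 0 < d by rewrite lt_neqAle eq_sym dn.
have h3 : (lam * d) ^+ 3 <= (2 * a * c) ^+ 3.
  by apply: lerXn2r; rewrite ?nnegrE ?mulr_ge0 //; lra.
rewrite -(ler_pM2r (exprn_gt0 2 dp)).
rewrite (_ : d * _ * _ = (lam * d) ^+ 3); last by ring.
by apply: le_trans h3 _; rewrite exprMn c3 [d ^+ 2 * W]mulrC mulrA.
Qed.

(** * Weak l3 bounds for [P + P - P] and for [D] *)

Section Popular.
Variables (R : realType) (G : zmodType) (P : seq G) (K : R) (k : nat).
Hypothesis K1 : 1 <= K.
Hypothesis incidence_cube : forall X Z : seq G, uniq X -> uniq Z ->
  (incidences P X Z)%:R ^+ 3 <=
  K * ((size X)%:R ^+ 2 * (size Z)%:R ^+ 2 + (size X)%:R ^+ 3 + (size Z)%:R ^+ 3) :> R.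
Hypothesis sums2 : forall z, (count_mem z (sums P 2) <= k)%N.
Hypothesis P0 : (0 < size P)%N.
Let N : R := (size P)%:R.

Let N1 : 1 <= N. Proof. by rewrite ler1n. Qed.
Let N0 : 0 < N. Proof. by rewrite ltr0n. Qed.
Let Nge n : 0 <= N ^+ n. Proof. by rewrite exprn_ge0 ?ler0n. Qed.
Let K0 : 0 < K. Proof. by apply: lt_le_trans K1. Qed.

Let Kge : 0 <= K. Proof. exact: ltW. Qed.

(** Values of [V] below [kappa] contribute at most [N * kappa] at each [z]; only the others enter
    the bilinear estimate, so that the last term is a tail of [V]. *)
Lemma popular_bound (V D : seq G) (lam kappa : R) (mv : nat) : uniq D -> 0 <= kappa ->
  (forall x, (count_mem x V <= mv)%N) ->
  (forall z, z \in D -> lam <= (\sum_(p <- P) count_mem (z + p)%R V)%N%:R) ->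
  lam * (size D)%:R <= N * kappa * (size D)%:R +
    K * (25 * cbrt ((size D)%:R ^+ 2 * ((size V)%:R * (dot V V)%:R)) + mv%:R * (size D)%:R
      + (size [seq x <- V | kappa <= (count_mem x V)%:R])%:R).
Proof.
move=> uD k0 Vm hD; set V' := [seq x <- V | _]; set d : R := (size D)%:R.
have cV' x : (count_mem x V' <= count_mem x V)%N.
  by rewrite count_filter; apply: sub_count => y /= /andP[].
have V'm x : (count_mem x V' <= mv)%N by apply: leq_trans (Vm x).
have D1 x : (count_mem x D <= 1)%N by rewrite count_uniq_mem // leq_b1.
have dD : dot D D = size D.
  rewrite /dot -sum1_size !big_seq; apply: eq_bigr => x xD.
  by rewrite count_uniq_mem // xD.
have := bilinear_incidence K1 incidence_cube D1 V'm; rewrite dD -/d mul1r => bil.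
have low : lam * d <= N * kappa * d + \sum_(x <- D) \sum_(p <- P) (count_mem (x + p) V')%:R.
  rewrite -/d; apply: (@le_trans _ _ (\sum_(x <- D) (N * kappa + \sum_(p <- P) (count_mem (x + p) V')%:R))).
    rewrite /d -sum1_size natr_sum mulr_sumr big_seq [X in _ <= X]big_seq.
    apply: ler_sum => x xD; rewrite mulr1; apply: le_trans (hD x xD) _.
    rewrite /N -sum1_size !natr_sum mulr_suml -big_split; apply: ler_sum => p _ /=.
    rewrite mul1r; have [h|h] := leP kappa (count_mem (x + p) V)%:R.
      rewrite ler_wpDl // ler_nat count_filter; apply: sub_count => y /= /eqP ->.
      by rewrite eqxx.
    by rewrite ler_wpDr // ltW.
  rewrite big_split /= lerD2r.
  by rewrite /d -sum1_size natr_sum mulr_sumr; apply: ler_sum => x _; rewrite mulr1.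
apply: le_trans low _; rewrite lerD2l; apply: le_trans bil _.
rewrite ler_pM2l // lerD2r lerD2r // ler_pM2l //.
rewrite -expr2 -cbrtM ?sqr_ge0 ?mulr_ge0 //.
apply: ge0_ler_powR => //; rewrite ?nnegrE ?mulr_ge0 ?sqr_ge0 ?invr_ge0 //.
rewrite ler_wpM2l ?sqr_ge0 // ler_pM // ler_nat.
  by rewrite size_filter count_size.
rewrite /dot big_filter big_mkcond; apply: leq_sum => x _.
by case: ifP => // _; apply: cV'.
Qed.

Definition opps (L : seq G) : seq G := [seq - x | x <- L].

Lemma count_sub L1 L2 z :
  count_mem z (sumset L1 (opps L2)) = (\sum_(y <- L2) count_mem (z + y)%R L1)%N.
Proof. by rewrite count_sumset big_map; apply: eq_bigr => y _; rewrite opprK. Qed.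

Let Y := sums P 2.
Let T := sumset Y (opps P).
Let D := sumset Y (opps Y).

Let size_Y : size Y = (size P ^ 2)%N. Proof. exact: size_sums. Qed.
Let size_T : size T = (size P ^ 3)%N. Proof. by rewrite size_sumset size_Y size_map -expnSr. Qed.
Let size_D : size D = (size P ^ 4)%N. Proof. by rewrite size_sumset size_map size_Y -expnD. Qed.

Let count_T z : (count_mem z T <= k * size P)%N.
Proof.
rewrite count_sub; apply: (@leq_trans (\sum_(p <- P) k)); first by apply: leq_sum.
by rewrite big_const_seq count_predT iter_addn_0.
Qed.

Lemma count_D_sum z : count_mem z D = (\sum_(p <- P) count_mem (z + p)%R T)%N.
Proof.
rewrite count_sub (sum_sums2 P (fun y => count_mem (z + y)%R Y)).
apply: eq_bigr => p _; rewrite count_sub; apply: eq_bigr => q _.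
by rewrite addrA.
Qed.

Lemma count_D z : (count_mem z D <= k * size P ^ 2)%N.
Proof.
rewrite count_D_sum; apply: (@leq_trans (\sum_(p <- P) k * size P)); first exact: leq_sum.
by rewrite big_const_seq count_predT iter_addn_0 -mulnA.
Qed.

(** The summands come from small [j], from the main term and from the linear term of the incidence
    bound; [K_D] is built alike. *)
Definition K_T : R := (4 * K * k%:R) ^+ 2 + (100 * K) ^+ 3 * k%:R + 4 * K * k%:R ^+ 2.

Lemma level_T j : (size (level T j))%:R * j.+1%:R ^+ 3 <= K_T * N ^+ 4.
Proof.
set d : R := (size (level T j))%:R; set J : R := j.+1%:R.
have J0 : 0 < J by rewrite ltr0n.
have d0 : 0 <= d by rewrite ler0n.
have a1 : 0 <= (4 * K * k%:R) ^+ 2 by rewrite sqr_ge0.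
have a2 : 0 <= (100 * K) ^+ 3 * k%:R := mulr_ge0 (exprn_ge0 3 (mulr_ge0 (ler0n _ _) Kge)) (ler0n _ _).
have a3 : 0 <= 4 * K * k%:R ^+ 2 by rewrite !mulr_ge0 ?exprn_ge0 ?Kge.
have [hJ|hJ] := leP J (4 * K * k%:R).
  (* For bounded [J], Markov's inequality is enough. *)
  have dJ : d * J <= N ^+ 3.
    rewrite /d /J -natrM /N -natrX ler_nat -size_T; exact: (size_level_mul R T j).
  apply: (@le_trans _ _ (N ^+ 3 * (4 * K * k%:R) ^+ 2)).
    rewrite [J ^+ 3]exprS mulrA; apply: ler_pM => //; rewrite ?mulr_ge0 ?exprn_ge0 ?(ltW J0) //.
    by apply: lerXn2r; rewrite ?nnegrE ?(ltW J0) ?mulr_ge0 // ltW.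
  rewrite mulrC; apply: ler_pM => //; first by rewrite /K_T; lra.
  by rewrite [N ^+ 4]exprS ler_peMl.
have [->|dn] := eqVneq d 0; first by rewrite mul0r mulr_ge0 // /K_T; lra.
have Jk : J <= k%:R * N.
  rewrite -natrM ler_nat; move: dn; rewrite pnatr_eq0 size_eq0.
  case E : (level T j) => [//|z s] _; have : z \in level T j by rewrite E inE eqxx.
  by rewrite mem_level => h; apply: leq_trans h (count_T z).
have hD z : z \in level T j -> J <= (\sum_(p <- P) count_mem (z + p)%R Y)%N%:R.
  by rewrite mem_level count_sub -(ler_nat R).
have := popular_bound (level_uniq T j) (lexx 0) sums2 hD.
rewrite -/d mulr0 mul0r add0r; set c := cbrt _ => h.
have W0 : 0 <= (size Y)%:R * (dot Y Y)%:R :> R by rewrite mulr_ge0.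
have c3 : c ^+ 3 = d ^+ 2 * ((size Y)%:R * (dot Y Y)%:R).
  by rewrite cbrtK // mulr_ge0 ?sqr_ge0.
have c0 : 0 <= c by apply: cbrt_ge0.
have hs : (size [seq x <- Y | 0 <= (count_mem x Y)%:R :> R])%:R <= N ^+ 2.
  by rewrite -natrX ler_nat -size_Y size_filter count_size.
have hd : K * (k%:R * d) <= J * d / 4.
  have : 4 * K * k%:R * d <= J * d by rewrite ler_wpM2r // ltW.
  rewrite (_ : 4 * K * k%:R * d = 4 * (K * (k%:R * d))); last by ring.
  by move: (K * (k%:R * d)) (J * d) => s t hst; lra.
have hKs : K * (size [seq x <- Y | 0 <= (count_mem x Y)%:R :> R])%:R <= K * N ^+ 2.
  by rewrite ler_wpM2l.
have hJ' : J * d <= 50 * K * c + 2 * (K * N ^+ 2).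
  have Kc : 0 <= K * c by rewrite mulr_ge0.
  have N2 : 0 <= K * N ^+ 2 by rewrite mulr_ge0.
  by move: h; rewrite !mulrDr [K * (25 * c)]mulrCA; lra.
have := cube_dichotomy (ltW J0) d0 _ c0 _ W0 c3 hJ'.
rewrite !mulr_ge0 ?exprn_ge0 ?Kge // => /(_ isT isT) {}h; apply: le_trans h _.
have distr a b e f : (a + b + e) * f = a * f + (b * f + e * f) :> R by ring.
rewrite /K_T distr {distr}.
apply: ler_wpDl; first exact: mulr_ge0.
apply: lerD.
  rewrite (_ : 2 * (50 * K) = 100 * K); last by ring.
  rewrite -mulrA ler_wpM2l ?exprn_ge0 ?mulr_ge0 // size_Y natrX.
  have := energy2_le R sums2; rewrite -/N /energy -/Y => hE.
  rewrite (_ : k%:R * _ = N ^+ 2 * (k%:R * N ^+ 2)); first by rewrite ler_wpM2l.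
  by ring.
rewrite (_ : 4 * K * k%:R ^+ 2 * N ^+ 4 = 2 * (2 * (K * N ^+ 2)) * (k%:R * N) ^+ 2); last by ring.
rewrite ler_wpM2l //; first by rewrite !mulr_ge0.
by apply: lerXn2r; rewrite ?nnegrE ?(ltW J0) ?mulr_ge0 // ltW.
Qed.

(* [x] is [N ^ (1/16)], which keeps all exponents integral. *)
Variables (M3 x : R).
Hypotheses (M3_ge0 : 0 <= M3) (x1 : 1 <= x) (xN : x ^+ 16 = N).
Hypothesis energy3 : (energy P 3)%:R <= M3 * x ^+ 56.

Let x0 : 0 < x. Proof. exact: lt_le_trans x1. Qed.

Lemma dot_sub_sub (A B C E : seq G) :
  dot (sumset A (opps B)) (sumset C (opps E)) = dot (sumset A E) (sumset C B).
Proof.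
pose f (a b c e : G) : nat := (a + e == c + b).
have fE a b c e : (a - b == c - e) = (a + e == c + b).
  by rewrite subr_eq addrAC eq_sym subr_eq eq_sym.
transitivity (\sum_(a <- A) \sum_(b <- B) \sum_(c <- C) \sum_(e <- E) f a b c e)%N.
  rewrite dotE sum_sumset; apply: eq_bigr => a _; rewrite big_map; apply: eq_bigr => b _.
  rewrite sum_sumset; apply: eq_bigr => c _; rewrite big_map; apply: eq_bigr => e _.
  by rewrite fE.
rewrite dotE sum_sumset; apply: eq_bigr => a _.
under eq_bigr do rewrite exchange_big.
rewrite exchange_big; apply: eq_bigr => e _ /=.
by rewrite exchange_big sum_sumset.
Qed.

Lemma dot_T : dot T T = energy P 3.
Proof. exact: dot_sub_sub. Qed.

Lemma energyD a b :
  energy P (a + b) = dot (sumset (sums P a) (sums P b)) (sumset (sums P a) (sums P b)).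
Proof.
rewrite /energy !dotE sum_sumsD sum_sumset; do 2!apply: eq_bigr => ? _.
by rewrite sum_sumsD sum_sumset.
Qed.

(** With all letters in [Y], [(a - b) + (c - e) = f - g] means [a + c + g = f + b + e]: six points
    of [P] on either side. *)
Lemma sum_count_DD : (\sum_(d <- D) \sum_(e <- D) count_mem (d + e)%R D)%N = energy P 6.
Proof.
transitivity (dot (sumset (sumset Y Y) (opps (sumset Y Y))) D).
  rewrite dot_sumset [RHS]sum_sumset [LHS]sum_sumset; apply: eq_bigr => a _.
  rewrite big_map; under [LHS]eq_bigr do rewrite sum_sumset.
  rewrite exchange_big; apply: eq_bigr => c _ /=.
  rewrite big_map [RHS]sum_sumset; apply: eq_bigr => b _.
  by rewrite big_map; apply: eq_bigr => e _; rewrite opprD addrACA.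
rewrite dot_sub_sub (energyD 4 2) !dotE.
have h4 (F : G -> nat) : (\sum_(z <- sums P 4) F z = \sum_(z <- sumset Y Y) F z)%N.
  by rewrite (sum_sumsD P 2 2) [RHS]sum_sumset.
rewrite [RHS]sum_sumset h4 [LHS]sum_sumset; do 2!apply: eq_bigr => ? _.
rewrite [RHS]sum_sumset h4 [LHS]sum_sumset exchange_big /=; do 2!apply: eq_bigr => ? _.
by rewrite [X in _ == X]addrC.
Qed.

Definition K_D : R := (8 * K * k%:R) ^+ 2 + (200 * K) ^+ 3 * M3 + 32 ^+ 2 * K * K_T.

Let xge n : 0 <= x ^+ n. Proof. by rewrite exprn_ge0 // ltW. Qed.
Let NX n : N ^+ n = x ^+ (16 * n). Proof. by rewrite -xN -exprM. Qed.

Let K_T_ge0 : 0 <= K_T.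
Proof. by rewrite /K_T !addr_ge0 ?exprn_ge0 ?mulr_ge0 ?exprn_ge0 ?mulr_ge0 ?Kge. Qed.

(** The exponent is [104 = 48 + 56], from [N^3 E_3]. The trivial bound [N^3] for the truncated [T]
    would only give [N^7], hence the tail bound drawn from [level_T]. *)
Lemma level_D j : (size (level D j))%:R * j.+1%:R ^+ 3 <= K_D * x ^+ 104.
Proof.
set d : R := (size (level D j))%:R; set J : R := j.+1%:R.
have J0 : 0 < J by rewrite ltr0n.
have d0 : 0 <= d by rewrite ler0n.
have a1 : 0 <= (8 * K * k%:R) ^+ 2 by rewrite sqr_ge0.
have a2 : 0 <= (200 * K) ^+ 3 * M3 := mulr_ge0 (exprn_ge0 3 (mulr_ge0 (ler0n _ _) Kge)) M3_ge0.
have a3 : 0 <= 32 ^+ 2 * K * K_T by apply: mulr_ge0 => //; apply: mulr_ge0 => //; apply: exprn_ge0.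
have N6 : N ^+ 6 <= x ^+ 104 by rewrite NX; apply: ler_weXn2l.
have [hJ|hJ] := leP J (8 * K * k%:R * N).
  have dJ : d * J <= N ^+ 4.
    rewrite /d /J -natrM /N -natrX ler_nat -size_D; exact: (size_level_mul R D j).
  apply: (@le_trans _ _ (N ^+ 4 * (8 * K * k%:R * N) ^+ 2)).
    rewrite [J ^+ 3]exprS mulrA; apply: ler_pM => //; rewrite ?mulr_ge0 ?exprn_ge0 ?(ltW J0) //.
    by apply: lerXn2r; rewrite ?nnegrE ?(ltW J0) ?mulr_ge0 // ltW.
  rewrite (_ : _ * _ = (8 * K * k%:R) ^+ 2 * N ^+ 6); last by ring.
  by apply: ler_pM => //; rewrite /K_D; lra.
(* The values of [T] below [kappa] account for at most half of [J]. *)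
pose kappa := J / (2 * N); have kappa0 : 0 < kappa by rewrite divr_gt0 ?mulr_gt0.
have hD z : z \in level D j -> J <= (\sum_(p <- P) count_mem (z + p)%R T)%N%:R.
  by rewrite mem_level count_D_sum -(ler_nat R).
have := popular_bound (level_uniq D j) (ltW kappa0) count_T hD.
rewrite -/d dot_T size_T natrX -/N; set c := cbrt _ => h.
have W0 : 0 <= N ^+ 3 * (energy P 3)%:R by rewrite mulr_ge0.
have c3 : c ^+ 3 = d ^+ 2 * (N ^+ 3 * (energy P 3)%:R).
  by rewrite cbrtK // mulr_ge0 ?sqr_ge0.
have c0 : 0 <= c by apply: cbrt_ge0.
have := moment0_le count_T level_T kappa0; rewrite -/N.
set v : R := (size _)%:R => hv; rewrite -/v in h.
have v0 : 0 <= v by rewrite ler0n.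
have hJ' : J * d <= 100 * K * c + 4 * (K * v).
  have Kc : 0 <= K * c by rewrite mulr_ge0.
  have Kv : 0 <= K * v by rewrite mulr_ge0.
  have e1 : N * kappa * d = J * d / 2 by rewrite /kappa; field; rewrite gt_eqF.
  have hd : K * ((k * size P)%N%:R * d) <= J * d / 8.
    have : 8 * K * k%:R * N * d <= J * d by rewrite ler_wpM2r // ltW.
    rewrite natrM -/N (_ : 8 * K * k%:R * N * d = 8 * (K * (k%:R * N * d))); last by ring.
    by move: (K * (k%:R * N * d)) (J * d) => s t hst; lra.
  have Jd : 0 <= J * d by rewrite mulr_ge0 // ltW.
  by move: h; rewrite e1 !mulrDr [K * (25 * c)]mulrCA; lra.
have Kv0 : 0 <= 4 * (K * v) by rewrite !mulr_ge0.
have Kc0 : 0 <= 100 * K by rewrite mulr_ge0.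
have := cube_dichotomy (ltW J0) d0 Kc0 c0 Kv0 W0 c3 hJ'.
move=> {}h; apply: le_trans h _.
have distr a b e f : (a + b + e) * f = a * f + (b * f + e * f) :> R by ring.
rewrite /K_D distr {distr}.
apply: ler_wpDl; first exact: mulr_ge0.
apply: lerD.
  rewrite (_ : 2 * (100 * K) = 200 * K); last by ring.
  rewrite -[X in _ <= X]mulrA ler_wpM2l ?exprn_ge0 ?mulr_ge0 //.
  rewrite (_ : M3 * _ = x ^+ 48 * (M3 * x ^+ 56)); last by ring.
  by rewrite NX ler_wpM2l.
apply: (@le_trans _ _ (32 ^+ 2 * K * K_T * N ^+ 6)); last by rewrite ler_wpM2l.
have -> : 32 ^+ 2 * K * K_T * N ^+ 6 = 2 * (4 * (K * (32 * (K_T * N ^+ 4) / kappa ^+ 2))) * J ^+ 2.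
  by rewrite /kappa; field; rewrite !gt_eqF.
by rewrite ler_wpM2r ?sqr_ge0 // !ler_pM2l.
Qed.
End Popular.

Lemma ler_sum_uniq (R : numDomainType) (T : eqType) (s t : seq T) (F : T -> R) :
  uniq s -> uniq t -> {subset s <= t} -> (forall x, 0 <= F x) ->
  \sum_(x <- s) F x <= \sum_(x <- t) F x.
Proof.
move=> us ut st F0; have ps : perm_eq s [seq x <- t | x \in s].
  apply: uniq_perm; rewrite ?filter_uniq // => x; rewrite mem_filter.
  by case: (boolP (x \in s)) => // /st ->.
rewrite (perm_big _ ps) big_filter /= big_mkcond; apply: ler_sum => x _.
by case: ifP.
Qed.

Lemma dot_map_filter (S : Type) (T : eqType) (phi : S -> T) (c : pred S) (L : seq S) :
  (dot (map phi [seq x <- L | c x]) (map phi [seq x <- L | c x]) <= dot (map phi L) (map phi L))%N.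
Proof.
rewrite !dotE !big_map big_filter big_mkcond; apply: leq_sum => x _; case: ifP => // _.
rewrite !big_map big_filter big_mkcond; apply: leq_sum => y _.
by case: ifP.
Qed.

(** * Popular differences and the triangles they span *)

Section Triangles.
Variables (R : realType) (G : zmodType) (Y : seq G).
Let D := sumset Y (opps Y).
Let rho (z : G) : R := (count_mem z D)%:R.
Let n : R := (size Y)%:R.
Let E : R := (dot (sumset Y Y) (sumset Y Y))%:R.

Let rho0 z : 0 <= rho z. Proof. exact: ler0n. Qed.

Lemma sum_differences (F : G -> R) :
  \sum_(v <- D) F v = \sum_(y <- Y) \sum_(z <- Y) F (y - z).
Proof. by rewrite sum_sumset; apply: eq_bigr => y _; rewrite big_map. Qed.

Lemma rho_sub (y z : G) : rho (y - z) = \sum_(a <- Y) \sum_(b <- Y) (y + b == z + a)%:R.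
Proof.
rewrite /rho count_sum natr_sum (sum_differences (fun v => (v == y - z)%:R)).
do 2!apply: eq_bigr => ? _; congr ((nat_of_bool _)%:R).
by rewrite subr_eq [X in _ == X]addrAC eq_sym subr_eq [X in _ == X]addrC.
Qed.

Lemma rho_opp z : rho (- z) = rho z.
Proof.
rewrite /rho !count_sum !natr_sum !(sum_differences (fun v => (v == _)%:R)) exchange_big /=.
by do 2!apply: eq_bigr => ? _; rewrite -[in RHS]eqr_opp opprB.
Qed.

Lemma energy_rho : E = \sum_(v <- D) rho v.
Proof. by rewrite /E -natr_sum -dot_sub_sub. Qed.

Lemma dot_sumset_rho (L : seq G) :
  (dot (sumset L Y) (sumset Y Y))%:R = \sum_(y <- L) \sum_(z <- Y) rho (y - z).
Proof.
rewrite dotE sum_sumset natr_sum; apply: eq_bigr => y _.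
under [RHS]eq_bigr do rewrite rho_sub.
rewrite natr_sum exchange_big /=.
under [RHS]eq_bigr do rewrite exchange_big.
rewrite [RHS]exchange_big; apply: eq_bigr => b _ /=.
rewrite sum_sumset natr_sum exchange_big /=; apply: eq_bigr => z _.
by rewrite natr_sum.
Qed.

Lemma dot_sumset_sumset_rho (L : seq G) :
  (dot (sumset L Y) (sumset L Y))%:R = \sum_(y <- L) \sum_(z <- L) rho (y - z).
Proof.
rewrite dotE sum_sumset natr_sum; apply: eq_bigr => y _.
under [RHS]eq_bigr do rewrite rho_sub exchange_big.
rewrite natr_sum [RHS]exchange_big; apply: eq_bigr => b _ /=.
by rewrite sum_sumset natr_sum; apply: eq_bigr => z _; rewrite natr_sum.
Qed.

Variable B : R.
Hypothesis tail : forall lam, 0 < lam -> \sum_(v <- D | lam <= rho v) rho v <= B / lam.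

(** Values below [tau] carry at most half of [E] and values from [lam] on at most a quarter; the
    remaining quarter has each value below [lam]. *)
Lemma popular_mass (tau lam : R) : 0 <= tau -> 0 < lam ->
  tau * n ^+ 2 <= E / 2 -> B / lam <= E / 4 ->
  E <= 4 * lam * \sum_(v <- D) (tau <= rho v)%R%:R.
Proof.
move=> t0 l0 h1 h2.
have : E <= tau * n ^+ 2 + lam * \sum_(v <- D) (tau <= rho v)%R%:R + B / lam.
  apply: le_trans (lerD (lexx _) (tail l0)); rewrite energy_rho.
  have -> : tau * n ^+ 2 = \sum_(v <- D) tau.
    by rewrite big_const_seq count_predT iter_addr_0 size_sumset size_map
      -[X in _ = X]mulr_natr natrM expr2.
  rewrite mulr_sumr [X in _ + X]big_mkcond -!big_split /=; apply: ler_sum => v _.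
  have [h|h] := leP lam (rho v).
    by rewrite ler_wpDl // addr_ge0 // mulr_ge0 // ltW.
  have [h'|h'] := leP tau (rho v); rewrite ?mulr1 ?mulr0 !addr0.
    by rewrite ler_wpDl // ltW.
  exact: ltW.
lra.
Qed.

Section Threshold.
Variable tau : R.
Hypothesis tau0 : 0 <= tau.
Let popular (y z : G) : bool := tau <= rho (y - z).
Let star (y : G) : seq G := [seq z <- Y | popular y z].
Let mass : R := \sum_(v <- D) (tau <= rho v)%R%:R.

Let popularC y z : popular y z = popular z y.
Proof. by rewrite /popular -rho_opp opprB. Qed.

Let sum_star (F : G -> R) y : \sum_(z <- star y) F z = \sum_(z <- Y) (popular y z)%:R * F z.
Proof.
rewrite big_filter big_mkcond; apply: eq_bigr => z _.
by case: ifP; rewrite ?mul1r ?mul0r.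
Qed.

(** By [dot_sumset_sumset_rho], the sum of [rho (z - z')] over pairs of popular neighbours [z], [z']
    of a common [y]. *)
Definition star_energy : R := \sum_(y <- Y) (dot (sumset (star y) Y) (sumset (star y) Y))%:R.

(* [rho] is positive definite: this bounds below the number of closed triangles. *)
Lemma star_energy_ge : tau ^+ 2 * mass ^+ 4 <= n ^+ 3 * E * star_energy.
Proof.
pose S := \sum_(y <- Y) (dot (sumset (star y) Y) (sumset Y Y))%:R : R.
pose u y := \sum_(b <- Y) (popular y b)%:R : R.
have u0 y : 0 <= u y by apply: sumr_ge0.
have massE : mass = \sum_(y <- Y) u y by rewrite /mass sum_differences.
have E0 : 0 <= E by apply: ler0n.
(* [S] sums [rho (z - b)] over [z] in [star y] and all [b]; keeping only the [b] popular with [z]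
   leaves [tau * u z ^+ 2] for each [z]. *)
have SE : tau * \sum_(y <- Y) u y ^+ 2 <= S.
  rewrite /S; under [X in _ <= X]eq_bigr do rewrite dot_sumset_rho sum_star.
  rewrite exchange_big mulr_sumr /=; apply: ler_sum => z _; rewrite -mulr_suml expr2.
  under [X in _ <= X * _]eq_bigr do rewrite popularC.
  rewrite -/(u z) mulrCA ler_wpM2l // mulr_sumr; apply: ler_sum => b _.
  rewrite /popular; case: (boolP (tau <= _)) => h; rewrite ?mulr1 // mulr0.
  exact: rho0.
have mass2 : mass ^+ 2 <= n * \sum_(y <- Y) u y ^+ 2.
  apply: sqr_le_of_amgm => //; first by apply: sumr_ge0 => y _; apply: sqr_ge0.
  move=> t; rewrite massE mulr_sumr /n -sum1_size natr_sum mulr_sumr -big_split /=.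
  apply: ler_sum => y _; rewrite mulr1 -subr_ge0.
  by rewrite (_ : _ - _ = (u y - t) ^+ 2) ?sqr_ge0 //; ring.
(* Positive definiteness enters here: the form given by [rho] is an inner product, to which
   Cauchy-Schwarz applies. *)
have S2 : S ^+ 2 <= (n * E) * star_energy.
  apply: sqr_le_of_amgm; rewrite ?mulr_ge0 //; first by apply: sumr_ge0.
  move=> t; have -> : t ^+ 2 * (n * E) = \sum_(y <- Y) t ^+ 2 * E.
    rewrite /n -sum1_size natr_sum mulr_suml mulr_sumr.
    by apply: eq_bigr => y _; rewrite mul1r.
  by rewrite /S mulr_sumr -big_split /=; apply: ler_sum => y _; apply: dot_amgm.
have S0 : 0 <= S by apply: sumr_ge0.
have mass0 : 0 <= mass by apply: sumr_ge0.
have h1 : tau * mass ^+ 2 <= n * S.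
  by apply: le_trans (ler_wpM2l tau0 mass2) _; rewrite mulrCA ler_wpM2l.
have : (tau * mass ^+ 2) ^+ 2 <= (n * S) ^+ 2.
  by apply: lerXn2r; rewrite ?nnegrE ?mulr_ge0 ?exprn_ge0.
rewrite (_ : (tau * _) ^+ 2 = tau ^+ 2 * mass ^+ 4); last by ring.
rewrite exprMn => h2; apply: le_trans h2 _.
rewrite (_ : n ^+ 3 * E * _ = n ^+ 2 * (n * E * star_energy)); last by ring.
by rewrite ler_wpM2l ?exprn_ge0.
Qed.

Variable tau2 : R.
Hypotheses (tau2_gt0 : 0 < tau2) (tau2_le : tau2 <= tau).

Let triple := allpairs pair (allpairs pair Y Y) Y.
Let closed (t : G * G * G) : bool :=
  [&& popular t.1.1 t.1.2, popular t.1.1 t.2 & tau2 <= rho (t.1.2 - t.2)].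
Let triangles := [seq t <- triple | closed t].
(** Determines the triangle up to translation; the third side is the sum of the two entries. *)
Let edges (t : G * G * G) : G * G := (t.1.2 - t.1.1, t.1.1 - t.2).

Let sum_triple (F : G * G * G -> R) :
  \sum_(t <- triple) F t = \sum_(a <- Y) \sum_(b <- Y) \sum_(c <- Y) F ((a, b), c).
Proof. by rewrite big_allpairs big_allpairs. Qed.

(** Third sides with [rho] below [tau2] or at least [lam] are bounded separately; every other pair
    of neighbours closes a triangle of weight below [lam]. *)
Lemma star_energy_le (lam : R) : 0 < lam ->
  star_energy <= tau2 * n ^+ 3 + lam * (size triangles)%:R + n * (B / lam).
Proof.
move=> l0; rewrite /star_energy.
have l0' := ltW l0; have t20 := ltW tau2_gt0.
have nn (b1 b2 : bool) v : 0 <= tau2 + lam * b1%:R + b2%:R * rho v.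
  by rewrite addr_ge0 ?mulr_ge0 // addr_ge0 ?mulr_ge0.
have -> : tau2 * n ^+ 3 = \sum_(t <- triple) tau2.
  rewrite big_const_seq count_predT iter_addr_0 !size_allpairs -[X in _ = X]mulr_natr !natrM.
  by rewrite -/n; ring.
have -> : (size triangles)%:R = \sum_(t <- triple) (closed t)%:R :> R.
  by rewrite -sum1_size natr_sum big_filter big_mkcond; apply: eq_bigr => t _; case: ifP.
apply: (@le_trans _ _ (\sum_(t <- triple) (tau2 + lam * (closed t)%:R +
    (lam <= rho (t.1.2 - t.2))%R%:R * rho (t.1.2 - t.2)))).
  rewrite sum_triple; apply: ler_sum => a _.
  rewrite dot_sumset_sumset_rho sum_star; apply: ler_sum => b _.
  rewrite sum_star mulr_sumr; apply: ler_sum => c _ /=.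
  rewrite /closed /=; case: (popular a b); last by rewrite mul0r nn.
  case: (popular a c); last by rewrite mul0r mulr0 nn.
  rewrite !mul1r /=; have [h|h] := leP lam (rho (b - c)).
    by rewrite mul1r ler_wpDl // addr_ge0 ?mulr_ge0.
  rewrite mul0r addr0; have [h'|h'] := leP tau2 (rho (b - c)).
    by rewrite mulr1 ler_wpDl ?(ltW h).
  by rewrite mulr0 addr0 ltW.
rewrite !big_split /= -mulr_sumr lerD2l sum_triple.
rewrite /n -sum1_size natr_sum mulr_suml; apply: ler_sum => a _; rewrite mul1r.
apply: le_trans (tail l0); rewrite [X in _ <= X]big_mkcond sum_differences.
by do 2![apply: ler_sum => ? _]; case: ifP; rewrite ?mul1r ?mul0r.
Qed.

(** For first vertices [a] and [a'], equal edges mean [b - b' = a - a' = c - c'], which gives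
    [rho (a - a') ^+ 2] pairs. *)
Lemma dot_edges_le :
  (dot (map edges triangles) (map edges triangles))%:R <= \sum_(v <- D) rho v ^+ 2.
Proof.
apply: le_trans (_ : (dot (map edges triple) (map edges triple))%:R <= _).
  by rewrite ler_nat dot_map_filter.
pose g (a a' b b' : G) : R := (b - b' == a - a')%:R.
have gg a b c a' b' c' : (edges (a, b, c) == edges (a', b', c'))%:R = g a a' b b' * g a a' c c'.
  have sub_eq (p q p' q' : G) : (p - q == p' - q') = (p - p' == q - q').
    rewrite -subr_eq0 -[RHS]subr_eq0; congr (_ == 0).
    by rewrite !opprB addrACA [RHS]addrACA [- q - p']addrC.
  by rewrite /edges /g /= xpair_eqE -natrM mulnb (sub_eq b) (sub_eq a) (eq_sym (a - a')).
have gE a a' : \sum_(b <- Y) \sum_(b' <- Y) g a a' b b' = rho (a - a').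
  by rewrite /rho count_sum natr_sum (sum_differences (fun v => (v == a - a')%:R)).
rewrite dotE big_map natr_sum sum_triple sum_differences.
apply: ler_sum => a _; rewrite [X in X <= _](_ : _ = \sum_(a' <- Y) rho (a - a') ^+ 2) //.
transitivity (\sum_(b <- Y) \sum_(c <- Y) \sum_(a' <- Y) \sum_(b' <- Y) \sum_(c' <- Y)
    g a a' b b' * g a a' c c').
  apply: eq_bigr => b _; apply: eq_bigr => c _.
  by rewrite big_map natr_sum sum_triple; do 3!apply: eq_bigr => ? _; apply: gg.
under eq_bigr do rewrite exchange_big.
rewrite exchange_big; apply: eq_bigr => a' _ /=.
rewrite expr2 -{1}gE mulr_suml; apply: eq_bigr => b _.
rewrite exchange_big mulr_suml; apply: eq_bigr => b' _ /=.
rewrite -gE mulr_sumr; apply: eq_bigr => c _; by rewrite mulr_sumr.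
Qed.

(** Each edge pair has [rho >= tau2] on all three sides; the factors [rho d] and [rho e] are the
    multiplicities of [d] and [e] in [D]. *)
Lemma size_edges_le : (size (undup (map edges triangles)))%:R * tau2 ^+ 3 <=
  \sum_(d <- D) \sum_(e <- D) rho (d + e).
Proof.
pose F (p : G * G) : R := rho p.1 * rho p.2 * rho (p.1 + p.2).
have F0 p : 0 <= F p by rewrite !mulr_ge0.
set U := undup _; pose UU := allpairs pair (undup D) (undup D).
have mem_diff a b : a \in Y -> b \in Y -> a - b \in D.
  by move=> aY bY; apply/allpairsP; exists (a, - b); split => //=; apply: map_f.
have inU p : p \in U -> p \in UU /\ tau2 ^+ 3 <= F p.
  rewrite mem_undup => /mapP[[[a b] c] + q]; rewrite mem_filter => /andP[/and3P[/= ab ac bc]].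
  rewrite /triple => /allpairsP[[[a' b'] c'] /= []].
  move=> /allpairsP[[a2 b2] /= [aY bY [ea eb]]] cY [ea' eb' ec].
  subst a b c a' b'; rewrite q; split.
    by apply/allpairsP; exists (b2 - a2, a2 - c'); split; rewrite //= mem_undup mem_diff.
  have ba : tau <= rho (b2 - a2) by rewrite -/(popular b2 a2) popularC.
  rewrite /F /edges /= addrA subrK !exprS expr0 mulr1 mulrA.
  have t20 := ltW tau2_gt0.
  apply: ler_pM => //; first by rewrite mulr_ge0.
  by apply: ler_pM => //; apply: le_trans tau2_le _.
apply: (@le_trans _ _ (\sum_(p <- U) F p)).
  rewrite -sum1_size natr_sum mulr_suml big_seq [X in _ <= X]big_seq.
  by apply: ler_sum => p /inU[_]; rewrite mul1r.
apply: (@le_trans _ _ (\sum_(p <- UU) F p)).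
  apply: ler_sum_uniq => //; first exact: undup_uniq.
    by apply: allpairs_uniq; rewrite ?undup_uniq // => -[? ?] [? ?].
  by move=> p /inU[].
rewrite big_allpairs (@sum_by_value R _ D (undup D)) ?undup_uniq //; last by move=> x; rewrite mem_undup.
apply: ler_sum => d _; rewrite (@sum_by_value R _ D (undup D)) ?undup_uniq //; last first.
  by move=> x; rewrite mem_undup.
by rewrite mulr_sumr; apply: ler_sum => e _; rewrite /F /= mulrA.
Qed.

Lemma triangles_le (E6 H : R) :
  \sum_(d <- D) \sum_(e <- D) rho (d + e) <= E6 -> \sum_(v <- D) rho v ^+ 2 <= H ->
  (size triangles)%:R ^+ 2 * tau2 ^+ 3 <= E6 * H.
Proof.
move=> h6 hH; have := size_sqr_le_dot R (map edges triangles); rewrite size_map => h.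
have t3 : 0 <= tau2 ^+ 3 by rewrite exprn_ge0 // ltW.
apply: le_trans (ler_wpM2r t3 h) _; rewrite mulrAC; apply: ler_pM => //.
- by rewrite mulr_ge0.
- exact: le_trans size_edges_le h6.
- exact: le_trans dot_edges_le hH.
Qed.

End Threshold.
End Triangles.

(** * The power saving in the fourth energy *)

Section Gain.
Variables (R : realType) (G : zmodType) (P : seq G) (K : R) (k : nat).
Hypothesis K1 : 1 <= K.
Hypothesis incidence_cube : forall X Z : seq G, uniq X -> uniq Z ->
  (incidences P X Z)%:R ^+ 3 <=
  K * ((size X)%:R ^+ 2 * (size Z)%:R ^+ 2 + (size X)%:R ^+ 3 + (size Z)%:R ^+ 3) :> R.
Hypothesis sums2 : forall z, (count_mem z (sums P 2) <= k)%N.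
Hypothesis P0 : (0 < size P)%N.
Let N : R := (size P)%:R.

Variables (M x : R).
Hypotheses (M1 : 1 <= M) (k1 : (0 < k)%N) (x1 : 1 <= x) (xN : x ^+ 16 = N).
Hypothesis energy3 : (energy P 3)%:R <= M * x ^+ 56.
Hypothesis energy4 : (energy P 4)%:R <= M * x ^+ 84.
Hypothesis energy6 : (energy P 6)%:R <= M * x ^+ 145.

Let Y := sums P 2.
Let D := sumset Y (opps Y).
Let rho (z : G) : R := (count_mem z D)%:R.
Let x0 : 0 < x. Proof. exact: lt_le_trans x1. Qed.
Let M0 : 0 < M. Proof. exact: lt_le_trans M1. Qed.
Let K0 : 0 < K. Proof. exact: lt_le_trans K1. Qed.
Let kd := K_D K k M.

Let kd1 : 1 <= kd.
Proof.
have kr : 1 <= k%:R :> R by rewrite ler1n.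
have h : 1 <= (8 * K * k%:R) ^+ 2.
  apply: exprn_ege1; rewrite -mulrA; apply: (@le_trans _ _ (K * k%:R)).
    exact: mulr_ege1.
  by rewrite ler_peMl ?ler1n // mulr_ge0 // ltW.
have h2 : 0 <= (200 * K) ^+ 3 * M := mulr_ge0 (exprn_ge0 3 (mulr_ge0 (ler0n _ _) (ltW K0))) (ltW M0).
have h3 : 0 <= 32 ^+ 2 * K * K_T K k.
  apply: mulr_ge0; first exact: (mulr_ge0 (exprn_ge0 2 (ler0n _ _)) (ltW K0)).
  have a1 : 0 <= (4 * K * k%:R) ^+ 2 by rewrite sqr_ge0.
  have a2 : 0 <= (100 * K) ^+ 3 * k%:R :=
    mulr_ge0 (exprn_ge0 3 (mulr_ge0 (ler0n _ _) (ltW K0))) (ler0n _ _).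
  have a3 : 0 <= 4 * K * k%:R ^+ 2 by rewrite !mulr_ge0 ?exprn_ge0 // ltW.
  by apply: addr_ge0 => //; apply: addr_ge0.
by apply: le_trans h _; rewrite /kd /K_D -addrA ler_wpDr // addr_ge0.
Qed.

Let kd0 : 0 < kd. Proof. exact: lt_le_trans kd1. Qed.

Let tail lam : 0 < lam -> \sum_(v <- D | lam <= rho v) rho v <= 32 * kd * x ^+ 104 / lam.
Proof.
move=> l0; rewrite -[32 * kd * _]mulrA; apply: moment1_le l0.
  exact: (count_D sums2).
exact: (level_D K1 incidence_cube sums2 P0 (ltW M0) x1 xN energy3).
Qed.

Let sqr_sum : \sum_(v <- D) rho v ^+ 2 <= 8 * kd * (33 + k%:R) * x ^+ 105.
Proof.
have := moment2_le (count_D sums2) (level_D K1 incidence_cube sums2 P0 (ltW M0) x1 xN energy3).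
move=> h; apply: le_trans h _.
have kn : (0 < k * size P ^ 2)%N by rewrite muln_gt0 k1 expn_gt0 P0.
have := harmonic_le_ln R kn; set h := \sum_(j < _) _ => hh.
have lnx (y : R) : 0 < y -> ln y <= y by move=> y0; apply: ltW; apply: ln_sublinear.
(* The logarithm of [k N^2] is [ln k + 32 ln x], and each logarithm is at most its argument. *)
have : h <= (33 + k%:R) * x.
  apply: le_trans hh _; rewrite natrM lnM ?posrE ?ltr0n ?expn_gt0 ?P0 //.
  rewrite natrX -/N -xN -exprM lnXn // -[ln x *+ _]mulr_natr.
  have := lnx k%:R; rewrite ltr0n => /(_ k1) lk; have lx := lnx _ x0.
  have kx : k%:R <= k%:R * x by rewrite ler_peMr.
  have fin (s t u w y : R) : s <= u -> t <= y -> u <= w -> 1 <= y ->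
    1 + (s + t * 32) <= 33 * y + w by lra.
  by rewrite mulrDl; apply: fin lk lx kx x1.
have p104 : 0 <= x ^+ 104 by rewrite exprn_ge0 // ltW.
move=> hx; apply: le_trans (ler_wpM2l _ hx) _.
  exact: (mulr_ge0 (ler0n _ _) (mulr_ge0 (ltW kd0) p104)).
rewrite -/kd (exprSr x 104); move: (x ^+ 104) => X.
by rewrite [X in X <= _](_ : _ = 8 * kd * (33 + k%:R) * (X * x)) //; ring.
Qed.

Let b := 32 * kd.
(** Collects the constants of [tau ^+ 2], of the fourth power of [hg2] and of [energy4]. *)
Let q := (4 * (16 * b) ^+ 4 * M)^-1.
(** In the final comparison [q ^+ 7] is [q^4] from the squared number of triangles times [q^3] from
    [tau2 ^+ 3]; likewise [(64 b)^2 = (8 b)^2 * 4^3]. *)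
Definition gain_const : R := M * (8 * kd * (33 + k%:R)) * (64 * b) ^+ 2 / q ^+ 7.

Let b1 : 1 <= b. Proof. by rewrite /b; apply: (le_trans kd1); rewrite ler_peMl ?ler1n // ltW. Qed.
Let b0 : 0 < b. Proof. exact: lt_le_trans b1. Qed.
Let q0 : 0 < q. Proof. by rewrite /q invr_gt0 !mulr_gt0 ?exprn_gt0 ?mulr_gt0. Qed.
Let q1 : q <= 1.
Proof.
rewrite /q invf_le1 ?mulr_gt0 ?exprn_gt0 ?mulr_gt0 //.
have h : 1 <= (16 * b) ^+ 4 by rewrite exprn_ege1 // (le_trans b1) // ler_peMl ?ler1n // ltW.
by apply: mulr_ege1 M1; apply: mulr_ege1 h; rewrite ler1n.
Qed.

Lemma gain_const_gt0 : 0 < gain_const.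
Proof.
have k33 : 0 < 33 + k%:R :> R by rewrite ltr_wpDr ?ltr0n.
by rewrite /gain_const divr_gt0 ?mulr_gt0 ?exprn_gt0 ?mulr_gt0.
Qed.

(** The loss in [d] is [d^2] for the mass, [d^2 (d^2)^4 = d^10] for the star energy and for [tau2],
    [d^20] for the triangles, and finally [2 * 20 + 3 * 10 = 70]. *)
Lemma energy4_gain (d : R) : 1 <= d -> x ^+ 84 / d <= (energy P 4)%:R ->
  x ^+ 2 <= gain_const * d ^+ 70.
Proof.
move=> d1 hE; have d0 : 0 < d by apply: lt_le_trans d1.
have EE : (dot (sumset Y Y) (sumset Y Y))%:R = (energy P 4)%:R :> R by rewrite (energyD P 2 2).
have nE : (size Y)%:R = x ^+ 32 :> R by rewrite size_sums natrX -/N -xN -exprM.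
set E : R := (energy P 4)%:R in hE EE.
have E0 : 0 < E by apply: lt_le_trans hE; rewrite divr_gt0 ?exprn_gt0.
(* As [Y] has [x^32] elements, values below [tau] carry at most [E / 2]; the next [lam1] makes the
   tail at most [E / 4]. *)
pose tau := x ^+ 20 / (2 * d); have tau0 : 0 < tau by rewrite divr_gt0 ?exprn_gt0 ?mulr_gt0.
pose lam1 := 4 * b * d * x ^+ 20; have lam10 : 0 < lam1 by rewrite !mulr_gt0 ?exprn_gt0.
pose g : R := \sum_(v <- D) (tau <= rho v)%R%:R.
have hg : E <= 4 * lam1 * g.
  rewrite -EE; apply: (popular_mass tail) => //; first exact: ltW.
    rewrite nE EE /tau; apply: le_trans (_ : x ^+ 84 / d / 2 <= _); last by rewrite ler_pM2r.
    by rewrite [X in X <= _](_ : _ = x ^+ 84 / d / 2) //; field; rewrite gt_eqF.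
  rewrite EE; apply: le_trans (_ : x ^+ 84 / d / 4 <= _); last by rewrite ler_pM2r.
  rewrite /lam1 -/b [X in X <= _](_ : _ = x ^+ 84 / d / 4) //; field.
  by rewrite !gt_eqF.
have hg2 : x ^+ 64 / (16 * b * d ^+ 2) <= g.
  rewrite ler_pdivrMr ?mulr_gt0 ?exprn_gt0 //.
  have di0 : 0 < d^-1 by rewrite invr_gt0.
  rewrite -(ler_pM2r (exprn_gt0 20 x0)) -(ler_pM2r di0).
  rewrite [X in X <= _](_ : _ = x ^+ 84 / d); last by ring.
  apply: le_trans hE _; apply: le_trans hg _; rewrite /lam1.
  by rewrite [X in X <= _](_ : _ = g * (16 * b * d ^+ 2) * x ^+ 20 / d) //; field; rewrite gt_eqF.
have bn : b != 0 by rewrite gt_eqF. have dn : d != 0 by rewrite gt_eqF.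
have xn : x != 0 by rewrite gt_eqF. have Mn : M != 0 by rewrite gt_eqF.
have qn : q != 0 by rewrite gt_eqF.
have hQ := star_energy_ge Y (ltW tau0).
rewrite EE nE -/D -/g in hQ; set Q := star_energy Y tau in hQ.
have Q0 : 0 <= Q by apply: sumr_ge0.
have hQ2 : q * x ^+ 116 / d ^+ 10 <= Q.
  have xM : 0 < (x ^+ 32) ^+ 3 * (M * x ^+ 84) by rewrite !mulr_gt0 ?exprn_gt0.
  rewrite -(ler_pM2l xM).
  apply: (@le_trans _ _ (tau ^+ 2 * g ^+ 4)); last first.
    by apply: le_trans hQ _; rewrite ler_wpM2r // ler_pM2l ?exprn_gt0 // exprn_gt0.
  apply: (@le_trans _ _ (tau ^+ 2 * (x ^+ 64 / (16 * b * d ^+ 2)) ^+ 4)); last first.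
    rewrite ler_pM2l ?exprn_gt0 //; apply: lerXn2r => //; rewrite nnegrE.
      by apply: divr_ge0; rewrite ?mulr_ge0 ?exprn_ge0 ?ltW.
    by apply: sumr_ge0.
  rewrite [X in X <= _](_ : _ = tau ^+ 2 * (x ^+ 64 / (16 * b * d ^+ 2)) ^+ 4) //.
  by rewrite /q /tau; field; rewrite dn bn Mn.
(* [tau2], and [lam2] below, each make one of the two discarded parts of the star energy a quarter
   of its lower bound. *)
pose tau2 := q * x ^+ 20 / (4 * d ^+ 10).
have tau20 : 0 < tau2 by rewrite divr_gt0 ?mulr_gt0 ?exprn_gt0.
have tau2_le : tau2 <= tau.
  rewrite /tau2 /tau ler_pdivrMr ?mulr_gt0 ?exprn_gt0 //.
  rewrite [X in _ <= X](_ : _ = (2 * d ^+ 9) * x ^+ 20); last by field.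
  rewrite ler_pM2r ?exprn_gt0 //; apply: (le_trans q1).
  by apply: mulr_ege1; [rewrite ler1n|apply: exprn_ege1].
pose lam2 := 4 * b * d ^+ 10 * x ^+ 20 / q.
have lam20 : 0 < lam2 by rewrite divr_gt0 ?mulr_gt0 ?exprn_gt0.
have := star_energy_le tail tau tau20 lam20.
have := triangles_le tau20 tau2_le (Y := Y).
rewrite nE -/Q; set T : R := (size _)%:R => hT hQT.
have T_ge : q ^+ 2 * x ^+ 96 / (8 * b * d ^+ 20) <= T.
  rewrite -(ler_pM2l lam20).
  have e1 : tau2 * (x ^+ 32) ^+ 3 = q * x ^+ 116 / d ^+ 10 / 4 by rewrite /tau2; field.
  have e2 : x ^+ 32 * (32 * kd * x ^+ 104 / lam2) = q * x ^+ 116 / d ^+ 10 / 4.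
    by rewrite /lam2 -/b; field; rewrite qn xn dn bn.
  have e3 : lam2 * (q ^+ 2 * x ^+ 96 / (8 * b * d ^+ 20)) = q * x ^+ 116 / d ^+ 10 / 2.
    by rewrite /lam2; field; rewrite qn dn bn.
  by move: hQT hQ2; rewrite e1 e2 e3; lra.
have E6_le : \sum_(d <- D) \sum_(e <- D) rho (d + e) <= M * x ^+ 145.
  apply: le_trans energy6; rewrite -(sum_count_DD P) natr_sum.
  by rewrite le_eqVlt; apply/ssrbool.orP; left; apply/eqP; apply: eq_bigr => e _; rewrite natr_sum.
have h6 := hT _ _ E6_le sqr_sum.
have h7 : (q ^+ 2 * x ^+ 96 / (8 * b * d ^+ 20)) ^+ 2 * tau2 ^+ 3 <=
    M * x ^+ 145 * (8 * kd * (33 + k%:R) * x ^+ 105).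
  apply: le_trans h6; rewrite ler_wpM2r ?exprn_ge0 ?(ltW tau20) //.
  have A0 : 0 < q ^+ 2 * x ^+ 96 / (8 * b * d ^+ 20) by rewrite divr_gt0 ?mulr_gt0 ?exprn_gt0.
  by apply: lerXn2r; rewrite ?nnegrE ?(ltW A0) ?ler0n.
have c0 : 0 < q ^+ 7 * x ^+ 250 / ((64 * b) ^+ 2 * d ^+ 70).
  by rewrite divr_gt0 ?mulr_gt0 ?exprn_gt0 ?mulr_gt0.
rewrite -(ler_pM2r c0) /gain_const.
rewrite [X in X <= _](_ : _ = (q ^+ 2 * x ^+ 96 / (8 * b * d ^+ 20)) ^+ 2 * tau2 ^+ 3); last first.
  by rewrite /tau2; field; rewrite dn bn.
rewrite [X in _ <= X](_ : _ = M * x ^+ 145 * (8 * kd * (33 + k%:R) * x ^+ 105)) //.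
by field; rewrite dn bn qn.
Qed.

End Gain.

(** * Representation counts *)

Lemma c0_ge0 (R : realType) : 0 <= c0 :> R.
Proof. by rewrite /c0 divr_ge0. Qed.

(** For [d = N^c0] the loss [d^70] is at most [x], against the gain [x^2]. *)
Lemma c0_le (R : realType) : c0 * 70 <= 16^-1 :> R.
Proof. rewrite /c0; lra. Qed.

Lemma c0_le_quarter (R : realType) : c0 <= 1 / 4 :> R.
Proof. by have := c0_le R; have := c0_ge0 R; lra. Qed.

(** * Explicit exponents for energies and representation counts *)

Section EnergyBounds.
Variables (R : realType) (G : zmodType) (P : seq G) (K : R) (k : nat).
Hypothesis K1 : 1 <= K.
Hypothesis incidence_cube : forall X Z : seq G, uniq X -> uniq Z ->
  (incidences P X Z)%:R ^+ 3 <=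
  K * ((size X)%:R ^+ 2 * (size Z)%:R ^+ 2 + (size X)%:R ^+ 3 + (size Z)%:R ^+ 3) :> R.
Hypothesis sums2 : forall z, (count_mem z (sums P 2) <= k)%N.
Hypothesis k1 : (0 < k)%N.
Hypothesis P0 : (0 < size P)%N.
Let N : R := (size P)%:R.
Let N1 : 1 <= N. Proof. by rewrite ler1n. Qed.
Let N0 : 0 < N. Proof. by rewrite ltr0n. Qed.

Let pow1 (a : R) : 0 <= a -> 1 <= N `^ a.
Proof. by move=> a0; rewrite -[X in X <= _](powRr0 N) ler_powR. Qed.

Definition base_const : R := (50 * K) ^+ 3 + 4 * K * k%:R + k%:R.

Let K0 : 0 < K. Proof. exact: lt_le_trans K1. Qed.
Let c1 : 0 <= (50 * K) ^+ 3. Proof. exact: (exprn_ge0 3 (mulr_ge0 (ler0n _ _) (ltW K0))). Qed.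
Let c2 : 0 <= 4 * K * k%:R. Proof. by rewrite !mulr_ge0 // ltW. Qed.

Lemma base_const_ge1 : 1 <= base_const.
Proof.
have : 1 <= k%:R :> R by rewrite ler1n.
by move/le_trans; apply; rewrite /base_const ler_wpDl // addr_ge0.
Qed.

Let cube_le_base : (50 * K) ^+ 3 <= base_const.
Proof. by rewrite /base_const -addrA ler_wpDr // addr_ge0. Qed.

Let linear_le_base : 4 * K * k%:R <= base_const.
Proof. by rewrite /base_const addrAC ler_wpDl // addr_ge0. Qed.

Let powR_half_sqr (a : R) : (N `^ (a / 2)) ^+ 2 = N `^ a.
Proof.
rewrite expr2 -powRD; first by congr (N `^ _); field.
by apply/implyP => _; rewrite gt_eqF.
Qed.

(** The start [E_2 << N^2] is read as [N * N^1]: the excess exponent 1 is halved at each step. *)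
Lemma energy_base s :
  (energy P s.+2)%:R <= base_const * (N ^+ (2 * s + 1) * N `^ (2^-1 ^+ s)).
Proof.
elim: s => [|s IH].
  rewrite muln0 add0n expr0 powRr1 ?(ltW N0) // expr1 -expr2.
  apply: le_trans (energy2_le R sums2) _; rewrite ler_wpM2r ?exprn_ge0 ?ler0n //.
  by rewrite /base_const ler_wpDl // addr_ge0.
rewrite (_ : 2 * s.+1 + 1 = 2 * s + 3)%N; last by clear; lia.
have h2 : (N `^ (2^-1 ^+ s.+1)) ^+ 2 = N `^ (2^-1 ^+ s).
  by rewrite [2^-1 ^+ s.+1]exprSr powR_half_sqr.
apply: (energy_step K1 incidence_cube sums2 P0).
- by apply: pow1; rewrite exprn_ge0 ?invr_ge0.
- exact: cube_le_base.
- exact: linear_le_base.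
- by rewrite h2.
Qed.

Let x := N `^ (16^-1).
Let x1 : 1 <= x. Proof. by apply: pow1; rewrite invr_ge0. Qed.
Let xN : x ^+ 16 = N.
Proof. by rewrite /x -powR_mulrn ?powR_ge0 // -powRrM mulVf ?powRr1 // ltW. Qed.

Let xpow (m : nat) (a : R) : a = m%:R / 16 -> N `^ a = x ^+ m.
Proof. by move=> ->; rewrite /x -powR_mulrn ?powR_ge0 // -powRrM mulrC. Qed.

Let NX n : N ^+ n = x ^+ (16 * n). Proof. by rewrite -xN -exprM. Qed.

Lemma energy4_le_size : (energy P 4)%:R <= N ^+ 8.
Proof.
rewrite -natrX ler_nat; apply: leq_trans (dot_le_size (fun z => count_size _ _)) _.
by rewrite size_sums -expnD.
Qed.

Definition energy4_const : R := 1 + gain_const K k base_const ^+ 128.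

(** If the bound fails with constant 1, [energy4_gain] with [d = N^c0] yields [x <= gain_const];
    then [E_4 <= N^8 = x^128] is bounded by a constant. *)
Lemma energy4_le :
  (energy P 4)%:R <= energy4_const * (N ^+ 5 * N `^ (1 / 4 - c0)).
Proof.
have g0 : 0 < gain_const K k base_const by exact (gain_const_gt0 K1 base_const_ge1 k1).
have g128 : 0 <= gain_const K k base_const ^+ 128 by rewrite exprn_ge0 // ltW.
have c00 := c0_ge0 R; have c14 := c0_le_quarter R.
have big : 1 <= N ^+ 5 * N `^ (1 / 4 - c0).
  by apply: mulr_ege1; [exact: exprn_ege1|apply: pow1; rewrite subr_ge0].
have [small|large] := leP ((energy P 4)%:R : R) (N ^+ 5 * N `^ (1 / 4 - c0)).
  by apply: le_trans small _; rewrite ler_peMl ?ler_wpDr // (le_trans _ big).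
have d1 : 1 <= N `^ c0 by apply: pow1.
have d0 : 0 < N `^ c0 by apply: lt_le_trans d1.
have hd : x ^+ 84 / N `^ c0 <= (energy P 4)%:R.
  apply: le_trans (ltW large).
  rewrite NX (_ : 84 = 16 * 5 + 4)%N // exprD -(@xpow 4 (1 / 4)); last by field.
  rewrite powRB; last by apply/implyP => _; rewrite gt_eqF.
  by rewrite mulrA.
have e3 := energy_base 1; have e4 := energy_base 2; have e6 := energy_base 4.
rewrite (@xpow 8) in e3; last by field.
rewrite (@xpow 4) in e4; last by field.
rewrite (@xpow 1) in e6; last by field.
rewrite NX -exprD in e3; rewrite NX -exprD in e4; rewrite NX -exprD in e6.
have gain := energy4_gain K1 incidence_cube sums2 P0 base_const_ge1 k1 x1 xN e3 e4 e6 d1 hd.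
have d70 : N `^ c0 ^+ 70 <= x.
  by rewrite -powR_mulrn ?(ltW d0) // -powRrM /x ler_powR // c0_le.
have xg : x <= gain_const K k base_const.
  have d70p : 0 < N `^ c0 ^+ 70 by rewrite exprn_gt0.
  rewrite -(ler_pM2r d70p); apply: le_trans gain; rewrite expr2 ler_pM2l //.
  exact: lt_le_trans x1.
apply: le_trans energy4_le_size _; apply: (@le_trans _ _ energy4_const).
  rewrite NX /energy4_const ler_wpDl // (_ : 16 * 8 = 128)%N //.
  by apply: lerXn2r => //; rewrite nnegrE ?(ltW g0) // (le_trans _ x1).
by rewrite ler_peMr // addr_ge0.
Qed.

Definition energy_const : R := base_const + energy4_const.

Let energy4_const_ge0 : 0 <= energy4_const.
Proof.
have g0 : 0 < gain_const K k base_const by exact (gain_const_gt0 K1 base_const_ge1 k1).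
by rewrite addr_ge0 // exprn_ge0 // ltW.
Qed.

Lemma energy_gain t :
  (energy P t.+4)%:R <= energy_const * (N ^+ (2 * t.+2 + 1) * N `^ ((1 / 4 - c0) * 2^-1 ^+ t)).
Proof.
have c14 := c0_le_quarter R.
elim: t => [|t IH].
  rewrite expr0 mulr1; apply: le_trans energy4_le _.
  rewrite ler_wpM2r ?mulr_ge0 ?exprn_ge0 ?powR_ge0 ?ler0n //.
  by rewrite /energy_const ler_wpDl // (le_trans _ base_const_ge1).
rewrite (_ : 2 * t.+3 + 1 = 2 * t.+2 + 3)%N; last by clear; lia.
have h2 : (N `^ ((1 / 4 - c0) * 2^-1 ^+ t.+1)) ^+ 2 = N `^ ((1 / 4 - c0) * 2^-1 ^+ t).
  by rewrite [2^-1 ^+ t.+1]exprSr mulrA powR_half_sqr.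
apply: (energy_step K1 incidence_cube sums2 P0).
- by apply: pow1; rewrite mulr_ge0 ?subr_ge0 // exprn_ge0 ?invr_ge0.
- by apply: le_trans cube_le_base _; rewrite /energy_const ler_wpDr.
- by apply: le_trans linear_le_base _; rewrite /energy_const ler_wpDr.
- by rewrite h2.
Qed.

Definition count_const : R := energy_const + K * (25 * cbrt energy_const ^+ 2 + 2 * k%:R).

Let energy_const_ge0 : 0 <= energy_const.
Proof. by apply: addr_ge0 => //; apply: le_trans base_const_ge1. Qed.

Let odd_const_ge0 : 0 <= K * (25 * cbrt energy_const ^+ 2 + 2 * k%:R).
Proof. by apply: mulr_ge0; [exact: ltW|rewrite addr_ge0 ?mulr_ge0 ?exprn_ge0 ?cbrt_ge0]. Qed.

Lemma count_const_gt0 : 0 < count_const.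
Proof.
apply: ltr_wpDr => //; apply: ltr_wpDr => //; exact: lt_le_trans base_const_ge1.
Qed.

Let mulr_expr_powR (m : nat) (a : R) : N ^+ m * N `^ a = N `^ (m%:R + a).
Proof.
rewrite powRD; last by apply/implyP => _; rewrite gt_eqF.
by rewrite powR_mulrn // ltW.
Qed.

Lemma count_even_powR s (a e : R) n :
  (energy P s.+2)%:R <= energy_const * (N ^+ (2 * s + 1) * N `^ a) ->
  (2 * s + 1)%N%:R + a <= e ->
  (count_mem n (sums P (2 * s.+2)))%:R <= count_const * N `^ e.
Proof.
move=> hE he; rewrite mul2n -addnn.
have := count_even_le R P s.+2 n; rewrite -(ler_nat R) => h.
apply: le_trans h _; apply: le_trans hE _; rewrite mulr_expr_powR.
apply: ler_pM; rewrite ?powR_ge0 //; first by rewrite /count_const ler_wpDr.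
exact: ler_powR.
Qed.

Lemma count_odd_powR s (a e : R) n : 0 <= a ->
  (energy P s.+2)%:R <= energy_const * (N ^+ (2 * s + 1) * N `^ a) ->
  (2 * s + 2)%N%:R + 2 * a / 3 <= e ->
  (count_mem n (sums P (2 * s.+2 + 1)))%:R <= count_const * N `^ e.
Proof.
move=> a0 hE he; rewrite (_ : 2 * s.+2 + 1 = s.+3 + s.+2)%N; last by clear; lia.
have g1 : 1 <= N `^ (a / 3) by apply: pow1; rewrite divr_ge0.
have g3 : N `^ (a / 3) ^+ 3 = N `^ a.
  by rewrite -powR_mulrn ?powR_ge0 // -powRrM divfK // pnatr_eq0.
have g2 : N `^ (a / 3) ^+ 2 = N `^ (2 * a / 3).
  by rewrite -powR_mulrn ?powR_ge0 // -powRrM; congr (N `^ _); field.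
rewrite -g3 in hE.
have := count_odd_le K1 incidence_cube sums2 P0 n g1 energy_const_ge0 hE.
move=> h; apply: le_trans h _; rewrite -/N g2 mulr_expr_powR.
apply: ler_pM; rewrite ?powR_ge0 //; first by rewrite /count_const ler_wpDl.
exact: ler_powR.
Qed.

Let energy_base' s :
  (energy P s.+2)%:R <= energy_const * (N ^+ (2 * s + 1) * N `^ (2^-1 ^+ s)).
Proof.
apply: le_trans (energy_base s) _; rewrite ler_wpM2r ?mulr_ge0 ?powR_ge0 ?exprn_ge0 ?ler0n //.
by rewrite /energy_const ler_wpDr.
Qed.

Lemma count_le p n :
  ((2 <= p)%N -> (count_mem n (sums P (2 * p + 1)))%:R <=
     count_const * N `^ (2 * p%:R - 2 + sigma p)) /\
  ((3 <= p)%N -> (count_mem n (sums P (2 * p)))%:R <=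
     count_const * N `^ (2 * p%:R - 3 + sigma' p)).
Proof.
have c14 : 0 <= 1 / 4 - c0 :> R by rewrite subr_ge0 c0_le_quarter.
have two_pow (t : nat) : 2 `^ (- t%:R) = 2^-1 ^+ t :> R.
  by rewrite powRN powR_mulrn // exprVn.
case: p => [|[|[|[|t]]]]; split => // _.
- apply: (count_odd_powR _ _ (energy_base' 0)) => //.
  by rewrite expr0 /sigma eqxx; lra.
- apply: (count_odd_powR _ _ (energy_base' 1)); first by rewrite expr1 invr_ge0.
  by rewrite expr1 /sigma /=; lra.
- apply: (count_even_powR _ (energy_base' 1)).
  by rewrite expr1 /sigma' eqxx; lra.
- apply: (count_odd_powR _ _ (energy_gain t)); first by rewrite mulr_ge0 // exprn_ge0 ?invr_ge0.
  rewrite /sigma /= (_ : - t.+4%:R + 5 = 1 - t%:R :> R); last first.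
    by rewrite -[t.+4]addn4 natrD; ring.
  rewrite powRD; last by apply/implyP => _; rewrite pnatr_eq0.
  rewrite powRr1 // two_pow.
  rewrite -[t.+4]addn4 !natrD !natrM -[t.+2]addn2 !natrD; move: (2^-1 ^+ t) => h.
  by rewrite le_eqVlt; apply/ssrbool.orP; left; apply/eqP; field.
- apply: (count_even_powR _ (energy_gain t)).
  (* For [p = 4] the exponent [1/4 - c0] reached here is at most the claimed [1/4 - c0/3]. *)
  have [->|t0] := posnP t.
    by rewrite expr0 /sigma' /=; have := c0_ge0 R; lra.
  rewrite /sigma' (_ : (t.+4 == 3) = false) // (_ : (t.+4 == 4)%N = false); last first.
    by move: t0; clear; lia.
  rewrite (_ : - t.+4%:R + 4 = - t%:R :> R); last by rewrite -[t.+4]addn4 natrD; ring.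
  rewrite two_pow -[t.+4]addn4 !natrD !natrM -[t.+2]addn2 !natrD; move: (2^-1 ^+ t) => h.
  by rewrite le_eqVlt; apply/ssrbool.orP; left; apply/eqP; field.
Qed.

End EnergyBounds.

Lemma sum_sums_ffun (G : zmodType) (V : nmodType) (T : finType) (f : T -> G) (s : nat) (F : G -> V) :
  \sum_(z <- sums [seq f t | t : T] s) F z =
  \sum_(x : {ffun 'I_s -> T}) F (\sum_(i < s) f (x i)).
Proof.
elim: s F => [|s IH] F.
  have x0 (x y : {ffun 'I_0 -> T}) : x = y by apply/ffunP => -[].
  rewrite big_seq1 (big_pred1 (ffun0 (card_ord 0))) => [|x]; first by rewrite big_ord0.
  by rewrite /= (x0 x (ffun0 (card_ord 0))) eqxx.
pose ext (p : {ffun 'I_s -> T} * T) : {ffun 'I_s.+1 -> T} :=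
  [ffun i => oapp p.1 p.2 (unlift ord_max i)].
have ext_bij : bijective ext.
  exists (fun x : {ffun 'I_s.+1 -> T} => ([ffun i => x (lift ord_max i)], x ord_max)).
    case=> x t; congr pair; last by rewrite ffunE unlift_none.
    by apply/ffunP => i; rewrite !ffunE liftK.
  by move=> x; apply/ffunP => i; rewrite ffunE; case: unliftP => [j|] -> /=; rewrite ?ffunE.
rewrite sum_sumset IH (reindex ext) /=; last by apply: onW_bij.
rewrite -(pair_bigA _ (fun x t => F (\sum_(i < s.+1) f (ext (x, t) i)))) /=.
apply: eq_bigr => x _; rewrite big_map big_enum; apply: eq_bigr => t _.
rewrite (bigD1_ord ord_max) // ffunE unlift_none /= addrC.
by congr (F (_ + _)); apply: eq_bigr => i _; rewrite ffunE liftK.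
Qed.

(** * Transfer to the points of the graph *)

Section Representations.
Variables (R : realType) (psi : R -> R) (A : {fset R}).

Definition graph_points : seq (R * R) := [seq (val t, psi (val t)) | t : A].

Lemma size_graph_points : size graph_points = #|` A|%fset.
Proof. by rewrite size_map -cardE -cardfE. Qed.

Lemma graph_points_uniq : uniq graph_points.
Proof. by rewrite map_inj_uniq ?enum_uniq // => a b [/val_inj]. Qed.

Lemma rep_countE s n : rep_count psi A s n = count_mem n (sums graph_points s).
Proof.
rewrite count_sum (sum_sums_ffun _ _ (fun x => nat_of_bool (x == n))) /rep_count.
rewrite -sum1dep_card big_mkcond; apply: eq_bigr => x _.
rewrite -pair_eqE /pair_eq /= (raddf_sum fst) (raddf_sum snd) /=.
by case: (_ && _).
Qed.

End Representations.

(** Points of a graph are determined by their abscissae, so the representations inject into the set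
    of [sum_condition]. *)
Lemma count_sums2_le (R : realType) (C : R) (k : nat) (I : interval R) (psi : R -> R)
    (P : seq (R * R)) z :
  C <= k%:R -> sum_condition I psi C -> uniq P ->
  (forall p, p \in P -> p.1 \in I /\ psi p.1 = p.2) -> (count_mem z (sums P 2) <= k)%N.
Proof.
move=> Ck sI uP PI.
pose L := [seq x <- [seq (p, q) | p <- P, q <- P] | x.1 + x.2 == z].
have LP x : x \in L -> [/\ x.1 \in P, x.2 \in P & x.1 + x.2 = z].
  by rewrite mem_filter => /andP[/eqP <- /allpairsP[[p q] /= [? ? ->]]].
have -> : count_mem z (sums P 2) = size L.
  rewrite size_filter count_sum (sum_sums2 _ (fun x => nat_of_bool (x == z))) -sum1_count.
  rewrite [RHS]big_mkcond big_allpairs /=; do 2!apply: eq_bigr => ? _.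
  by case: eqP.
rewrite -(size_map (fun x => (x.1.1, x.2.1))).
apply: (card_at_most_size Ck (sI z.1 z.2)).
  rewrite map_inj_in_uniq.
    by rewrite filter_uniq // allpairs_uniq // => -[? ?] [? ?].
  move=> [[p1 p2] [q1 q2]] [[r1 r2] [t1 t2]] /LP[/PI/= [_ <-] /PI/= [_ <-] _].
  by move=> /LP[/PI/= [_ <-] /PI/= [_ <-] _] /= [-> ->].
move=> _ /mapP[[p q] /LP[/= /PI[pI pe] /PI[qI qe] <-] ->] /=.
by split => //=; rewrite pe qe.
Qed.

Theorem theorem2p4 (R : realType) (C : R) (hC : 0 < C) :
  exists2 K : R, 0 < K &
    forall (I : interval R) (psi : R -> R),
      {within [set` I], continuous psi} ->
      diff_condition I psi C ->
      sum_condition I psi C ->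
      forall A : {fset R}, (forall x : R, x \in A -> x \in I) -> A != fset0 ->
      forall p : nat,
        ((2 <= p)%N ->
           rep_sup psi A (2 * p + 1)%N
             <= K * (#|` A|%fset)%:R `^ (2 * p%:R - 2 + sigma p)) /\
        ((3 <= p)%N ->
           rep_sup psi A (2 * p)%N
             <= K * (#|` A|%fset)%:R `^ (2 * p%:R - 3 + sigma' p)).
Proof.
pose k := (Num.bound C).
have Ck : C <= k%:R by apply/ltW/archi_boundP/ltW.
have k0 : (0 < k)%N by rewrite -(ltr_nat R); apply: lt_le_trans Ck.
pose K : R := (3168 * k ^ 3 + 4)%N%:R.
have K1 : 1 <= K by rewrite ler1n addn_gt0 orbT.
(* This depends on [C] only, through [k]. *)
exists (count_const K k); first exact: count_const_gt0.
move=> I psi cpsi dI sI A AI A0 p.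
pose P := graph_points psi A.
have PI q : q \in P -> q.1 \in I /\ psi q.1 = q.2.
  by move=> /mapP[t _ ->]; split => //=; apply: AI; apply: valP.
have uP : uniq P by apply: graph_points_uniq.
have P0 : (0 < size P)%N by rewrite size_graph_points cardfs_gt0.
have s2 z : (count_mem z (sums P 2) <= k)%N by exact: (count_sums2_le z Ck sI uP PI).
have inc X Z : uniq X -> uniq Z -> (incidences P X Z)%:R ^+ 3 <=
  K * ((size X)%:R ^+ 2 * (size Z)%:R ^+ 2 + (size X)%:R ^+ 3 + (size Z)%:R ^+ 3) :> R.
  move=> uX uZ; rewrite -!natrX -natrM -!natrD -natrM ler_nat.
  exact: (incidence_bound cpsi dI Ck).
have := count_le K1 inc s2 k0 P0 p.
rewrite size_graph_points => h.
have sup_le s B : (forall n, (count_mem n (sums P s))%:R <= B) -> rep_sup psi A s <= B.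
  move=> hB; apply: ge_sup; first by exists (rep_count psi A s 0)%:R; exists 0.
  by move=> _ [n _ <-]; rewrite rep_countE.
split=> p2; apply: sup_le => n; have [] := h n; auto.
Qed.
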